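(* Assume the standing setting with $I=(0,\infty)$, and that $X$ a.s. has no negative jumps. Suppose there exist $Q\in(0,\infty)$, $z_0\in[0,\infty)$, $\theta\in(z_0,\infty)$ and a $C^1$ map $g:[z_0,\infty)\to[0,\infty)$ with $g>0$ on $(z_0,\infty)$, $g(z_0)=0$, $\lim_{z\to\infty}g(z)=\infty$ and $\int_\theta^\infty\frac{dz}{g(z)}=\infty$, such that $$\mathbb{P}_x[e^{-qT_\ell^-};T_\ell^-<\zeta]=\frac{\int_{z_0}^\infty\frac{1}{g(z)}\exp\big(-xz+\int_\theta^z\frac{q}{g}\big)dz}{\int_{z_0}^\infty\frac{1}{g(z)}\exp\big(-\ell z+\int_\theta^z\frac{q}{g}\big)dz}\quad\text{for all }0<\ell\le x\text{ and all }q\in(Q,\infty).$$ Then there exist a Laplace exponent $\psi$ of a spectrally positive Lévy process and $p\in[0,\infty)$, with $\int^\infty_{\psi^{-1}(0)+1}\frac{dz}{\psi(z)}=\infty$, such that $X$ under $(\mathbb{P}_x)_{x\in(0,\infty)}$ has the law of a continuous-state branching process with branching mechanism $\psi-p$ (with state space $(0,\infty)$ and cemetery $\infty$); necessarily $z_0=\psi^{-1}(p)$ and $g=(\psi-p)|_{[\psi^{-1}(p),\infty)}$. In particular the laws of $X$ are uniquely determined by $z_0$ and $g$.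
   Context: Standing setting: $I\subset\mathbb{R}$ is an interval unbounded above. $X=(X_t)_{t\in[0,\zeta)}$ is a process under complete probability measures $(\mathbb{P}_x)_{x\in I}$ (whose domains all contain $\mathcal{F}_\infty$), adapted to a filtration $\mathcal{F}=(\mathcal{F}_t)_{t\ge0}$ that is complete in the sense that each $\mathcal{F}_t$ contains every set differing from an event of $\mathcal{F}_t$ by a set that is $\mathbb{P}_x$-null for all $x\in I$. The lifetime $\zeta$ is an $\mathcal{F}$-stopping time with $\zeta>0$ a.s., and $X_t:=\infty$ (cemetery) for $t\ge\zeta$. ''a.s.'' means $\mathbb{P}_x$-a.s. for every $x\in I$, and ''negligible'' means $\mathbb{P}_x$-null for every $x$. Assumptions: paths of $X$ are càdlàg in $I$ on $[0,\zeta)$; on $\{0<\zeta<\infty\}$ the limit $X_{\zeta-}$ exists in $I\cup\{\infty\}$ a.s. (set $X_{\zeta-}:=\infty$ when it does not exist); $x\mapsto\mathbb{P}_x(t<\zeta,X_t\in A)$ is universally measurable for Borel $A\subset I$; normality: $X_0=x$ $\mathbb{P}_x$-a.s.; strong Markov: for every $\mathcal{F}$-stopping time $S$ and measurable $H\ge0$, $\mathbb{P}_x[H(X_{S+\cdot})\mid\mathcal{F}_S]=\mathbb{P}_{X_S}[H(X)]$ $\mathbb{P}_x$-a.s. on $\{S<\zeta\}$; quasi left-continuity: if $\mathcal{F}$-stopping times $T_n$ increase a.s. to $T$ then $X_{T_n}\to X_T$ a.s. on $\{T<\zeta\}$; non-announceability: for every a.s. nondecreasing sequence $(T_n)$ of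 $\mathcal{F}$-stopping times, the event $\{T_n<\zeta\ \forall n\}\cap\{\lim_n T_n=\zeta\}\cap\{\zeta<\infty,X_{\zeta-}<\infty\}$ is negligible. Notation: $\mathbb{P}_x[Y;A]:=\mathbb{E}_x[Y\mathbf{1}_A]$; for $\ell\in I$, $T_\ell^-:=\inf\{t\in[0,\zeta):X_t\le\ell\}$ ($\inf\emptyset=\infty$). A spectrally positive Lévy process is a Lévy process with no negative jumps that is not a subordinator; its Laplace exponent is $\psi(z)=\log\mathbb{E}_0[e^{-z\xi_1}]=-\gamma z+\frac{\sigma^2}{2}z^2+\int_{(0,\infty)}(e^{-zh}+zh\mathbf{1}_{(0,1]}(h)-1)\,\mathsf{m}(dh)$, $z\ge0$, so $\psi(0)=0$; $\psi^{-1}$ is its right-continuous inverse. A continuous-state branching process with branching mechanism $\psi-p$ ($p\ge0$) is a Markov process with values in $[0,\infty]$ (with $\infty$ absorbing/cemetery) such that $\mathbb{E}_x[e^{-\lambda X_t}]=e^{-xu_t(\lambda)}$ for $x,\lambda,t\ge0$ (with $e^{-\lambda\infty}:=0$), where $u_t(\lambda)$ solves $\partial_tu_t(\lambda)+\psi(u_t(\lambda))-p=0$, $u_0(\lambda)=\lambda$; equivalently it has the branching property $\mathbb{P}_{x_1+x_2}\circ X_t^{-1}=(\mathbb{P}_{x_1}\circ X_t^{-1})*(\mathbb{P}_{x_2}\circ X_t^{-1})$. When $\int^\infty_{\psi^{-1}(0)+1}\frac{1}{\psi}=\infty$ it does not hit $0$ from $x>0$, so its state space may be taken to be $(0,\infty)$.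 *)

(* Defs.v *)
From HB Require Import structures.
From mathcomp Require Import all_boot all_order all_algebra.
From mathcomp Require Import all_classical all_reals all_analysis.
From mathcomp Require Import measurable_realfun lebesgue_measure.
Import Order.TTheory GRing.Theory Num.Theory.
Import numFieldNormedType.Exports.
Set Implicit Arguments.
Unset Strict Implicit.
Unset Printing Implicit Defensive.
Local Open Scope classical_set_scope.
Local Open Scope ring_scope.

Section setting.
Context (R : realType) (d : measure_display) (Omega : measurableType d).
(* filtration (only t >= 0 matters), family of laws (only x > 0 matters),
   the process X on [0, zeta) and its lifetime zeta *)
Variables (F : R -> set (set Omega)) (P : R -> probability Omega R)
          (X : R -> Omega -> R) (zeta : Omega -> \bar R).

Definition negl (N : set Omega) := forall x, 0 < x -> (P x).-negligible N.

Definition Xe (t : R) (w : Omega) : \bar R :=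
  if (t%:E < zeta w)%E then (X t w)%:E else +oo%E.

Definition filtration :=
  (forall t, 0 <= t -> sigma_algebra setT (F t) /\ F t `<=` measurable) /\
  (forall s t, 0 <= s <= t -> F s `<=` F t).

Definition filtration_complete :=
  forall t A B, 0 <= t -> F t A -> negl ((A `\` B) `|` (B `\` A)) -> F t B.

Definition F_infty := <<s \bigcup_(t in [set t : R | 0 <= t]) F t >>.

Definition stopping_time (T : Omega -> \bar R) :=
  (forall w, (0 <= T w)%E) /\
  (forall t, 0 <= t -> F t [set w | (T w <= t%:E)%E]).

Definition F_at (S : Omega -> \bar R) : set (set Omega) :=
  [set A | F_infty A /\
     forall t, 0 <= t -> F t (A `&` [set w | (S w <= t%:E)%E])].

(* left limit X_{zeta-} in (0,oo] (set to +oo when it does not exist) *)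
Definition Xzeta_minus (w : Omega) : \bar R :=
  if pselect (exists l : \bar R, (0 < l)%E /\
        (fun s => (X s w)%:E) @ (fine (zeta w))^'- --> l)
  then lim ((fun s => (X s w)%:E) @ (fine (zeta w))^'-) else +oo%E.

Definition cadlag_paths :=
  forall w t, 0 <= t -> (t%:E < zeta w)%E ->
    0 < X t w /\ (X ^~ w) @ t^'+ --> X t w /\
    (0 < t -> exists2 l : R, 0 < l & (X ^~ w) @ t^'- --> l).

Definition left_limit_at_zeta :=
  negl [set w | (0 < zeta w < +oo)%E /\
     ~ (exists l : \bar R, (0 < l)%E /\
          (fun s => (X s w)%:E) @ (fine (zeta w))^'- --> l)].

Definition univ_measurable (D : set R) (f : R -> R) :=
  forall mu : probability R R, exists g : R -> R,
    measurable_fun D g /\ mu.-negligible (D `&` [set x | f x <> g x]).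

Definition transition_univ_meas :=
  forall t (A : set R), 0 <= t -> measurable A -> A `<=` `]0%R, +oo[ ->
    univ_measurable `]0%R, +oo[
      (fun x => fine (P x [set w | (t%:E < zeta w)%E /\ A (X t w)])).

Definition normal :=
  forall x, 0 < x -> (P x).-negligible [set w | Xe 0 w <> x%:E].

Definition cylinders : set (set (R -> \bar R)) :=
  [set C | exists (t : R) (B : set (\bar R)), 0 <= t /\
           measurable B /\ C = (fun u : R -> \bar R => u t) @^-1` B].

Definition path_measurable (H : (R -> \bar R) -> \bar R) :=
  forall B : set (\bar R), measurable B -> <<s cylinders >> (H @^-1` B).

Definition EH (y : R) (H : (R -> \bar R) -> \bar R) : \bar R :=
  (\int[P y]_w H (fun t => Xe t w))%E.

(* P_x[ H(X_{S+.}) | F_S ] = P_{X_S}[H(X)] P_x-a.s. on {S < zeta} *)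
Definition strong_markov :=
  forall (S : Omega -> \bar R) (H : (R -> \bar R) -> \bar R) x,
    stopping_time S -> path_measurable H -> (forall u, (0 <= H u)%E) ->
    0 < x ->
    exists Y : Omega -> \bar R,
      [/\ forall w, (0 <= Y w)%E,
          forall B : set (\bar R), measurable B -> F_at S (Y @^-1` B),
          forall A, F_at S A ->
            (\int[P x]_(w in A) Y w =
             \int[P x]_(w in A) H (fun u => Xe (fine (S w) + u) w))%E &
          {ae P x, forall w, (S w < zeta w)%E ->
                      Y w = EH (fine (Xe (fine (S w)) w)) H}].

Definition as_nondecr_to (Tn : nat -> Omega -> \bar R) (T : Omega -> \bar R) :=
  negl [set w | ~ ({homo (fun n => Tn n w) : m n / (m <= n)%N >-> (m <= n)%E}
                  /\ (fun n => Tn n w) @ \oo --> T w)].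

Definition quasi_left_continuous :=
  forall (Tn : nat -> Omega -> \bar R) (T : Omega -> \bar R),
    (forall n, stopping_time (Tn n)) -> stopping_time T ->
    as_nondecr_to Tn T ->
    negl [set w | (T w < zeta w)%E /\
       ~ ((fun n => Xe (fine (Tn n w)) w) @ \oo --> Xe (fine (T w)) w)].

Definition non_announceable :=
  forall Tn : nat -> Omega -> \bar R,
    (forall n, stopping_time (Tn n)) ->
    negl [set w | ~ {homo (fun n => Tn n w) : m n / (m <= n)%N >-> (m <= n)%E}] ->
    negl [set w | (forall n, (Tn n w < zeta w)%E) /\
                  ereal_sup (range (fun n => Tn n w)) = zeta w /\
                  (zeta w < +oo)%E /\ (Xzeta_minus w < +oo)%E].

Definition standing_setting :=
  [/\ filtration /\ filtration_complete, stopping_time zeta,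
      negl [set w | (zeta w <= 0)%E], cadlag_paths /\ left_limit_at_zeta &
      [/\ transition_univ_meas, normal, strong_markov,
          quasi_left_continuous & non_announceable]].

Definition no_negative_jumps :=
  negl [set w | exists (t l : R), 0 < t /\ (t%:E < zeta w)%E /\
                  (X ^~ w) @ t^'- --> l /\ X t w < l].

Definition T_below (l : R) (w : Omega) : \bar R :=
  ereal_inf [set t%:E | t in [set t : R | 0 <= t /\ (t%:E < zeta w)%E /\ X t w <= l]].

Definition laplace_passage (x q l : R) : \bar R :=
  (\int[P x]_w (if (T_below l w < zeta w)%E
                then (expR (- (q * fine (T_below l w))))%:E else 0%E))%E.

End setting.

Section analytic.
Context (R : realType).
Notation leb := (@lebesgue_measure R).

Definition ointegral (a b : R) (f : R -> R) : R :=
  if a <= b then (\int[leb]_(z in `[a, b]) f z)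
  else - (\int[leb]_(z in `[b, a]) f z).

Definition C1_on_halfline (z0 : R) (g : R -> R) :=
  exists h : R -> R,
    {within `[z0, +oo[, continuous h} /\
    (forall z, z0 < z -> is_derive z 1 g (h z)) /\
    (fun e => (g (z0 + e) - g z0) / e) @ 0^'+ --> h z0.

Definition Ng (g : R -> R) (z0 theta q y : R) : \bar R :=
  (\int[leb]_(z in `[z0, +oo[)
     ((g z)^-1 * expR (- (y * z) + ointegral theta z (fun s => q / g s)))%:E)%E.

Definition levy_measure (m : {measure set R -> \bar R}) :=
  (\int[m]_(h in `]0%R, +oo[) (Num.min 1 (h ^+ 2))%:E < +oo)%E.

(* the triple is that of a subordinator: no Gaussian part, finite variation,
   nonnegative drift *)
Definition subordinator_triple (gamma sigma : R) (m : {measure set R -> \bar R}) :=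
  sigma = 0 /\ (\int[m]_(h in `]0%R, 1%R]) h%:E < +oo)%E /\
  (\int[m]_(h in `]0%R, 1%R]) h) <= gamma.

Definition laplace_exponent_formula (gamma sigma : R)
    (m : {measure set R -> \bar R}) (z : R) : R :=
  - gamma * z + sigma ^+ 2 / 2 * z ^+ 2 +
  \int[m]_(h in `]0%R, +oo[)
     (expR (- (z * h)) + z * h * (\1_`]0%R, 1%R] h : R) - 1).

Definition spec_pos_laplace_exponent (psi : R -> R) :=
  exists gamma sigma (m : {measure set R -> \bar R}),
    levy_measure m /\ ~ subordinator_triple gamma sigma m /\
    forall z, 0 <= z -> psi z = laplace_exponent_formula gamma sigma m z.

Definition rc_inverse (psi : R -> R) (p : R) : R :=
  inf [set z : R | 0 <= z /\ p < psi z].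

End analytic.

Definition is_CSBP (R : realType) (d : measure_display) (Omega : measurableType d)
    (P : R -> probability Omega R) (X : R -> Omega -> R) (zeta : Omega -> \bar R)
    (psi : R -> R) (p : R) :=
  exists u : R -> R -> R,
    (forall lam : R, 0 <= lam ->
       [/\ u 0 lam = lam,
           (forall t : R, 0 <= t -> 0 <= u t lam),
           (u ^~ lam) @ 0^'+ --> lam &
           (forall t : R, 0 < t -> is_derive t 1 (u ^~ lam) (p - psi (u t lam)))]) /\
    (forall x t lam : R, 0 < x -> 0 <= t -> 0 <= lam ->
       (\int[P x]_w (if (t%:E < zeta w)%E then (expR (- (lam * X t w)))%:E
                     else 0%E))%E
       = (expR (- (x * u t lam)))%:E).

(* Main.v *)
Require Import Defs.
From HB Require Import structures.
From mathcomp Require Import all_boot all_order all_algebra.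
From mathcomp Require Import all_classical all_reals all_analysis.
From mathcomp Require Import measurable_realfun lebesgue_measure.
From mathcomp Require Import ring lra.
Import Order.TTheory GRing.Theory Num.Theory.
Import numFieldNormedType.Exports.
Set Implicit Arguments.
Unset Strict Implicit.
Unset Printing Implicit Defensive.
Local Open Scope classical_set_scope.
Local Open Scope ring_scope.

(* Write G for the primitive of 1/g vanishing at theta and u_t(z) for the flow
   G(u_t(z)) = G(z) - t of the equation u' = -g(u) on ]z0, +oo[. The passage
   formula says that Phi_q(x) = int (1/g(z)) exp(-xz + q G(z)) dz satisfies
   E_x[exp(-q T_l)] = Phi_q(x) / Phi_q(l). By the Markov property at time t, and
   letting l tend to 0, E_x[Phi_q(X_t); t < zeta] = exp(qt) Phi_q(x); the
   remainder vanishes by comparison with a larger q. Substituting z -> u_t(z) on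
   the right, this says that E_x[exp(-z X_t)] and exp(-x u_t(z)) have the same
   integrals against exp(q G(z)) dG(z) for all large q, so that they agree for
   z > z0 by uniqueness of bilateral Laplace transforms.

   For z <= z0, multiplicativity of x |-> E_x[exp(-z X_t)] is continued from
   z > z0, and monotonicity gives E_x[exp(-z X_t)] = exp(-x u_t(z)) for all
   z >= 0, with u a semigroup in t. For a > z0 the measures
   t^-3 (1 - v)^2 P_(t^2)(exp(-a X_t) in dv) on [0, 1] have bounded mass. Their
   limit along an ultrafilter of t -> 0+ has an atom p at v = 0 (killing), an atom
   a^2 sigma^2 at v = 1 (Gaussian part), and its part on ]0, 1[ gives the Levy
   measure under v = exp(-a h). Hence (u_t(z) - z)/t tends to p - psi(z) along the
   ultrafilter for all z > 0, with psi a Laplace exponent; this forces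
   g = psi - p above z0. By the semigroup property the right derivative of u along
   the ultrafilter is p - psi(u) at all times; being continuous, it is the
   derivative of u. *)

(** * Integration preliminaries *)

(** Expectations are handled without knowing that [X t] is measurable: almost sure equalities are
    integrated directly, and Tonelli and dominated convergence are applied to measurable versions of
    exp(- X_t). Transforms are known only at real arguments, so uniqueness and continuation rest on
    real approximations: (2 - exp(y/n))^n for exp(-y), and powers of cosines for a Gaussian.

    The integral of 1/g diverges at both ends: at infinity by hypothesis, at z0 because g is C^1
    with g z0 = 0. Hence G maps onto the whole line and the flow exists for all times. Divergence at
    infinity also makes Phi_q(0+) infinite, which is what kills the remainder in the martingale
    identity.

    Differentiability of u_t(z) at t = 0 is known beforehand only for z > z0. The mass of the
    rescaled measures involves z = a and z = 2a alone, because (1 - v)^2 = 2 (1 - v) - (1 - v^2), so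
    that a > z0 suffices to bound it; the ultrafilter then supplies limits at all z > 0 at once. *)

Section unmeasured.
Local Open Scope ereal_scope.
Context d (T : measurableType d) (R : realType) (mu : {measure set T -> \bar R}).
Import HBNNSimple.

(* No measurability is assumed: the integral of a nonnegative function is a
   supremum over simple functions, and these are measurable. *)
Lemma ae_le_integral_nonmeas (f g : T -> \bar R) :
  (forall x, 0 <= f x) -> (forall x, 0 <= g x) ->
  {ae mu, forall x, f x <= g x} -> \int[mu]_x f x <= \int[mu]_x g x.
Proof.
move=> f0 g0 [N [mN N0 fgN]].
rewrite (ge0_integralTE _ f0) (ge0_integralTE _ g0).
apply: ge_ereal_sup => _ [h /= hf <-].
(* Cutting [h] to 0 on the null set [N] keeps its integral and brings it below [g] everywhere. *)
pose k : {nnsfun T >-> R} := proj_nnsfun h (measurableC mN).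
have -> : sintegral mu h = sintegral mu k.
  have sE (u : {nnsfun T >-> R}) : sintegral mu u = \int[mu]_x (u x)%:E.
    by rewrite integral_nnsfun// patch_setT.
  rewrite !sE.
  apply: ge0_ae_eq_integral => //; try exact/measurable_EFinP.
  - by move=> x _; rewrite lee_fin.
  - by move=> x _; rewrite lee_fin.
  exists N; split => // x /= /not_implyP[_]; apply: contra_notP => xN.
  by congr EFin; rewrite /= mindicE mem_set// mulr1.
apply: ereal_sup_ubound; exists k => // x /=.
rewrite mindicE; have [xN|/negP xN] := boolP (x \in ~` N); last first.
  by rewrite /= mulr0.
rewrite mulr1; apply: le_trans (hf x) _.
by apply: contrapT => fg; move/set_mem : xN; apply; exact: fgN.
Qed.

Lemma ae_eq_integral_nonmeas (f g : T -> \bar R) :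
  (forall x, 0 <= f x) -> (forall x, 0 <= g x) ->
  {ae mu, forall x, f x = g x} -> \int[mu]_x f x = \int[mu]_x g x.
Proof.
move=> f0 g0 fg; apply/eqP; rewrite eq_le; apply/andP; split.
  by apply: ae_le_integral_nonmeas => //; apply: filterS fg => x ->.
by apply: ae_le_integral_nonmeas => //; apply: filterS fg => x ->.
Qed.

Lemma integralZl_ge_nonmeas (f : T -> \bar R) (c : R) : (0 < c)%R ->
  (forall x, 0 <= f x) -> c%:E * (\int[mu]_x f x) <= \int[mu]_x (c%:E * f x).
Proof.
move=> c0 f0; have cf0 x : 0 <= c%:E * f x by rewrite mule_ge0// lee_fin ltW.
rewrite -lee_pdivlMl// (ge0_integralTE _ f0) (ge0_integralTE _ cf0).
apply: ge_ereal_sup => _ [h /= hf <-].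
rewrite lee_pdivlMl//.
have c0' : (0 <= c)%R by exact: ltW.
pose k : {nnsfun T >-> R} := scale_nnsfun h c0'.
have -> : c%:E * sintegral mu h = sintegral mu k by rewrite -sintegralrM.
apply: ereal_sup_ubound; exists k => // x /=.
by rewrite EFinM lee_pmul2l// lte_fin.
Qed.

(** The missing inequality is the previous one for the factor [c^-1] and the function [c * f]. *)
Lemma integralZl_nonmeas (f : T -> \bar R) (c : R) : (0 < c)%R ->
  (forall x, 0 <= f x) -> \int[mu]_x (c%:E * f x) = c%:E * (\int[mu]_x f x).
Proof.
move=> c0 f0; apply/eqP; rewrite eq_le integralZl_ge_nonmeas// andbT.
have ci0 : (0 < c^-1)%R by rewrite invr_gt0.
have := @integralZl_ge_nonmeas (fun x => c%:E * f x) _ ci0.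
have E x : c^-1%:E * (c%:E * f x) = f x.
  by rewrite muleA -EFinM mulVf ?gt_eqF// mul1e.
have -> : \int[mu]_x (c^-1%:E * (c%:E * f x)) = \int[mu]_x f x.
  by apply: eq_integral => x _; rewrite E.
rewrite lee_pdivrMl//; apply => x.
by rewrite mule_ge0// lee_fin ltW.
Qed.

End unmeasured.

Section dominated.
Context d (T : measurableType d) (R : realType) (mu : {measure set T -> \bar R}).
Variables (D : set T) (mD : measurable D).

Lemma Rdominated_cvg (f_ : nat -> T -> R) (f g : T -> R) :
  (forall n, measurable_fun D (f_ n)) ->
  (forall x, D x -> f_ ^~ x @ \oo --> f x) ->
  mu.-integrable D (EFin \o g) ->
  (forall n x, D x -> `|f_ n x| <= g x) ->
  mu.-integrable D (EFin \o f) /\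
  (\int[mu]_(x in D) f_ n x) @[n --> \oo] --> \int[mu]_(x in D) f x.
Proof.
move=> mf ff ig fg.
have mlim : measurable_fun D f by exact: (measurable_fun_cvg mf ff).
have [] := @dominated_convergence _ _ _ mu D mD (fun n => EFin \o f_ n)
  (EFin \o f) (EFin \o g).
- by move=> n; exact/measurable_EFinP.
- exact/measurable_EFinP.
- apply: aeW => x Dx; apply: cvg_EFin; last exact: ff.
  by apply: nearW => n; rewrite /= fin_numE.
- exact: ig.
- by apply: aeW => x n Dx; rewrite /= lee_fin; exact: fg.
move=> intf _ cvgf; split => //.
have fin : (\int[mu]_(x in D) (EFin \o f) x)%E \is a fin_num.
  exact: integrable_fin_num.
rewrite /Rintegral; apply: fine_cvg; rewrite fineK//; exact: cvgf.
Qed.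

Lemma integrableR_D (f g : T -> R) : mu.-integrable D (EFin \o f) ->
  mu.-integrable D (EFin \o g) ->
  mu.-integrable D (EFin \o (fun x => f x + g x)).
Proof. by move=> fi gi; have := integrableD mD fi gi. Qed.

Lemma integrableR_Zl (k : R) (f : T -> R) : mu.-integrable D (EFin \o f) ->
  mu.-integrable D (EFin \o (fun x => k * f x)).
Proof. by move=> fi; have := integrableZl mD k fi. Qed.

Lemma integrableR_B (f g : T -> R) : mu.-integrable D (EFin \o f) ->
  mu.-integrable D (EFin \o g) ->
  mu.-integrable D (EFin \o (fun x => f x - g x)).
Proof. by move=> fi gi; have := integrableB mD fi gi. Qed.

Lemma Rintegral_sumR (I : Type) (s : seq I) (F : I -> T -> R) :
  (forall i, mu.-integrable D (EFin \o F i)) ->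
  mu.-integrable D (EFin \o (fun x => \sum_(i <- s) F i x)) /\
  \int[mu]_(x in D) (\sum_(i <- s) F i x) = \sum_(i <- s) \int[mu]_(x in D) F i x.
Proof.
move=> iF; elim: s => [|i s [iS ih]].
  under eq_fun do rewrite big_nil; rewrite big_nil; split.
    exact: integrable0.
  by rewrite Rintegral_cst// mul0r.
under eq_fun do rewrite big_cons; rewrite big_cons; split.
  exact: integrableR_D.
by rewrite RintegralD// ih.
Qed.

Lemma le_integrableR (f g : T -> R) : measurable_fun D f ->
  (forall x, D x -> `|f x| <= g x) -> mu.-integrable D (EFin \o g) ->
  mu.-integrable D (EFin \o f).
Proof.
move=> mf fg; apply: le_integrable => //; first exact/measurable_EFinP.
move=> x Dx /=; rewrite lee_fin (le_trans (fg _ Dx))// ler_norm//.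
Qed.

End dominated.

(** * Explicit inequalities for exp, sin and cos *)

Section elementary.
Context {R : realType}.
Implicit Types v y a b M C : R.

Lemma cvg_dist_le_harmonic (u : nat -> R) l C :
  (forall n, `|u n - l| <= C * n.+1%:R^-1) -> u @ \oo --> l.
Proof.
move=> ul; apply/cvgrPdistC_lt => e e0.
have [C0|C0] := leP C 0.
  near=> n; apply: (le_lt_trans (ul n)).
  by rewrite (le_lt_trans _ e0)// mulr_le0_ge0// invr_ge0.
near=> n; apply: (le_lt_trans (ul n)).
rewrite -ltr_pdivlMl//; near: n.
have := @near_infty_natSinv_lt R (PosNum (divr_gt0 e0 C0)).
by apply: filterS => n /=; rewrite mulrC.
Unshelve. all: by end_near. Qed.

(** Induction on a^(n+1) - b^(n+1) = a (a^n - b^n) + (a - b) b^n. Since 1 <= M, the power M^n may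
    stand for M^(n-1), which spares a separate case n = 0. *)
Lemma norm_subX_le a b M (n : nat) : `|a| <= M -> `|b| <= M -> 1 <= M ->
  `|a ^+ n - b ^+ n| <= n%:R * M ^+ n * `|a - b|.
Proof.
move=> aM bM M1; elim: n => [|n ih]; first by rewrite !expr0 subrr normr0 !mul0r.
have -> : a ^+ n.+1 - b ^+ n.+1 = a * (a ^+ n - b ^+ n) + (a - b) * b ^+ n.
  by rewrite !exprS; ring.
apply: (le_trans (ler_normD _ _)); rewrite !normrM normrX.
have M0 : 0 <= M by apply: le_trans M1.
have Mn : 0 <= M ^+ n by exact: exprn_ge0.
have h1 : `|a| * `|a ^+ n - b ^+ n| <= M * (n%:R * M ^+ n * `|a - b|).
  by apply: ler_pM.
have h2 : `|a - b| * `|b| ^+ n <= `|a - b| * M ^+ n.+1.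
  apply: ler_wpM2l => //; rewrite exprS (@le_trans _ _ (M ^+ n))//.
    by rewrite lerXn2r// nnegrE.
  by rewrite ler_peMl.
apply: (le_trans (lerD h1 h2)); rewrite -natr1 exprS.
by rewrite [X in X <= _](_ : _ = (n%:R + 1) * (M * M ^+ n) * `|a - b|)//; ring.
Qed.

Lemma expR_sub1_le v : `|expR v - 1| <= `|v| * expR `|v|.
Proof.
have [v0|v0] := leP 0 v.
  rewrite !ger0_norm//; last by rewrite subr_ge0 -expR0 ler_expR.
  have := expR_ge1Dx (- v); rewrite expRN => h.
  have e0 := expR_gt0 v.
  have : (1 + - v) * expR v <= (expR v)^-1 * expR v by rewrite ler_pM2r.
  by rewrite mulVf ?gt_eqF//; nra.
rewrite ltr0_norm; last by rewrite subr_lt0 expR_lt1.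
rewrite ltr0_norm// opprB.
have h := expR_ge1Dx v.
have h2 : 1 <= expR (- v) by rewrite -expR0 ler_expR; lra.
by nra.
Qed.

Lemma expR_sub1D_ge0 v : 0 <= expR v - 1 - v.
Proof. by have := expR_ge1Dx v; lra. Qed.

Lemma expR_sub1D_le v : expR v - 1 - v <= v * (expR v - 1).
Proof.
have := expR_ge1Dx (- v); rewrite expRN => h.
have e0 := expR_gt0 v.
have : (1 + - v) * expR v <= (expR v)^-1 * expR v by rewrite ler_pM2r.
by rewrite mulVf ?gt_eqF//; nra.
Qed.

Lemma norm_expR_sub1D_le v : `|expR v - 1 - v| <= v ^+ 2 * expR `|v|.
Proof.
rewrite ger0_norm ?expR_sub1D_ge0//; apply: (le_trans (expR_sub1D_le v)).
apply: (le_trans (ler_norm _)); rewrite normrM -real_normK ?num_real// expr2.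
by rewrite -mulrA ler_wpM2l// expR_sub1_le.
Qed.

Lemma expR_norm_le y : expR `|y| <= expR y + expR (- y).
Proof.
by have [y0|y0] := ger0P y; rewrite ?lerDl ?lerDr expR_ge0.
Qed.

Lemma norm_le_expR y : `|y| <= expR `|y|.
Proof. by have := expR_ge1Dx `|y|; lra. Qed.

Lemma norm_expR_sub_expRN_le v : expR v + expR (- v) - 2 <= v ^+ 2 * expR `|v| *+ 2.
Proof.
have h1 := norm_expR_sub1D_le v; have h2 := norm_expR_sub1D_le (- v).
rewrite sqrrN normrN in h2.
have := lerD (le_trans (ler_norm _) h1) (le_trans (ler_norm _) h2).
by rewrite mulr2n; lra.
Qed.

Lemma norm_2BexpR_le v : `|2 - expR v| <= expR `|v|.
Proof.
have e0 := expR_gt0 v.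
have [v0|v0] := ger0P v.
  have : 1 <= expR v by rewrite -expR0 ler_expR.
  by rewrite ler_norml => ?; apply/andP; split; lra.
have : expR v < 1 by rewrite expR_lt1.
have h : 2 <= expR v + expR (- v).
  have := expR_ge1Dx v; have := expR_ge1Dx (- v); lra.
by move=> ?; rewrite ler_norml; apply/andP; split; lra.
Qed.

Lemma norm_div_natS_le y (n : nat) : `|y / n.+1%:R| <= `|y|.
Proof.
rewrite normrM ler_piMr// ger0_norm ?invr_ge0// invf_le1 ?ltr0n//.
by rewrite ler1n.
Qed.

(** With v = y/(n+1), the bases 2 - exp v and exp(-v) differ by exp v + exp(-v) - 2 = O(v^2). Taking
    (n+1)-th powers costs a factor n+1 and the constant exp [|y|], so the gap is O(1/n). *)
Lemma cvg_2BexpR y :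
  (2 - expR (y / n.+1%:R)) ^+ n.+1 @[n --> \oo] --> expR (- y).
Proof.
apply: (@cvg_dist_le_harmonic _ _ (y ^+ 2 * expR `|y| * expR `|y| *+ 2)) => n.
have n0 : 0 < n.+1%:R :> R by rewrite ltr0n.
pose v := y / n.+1%:R.
have -> : expR (- y) = expR (- v) ^+ n.+1.
  by rewrite -expRM_natr /v mulNr divfK// gt_eqF.
have vy : `|v| <= `|y|.
  exact: norm_div_natS_le.
have M1 : 1 <= expR `|v| by rewrite -expR0 ler_expR.
have h := norm_subX_le n.+1 (norm_2BexpR_le v) _ M1.
apply: (le_trans (h _ _)).
  by rewrite ger0_norm ?expR_ge0// ler_expR -normrN ler_norm.
rewrite -expRM_natr [`|v|]normrM [`|_^-1|]ger0_norm ?invr_ge0//.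
rewrite divfK ?gt_eqF//.
have -> : `|2 - expR v - expR (- v)| = expR v + expR (- v) - 2.
  rewrite -[LHS]normrN ger0_norm; first by lra.
  have := expR_ge1Dx v; have := expR_ge1Dx (- v); lra.
have := norm_expR_sub_expRN_le v => h2.
have h3 : expR v + expR (- v) - 2 <= v ^+ 2 * expR `|y| *+ 2.
  by apply: (le_trans h2); rewrite ler_pMn2r// ler_wpM2l ?sqr_ge0// ler_expR.
apply: (@le_trans _ _ (n.+1%:R * expR `|y| * (v ^+ 2 * expR `|y| *+ 2))).
  by rewrite ler_wpM2l// mulr_ge0// ?expR_ge0// ler0n.
rewrite /v exprMn [X in X <= _](_ : _ = y ^+ 2 * expR `|y| * expR `|y| *+ 2 / n.+1%:R)//.
by field; rewrite gt_eqF.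
Qed.

Lemma cvg_natM_expR_sub1 y :
  n.+1%:R * (expR (y / n.+1%:R) - 1) @[n --> \oo] --> y.
Proof.
apply: (@cvg_dist_le_harmonic _ _ (y ^+ 2 * expR `|y|)) => n.
have n0 : 0 < n.+1%:R :> R by rewrite ltr0n.
pose v := y / n.+1%:R.
have yE : y = n.+1%:R * v by rewrite /v mulrC divfK// gt_eqF.
rewrite -/v [X in _ - X]yE -mulrBr normrM gtr0_norm//.
have vy : `|v| <= `|y|.
  exact: norm_div_natS_le.
apply: (@le_trans _ _ (n.+1%:R * (v ^+ 2 * expR `|y|))).
  apply: ler_wpM2l; first exact: ltW.
  apply: (le_trans (norm_expR_sub1D_le v)); rewrite ler_wpM2l ?sqr_ge0//.
  by rewrite ler_expR.
rewrite /v exprMn [X in X <= _](_ : _ = y ^+ 2 * expR `|y| / n.+1%:R)//.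
by field; rewrite gt_eqF.
Qed.

Lemma norm_sin_le y : `|sin y| <= `|y|.
Proof.
wlog y0 : y / 0 < y => [wl|].
  have [y0|y0|<-] := ltgtP 0 y; first exact: wl.
    by rewrite -normrN -sinN -[in leRHS]normrN; apply: wl; rewrite oppr_gt0.
  by rewrite sin0 normr0.
have [c _] := @MVT R sin cos 0 y y0 (fun x _ => is_derive_sin x)
  (continuous_subspaceT (@continuous_sin R)).
rewrite sin0 !subr0 => ->; rewrite normrM ler_piMl// cos_max//.
Qed.

Lemma cos_half y : cos y = 1 - sin (y / 2) ^+ 2 *+ 2.
Proof.
rewrite [in LHS](_ : y = (y / 2) *+ 2); last by rewrite -mulr_natr divfK.
by rewrite cos_mulr2n cos2sin2 mulrnBl; lra.
Qed.

Lemma cos_ge1B y : 1 - cos y <= y ^+ 2 / 2.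
Proof.
rewrite cos_half opprB addrC subrK.
have : sin (y / 2) ^+ 2 <= (y / 2) ^+ 2.
  by rewrite -[leLHS]real_normK ?num_real// -[leRHS]real_normK ?num_real// lerXn2r ?nnegrE// norm_sin_le.
have -> : (y / 2) ^+ 2 = y ^+ 2 / 4 by field.
by move=> h; rewrite -mulr_natl; lra.
Qed.

Lemma norm_sinB_le y : `|y - sin y| <= `|y| ^+ 3 / 2.
Proof.
wlog y0 : y / 0 < y => [wl|].
  have [y0|y0|<-] := ltgtP 0 y; first exact: wl.
    by rewrite -normrN opprB -[`|y|]normrN addrC -[sin y]opprK -sinN; apply: wl; rewrite oppr_gt0.
  by rewrite sin0 subrr normr0 exprS mul0r mul0r.
have df x : x \in `]0, y[%R -> is_derive x 1 (fun x => x - sin x) (1 - cos x).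
  move=> _; exact: is_deriveB.
have cf : {within `[0, y], continuous (fun x => x - sin x : R)}.
  apply: continuous_subspaceT => x; apply: cvgB; first exact: cvg_id.
  exact: continuous_sin.
have [c] := @MVT R (fun x => x - sin x) _ 0 y y0 df cf.
rewrite in_itv/= => /andP[c0 cy]; rewrite sin0 !subr0 => ->.
have h := cos_ge1B c; have h1 := cos_le1 c.
rewrite normrM ger0_norm ?subr_ge0// (gtr0_norm y0).
apply: (@le_trans _ _ (y ^+ 2 / 2 * y)); last by rewrite !exprS expr0; lra.
rewrite ler_wpM2r ?(ltW y0)// (le_trans h)//.
by rewrite ler_pM2r// lerXn2r ?nnegrE// ltW.
Qed.

(** Both functions are compared with 1 - v^2/2, the cosine through the half-angle formula; the two
    errors add up to (3/8) v^4. *)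
Lemma norm_cos_sub_gauss_le v : `|cos v - expR (- (v ^+ 2 / 2))| <= v ^+ 4.
Proof.
pose x := v / 2.
have h1 : `|cos v - (1 - v ^+ 2 / 2)| <= 2 * x ^+ 4.
  rewrite cos_half -/x.
  have -> : 1 - sin x ^+ 2 *+ 2 - (1 - v ^+ 2 / 2) = 2 * ((x - sin x) * (x + sin x)).
    by rewrite /x; field.
  rewrite normrM ger0_norm// ler_pM2l// normrM.
  have -> : x ^+ 4 = `|x| ^+ 3 / 2 * (`|x| *+ 2).
    by rewrite (exprM x 2 2) -[x ^+ 2]real_normK ?num_real//; field.
  apply: ler_pM => //; first exact: norm_sinB_le.
  by rewrite mulr2n (le_trans (ler_normD _ _))// lerD2l norm_sin_le.
have h2 : `|1 - v ^+ 2 / 2 - expR (- (v ^+ 2 / 2))| <= (v ^+ 2 / 2) ^+ 2.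
  set z := v ^+ 2 / 2.
  have z0 : 0 <= z by rewrite /z divr_ge0// sqr_ge0.
  have g1 := expR_sub1D_ge0 (- z); have g2 := expR_sub1D_le (- z).
  have g3 := expR_ge1Dx (- z).
  by rewrite ler_norml; apply/andP; split; nra.
have -> : cos v - expR (- (v ^+ 2 / 2)) = (cos v - (1 - v ^+ 2 / 2)) +
   (1 - v ^+ 2 / 2 - expR (- (v ^+ 2 / 2))) by ring.
apply: (le_trans (ler_normD _ _)); apply: (le_trans (lerD h1 h2)).
have v4 : 0 <= v ^+ 4 by rewrite (exprM v 2 2) sqr_ge0.
have -> : 2 * x ^+ 4 + (v ^+ 2 / 2) ^+ 2 = v ^+ 4 * (3 / 8) by rewrite /x; field.
by lra.
Qed.

(** The central limit theorem for coin tosses, read on characteristic functions. It produces from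
    cosines the Gaussian that localizes at a point in [gauss_null_le0]. *)
Lemma cvg_cosX_gauss y :
  cos (y / Num.sqrt n.+1%:R) ^+ n.+1 @[n --> \oo] --> expR (- (y ^+ 2 / 2)).
Proof.
apply: (@cvg_dist_le_harmonic _ _ (y ^+ 4)) => n.
have n0 : 0 < n.+1%:R :> R by rewrite ltr0n.
have s0 : 0 < Num.sqrt (n.+1%:R : R) by rewrite sqrtr_gt0.
pose v := y / Num.sqrt n.+1%:R.
have v2 : v ^+ 2 = y ^+ 2 / n.+1%:R by rewrite exprMn exprVn sqr_sqrtr// ltW.
have -> : expR (- (y ^+ 2 / 2)) = expR (- (v ^+ 2 / 2)) ^+ n.+1.
  by rewrite -expRM_natr v2; congr expR; field; rewrite gt_eqF.
apply: (le_trans (norm_subX_le n.+1 (cos_max _) _ (lexx 1))).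
  rewrite ger0_norm ?expR_ge0// expR_le1 oppr_le0 divr_ge0 ?sqr_ge0//.
rewrite expr1n mulr1.
apply: (@le_trans _ _ (n.+1%:R * v ^+ 4)).
  by apply: ler_wpM2l; [exact: ltW|exact: norm_cos_sub_gauss_le].
rewrite (exprM v 2 2) v2 [leLHS](_ : _ = y ^+ 4 / n.+1%:R)//.
by field; rewrite gt_eqF.
Qed.

End elementary.

(** * Uniqueness for exponential transforms *)

Lemma measurable_cos (R : realType) : measurable_fun [set: R] (@cos R).
Proof. by apply: continuous_measurable_fun; exact: continuous_cos. Qed.

Section exponential_family.
Context d (T : measurableType d) (R : realType) (mu : {measure set T -> \bar R}).
Variables (D : set T) (mD : measurable D).
Implicit Types (h k S : T -> R) (q Q e th : R).

Definition exp_integrable S Q h := measurable_fun D h /\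
  forall q, Q < q -> mu.-integrable D (EFin \o (fun x => h x * expR (q * S x))).

Lemma measurable_expS S q : measurable_fun D S ->
  measurable_fun D (fun x => expR (q * S x)).
Proof.
move=> mS; apply: measurableT_comp => //.
by apply: measurable_funM => //; exact: measurable_cst.
Qed.

(** exp(e |S|) <= exp(e S) + exp(- e S), so the parameters q - e and q + e dominate. This function
    is the dominating one in the limits below. *)
Lemma exp_integrable_norm S Q h q e : measurable_fun D S ->
  exp_integrable S Q h -> Q < q - e -> 0 <= e ->
  mu.-integrable D (EFin \o (fun x => `|h x| * expR (q * S x) * expR (e * `|S x|))).
Proof.
move=> mS [mh ih] Qqe e0.
have i1 := integrable_norm (ih _ (Qqe : Q < q - e)).
have Qqe' : Q < q + e by lra.
have i2 := integrable_norm (ih _ Qqe').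
have i12 := integrableD mD i1 i2.
apply: (le_integrableR mD _ _ i12).
  apply: measurable_funM; first apply: measurable_funM.
  - exact: measurableT_comp.
  - exact: measurable_expS.
  - by apply: measurable_expS; exact: measurableT_comp.
move=> x Dx /=; rewrite !normrM normr_id !(ger0_norm (expR_ge0 _)).
rewrite -mulrA -mulrDr ler_wpM2l// 2!mulrDl !expRD mulNr.
rewrite -mulrDr ler_wpM2l ?expR_ge0//.
by rewrite -{1}(ger0_norm e0) -normrM addrC; exact: expR_norm_le.
Qed.

Lemma exp_integrable_le S Q h k : measurable_fun D S -> measurable_fun D k ->
  exp_integrable S Q h -> (forall x, D x -> `|k x| <= `|h x|) ->
  exp_integrable S Q k.
Proof.
move=> mS mk [mh ih] kh; split => // q Qq.
apply: (le_integrableR mD _ _ (integrable_norm (ih _ Qq))).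
  by apply: measurable_funM => //; exact: measurable_expS.
move=> x Dx /=; rewrite !normrM ler_wpM2r//; exact: kh.
Qed.

(** The factor S is paid for by |S| <= e^-1 exp(e |S|); half of the gap q - Q is room enough for
    e. *)
Lemma exp_integrable_mulS S Q h : measurable_fun D S ->
  exp_integrable S Q h -> exp_integrable S Q (fun x => h x * S x).
Proof.
move=> mS ih; have [mh _] := ih; split; first exact: measurable_funM.
move=> q Qq; pose e := (q - Q) / 2.
have e0 : 0 < e by rewrite /e; lra.
have iN : mu.-integrable D (EFin \o (fun x => e^-1 *
    (`|h x| * expR (q * S x) * expR (e * `|S x|)))).
  have := @integrableZl _ _ _ mu _ mD e^-1 _ (exp_integrable_norm mS ih (_ : Q < q - e) (ltW e0)).
  by apply; rewrite /e; lra.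
apply: (le_integrableR mD _ _ iN).
  apply: measurable_funM; first exact: measurable_funM.
  exact: measurable_expS.
move=> x Dx /=; rewrite !normrM (ger0_norm (expR_ge0 _)).
rewrite [leLHS](_ : _ = `|h x| * expR (q * S x) * `|S x|); last by ring.
rewrite [leRHS](_ : _ = `|h x| * expR (q * S x) * (e^-1 * expR (e * `|S x|))); last by ring.
rewrite ler_wpM2l ?mulr_ge0 ?expR_ge0// ler_pdivlMl//.
by rewrite -{1}(gtr0_norm e0) -{2}(gtr0_norm e0) -normrM norm_le_expR.
Qed.

Definition exp_transform S h q := \int[mu]_(x in D) (h x * expR (q * S x)).

(** The coefficient of x^k in (2 - x)^n. *)
Definition binom2 (n k : nat) : R := ((2 : R) ^+ (n - k) * (-1) ^+ k) *+ 'C(n, k).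

(* The transform at q - e is a limit of combinations of its values on
   [q, q + e], because (2 - exp(y/n))^n tends to exp(-y): this replaces
   analytic continuation. *)
Lemma exp_transform_left S Q h q e : measurable_fun D S ->
  exp_integrable S Q h -> Q < q - e -> 0 <= e ->
  (\sum_(k < n.+2) binom2 n.+1 k * exp_transform S h (q + e * k%:R / n.+1%:R))
    @[n --> \oo] --> exp_transform S h (q - e).
Proof.
move=> mS ih Qqe e0; have [mh ihq] := ih.
have iN := exp_integrable_norm mS ih Qqe e0.
pose f_ n x := h x * expR (q * S x) * (2 - expR (e * S x / n.+1%:R)) ^+ n.+1.
have [] := @Rdominated_cvg _ _ _ mu D mD f_ (fun x => h x * expR ((q - e) * S x)) _ _ _ iN.
- move=> n; apply: measurable_funM.
    by apply: measurable_funM => //; exact: measurable_expS.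
  apply: measurable_funX; apply: measurable_funB; first exact: measurable_cst.
  apply: (eq_measurable_fun (fun x => expR (e / n.+1%:R * S x))).
    by move=> x _; congr expR; rewrite mulrAC.
  exact: measurable_expS.
- move=> x Dx; rewrite mulrBl expRD mulrA; apply: cvgM; first exact: cvg_cst.
  exact: cvg_2BexpR.
- move=> n x Dx; rewrite /f_ !normrM (ger0_norm (expR_ge0 _)).
  apply: ler_wpM2l; first by rewrite mulr_ge0// expR_ge0.
  rewrite normrX.
  have -> : expR (e * `|S x|) = expR `|e * S x / n.+1%:R| ^+ n.+1.
    rewrite -expRM_natr 2!normrM (ger0_norm e0) [`|_^-1|]ger0_norm ?invr_ge0//.
    by rewrite divfK// pnatr_eq0.
  by rewrite lerXn2r ?nnegrE ?expR_ge0// norm_2BexpR_le.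
move=> _; apply: cvg_trans; apply: near_eq_cvg; apply: nearW => n /=.
have ik (k : 'I_n.+2) : mu.-integrable D (EFin \o (fun x => h x * expR ((q + e * k%:R / n.+1%:R) * S x))).
  apply: ihq; have : 0 <= e * k%:R / n.+1%:R by rewrite !mulr_ge0// invr_ge0.
  by move: (e * k%:R / n.+1%:R) => z z0; lra.
transitivity (\int[mu]_(x in D) \sum_(k < n.+2) (binom2 n.+1 k * (h x * expR ((q + e * k%:R / n.+1%:R) * S x)))).
  apply: eq_Rintegral => x _; rewrite /f_ exprDn mulr_sumr.
  apply: eq_bigr => k _; rewrite /binom2 mulrDl expRD [(- expR _) ^+ _]exprNn -expRM_natr.
  rewrite -[X in _ * X = _]mulr_natr -[X in _ = X * _]mulr_natr (_ : e * S x / n.+1%:R * k%:R = e * k%:R / n.+1%:R * S x); last first.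
    by move: (n.+1%:R^-1 : R) (k%:R : R) => a b; ring.
  move: (_ ^+ _) (_ ^+ k) ('C(_, _)%:R) (expR _) (expR (q * S x)) => a b c y z.
  by ring.
rewrite (Rintegral_sumR mD _ _).2//; last first.
  by move=> k; have := integrableZl mD (binom2 n.+1 k) (ik k).
by apply: eq_bigr => k _; rewrite RintegralZl.
Qed.

(** The transform of [h * S] is the derivative in q of that of [h], taken along the steps 1/(n+1).
    The 2 in the threshold comes from the dominating factor |S| exp |S| <= exp(2 |S|). *)
Lemma exp_transform_mulS0 S Q Q' h : measurable_fun D S ->
  exp_integrable S Q h -> (forall q, Q' < q -> exp_transform S h q = 0) ->
  forall q, Num.max Q' (Q + 2) < q -> exp_transform S (fun x => h x * S x) q = 0.
Proof.
move=> mS ih h0 q; rewrite gt_max => /andP[Q'q Qq]; have [mh ihq] := ih.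
have Qq2 : Q < q - 2 by lra.
have iN := exp_integrable_norm mS ih Qq2 (ler0n _ 2).
pose f_ n x := h x * expR (q * S x) * (n.+1%:R * (expR (S x / n.+1%:R) - 1)).
have [] := @Rdominated_cvg _ _ _ mu D mD f_ (fun x => h x * S x * expR (q * S x)) _ _ _ iN.
- move=> n; apply: measurable_funM.
    by apply: measurable_funM => //; exact: measurable_expS.
  apply: measurable_funM; first exact: measurable_cst.
  apply: measurable_funB; last exact: measurable_cst.
  apply: (eq_measurable_fun (fun x => expR (n.+1%:R^-1 * S x))).
    by move=> x _; congr expR; rewrite mulrC.
  exact: measurable_expS.
- move=> x Dx; rewrite mulrAC; apply: cvgM; first exact: cvg_cst.
  exact: cvg_natM_expR_sub1.
- move=> n x Dx; rewrite /f_ !normrM (ger0_norm (expR_ge0 _)).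
  apply: ler_wpM2l; first by rewrite mulr_ge0// expR_ge0.
  rewrite (gtr0_norm (ltr0Sn _ _)).
  apply: (@le_trans _ _ (n.+1%:R * (`|S x / n.+1%:R| * expR `|S x / n.+1%:R|))).
    by rewrite ler_wpM2l// expR_sub1_le.
  rewrite normrM [`|_^-1|]ger0_norm ?invr_ge0// mulrA mulrCA divff ?pnatr_eq0//.
  rewrite mulr1 (_ : 2 * `|S x| = `|S x| + `|S x|); last by ring.
  rewrite expRD ler_pM ?expR_ge0// ?norm_le_expR// ler_expR.
  rewrite ler_piMr// invf_le1 ?ltr0n// ler1n//.
move=> _ cf; apply/esym; move: cf; apply: cvg_unique => //.
apply: cvg_near_cst; apply: nearW => n /=.
have q1 : q < q + n.+1%:R^-1 by rewrite ltrDl invr_gt0.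
have Qq' : Q < q by lra.
have Qq1 : Q < q + n.+1%:R^-1 by exact: lt_trans q1.
transitivity (\int[mu]_(x in D) (n.+1%:R * (h x * expR ((q + n.+1%:R^-1) * S x) -
   h x * expR (q * S x)))).
  by apply: eq_Rintegral => x _; rewrite /f_ mulrDl expRD [n.+1%:R^-1 * _]mulrC; ring.
rewrite RintegralZl//; last first.
  by apply: integrableR_B => //; apply: ihq.
rewrite RintegralB//; try exact: ihq.
rewrite -/(exp_transform S h _) -/(exp_transform S h _) !h0 ?subr0 ?mulr0//.
exact: lt_trans q1.
Qed.

(** [exp_transform_left] started at q + e expresses the value at q by values at points of at least q
    + e. With e = |Q'| + 1 + |q| all of these lie beyond [Q']. *)
Lemma exp_transform_continuation S Q Q' h : measurable_fun D S ->
  exp_integrable S Q h -> (forall q, Q' < q -> exp_transform S h q = 0) ->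
  forall q, Q < q -> exp_transform S h q = 0.
Proof.
move=> mS ih h0 q Qq; pose e : R := `|Q'| + 1 + `|q|.
have e0 : 0 <= e by rewrite /e !addr_ge0.
have qe : Q < (q + e) - e by lra.
have := exp_transform_left mS ih qe e0.
rewrite addrK => /cvg_lim <-//; apply: cvg_lim => //.
apply: cvg_near_cst; apply: nearW => n; apply: big1 => k _.
rewrite h0 ?mulr0//.
have : 0 <= e * k%:R / n.+1%:R by rewrite !mulr_ge0// invr_ge0.
move: (e * k%:R / n.+1%:R) => z z0.
by have := ler_norm (- q); have := ler_norm Q'; rewrite normrN /e; lra.
Qed.

Definition exp_null S Q h := exp_integrable S Q h /\
  forall q, Q < q -> exp_transform S h q = 0.

(** Differentiation raises the threshold and continuation brings it back to the same [Q], so the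
    operation can be iterated. *)
Lemma exp_null_mulS S Q h : measurable_fun D S ->
  exp_null S Q h -> exp_null S Q (fun x => h x * S x).
Proof.
move=> mS [ih h0]; split; first exact: exp_integrable_mulS.
exact: (exp_transform_continuation mS (exp_integrable_mulS mS ih)
  (exp_transform_mulS0 mS ih h0)).
Qed.

Lemma exp_null_mulSX S Q h (k : nat) : measurable_fun D S ->
  exp_null S Q h -> exp_null S Q (fun x => h x * S x ^+ k).
Proof.
move=> mS h0; elim: k => [|k ih].
  by under eq_fun do rewrite expr0 mulr1.
by under eq_fun do rewrite exprSr mulrA; exact: exp_null_mulS.
Qed.

Lemma norm_series_cos_le (y : R) n : `|series (cos_coeff y) n| <= expR `|y|.
Proof.
rewrite /series/=; apply: (le_trans (ler_norm_sum _ _ _)).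
apply: (@le_trans _ _ (series (exp_coeff `|y|) n)).
  rewrite /series/=; apply: ler_sum => k _; rewrite cos_coeffE /exp_coeff.
  rewrite !normrM !normrX normrN normr1 expr1n mulr1.
  rewrite [`|_^-1|]ger0_norm ?invr_ge0//= mulrC ler_wpM2l ?exprn_ge0//.
  by rewrite ler_piMl ?invr_ge0//; case: odd => //=; rewrite ?normr0 ?normr1.
apply: nondecreasing_cvgn_le; last exact: is_cvg_series_exp_coeff.
by apply: nondecreasing_series => k _ _; rewrite /exp_coeff divr_ge0// exprn_ge0.
Qed.

(** The cosine is expanded in powers of S, each of which has a vanishing transform. The series is
    dominated by exp(th |S|), hence only for q > Q + th; continuation covers the other q. *)
Lemma exp_null_mulcos S Q h th : measurable_fun D S ->
  exp_null S Q h -> 0 <= th -> exp_null S Q (fun x => h x * cos (th * S x)).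
Proof.
move=> mS h0 th0; have [ih _] := h0; have [mh ihq] := ih.
have mc : measurable_fun D (fun x => cos (th * S x)).
  apply: measurableT_comp; first exact: measurable_cos.
  by apply: measurable_funM => //; exact: measurable_cst.
have ihc : exp_integrable S Q (fun x => h x * cos (th * S x)).
  apply: (exp_integrable_le mS _ ih); first exact: measurable_funM.
  by move=> x Dx; rewrite normrM ler_piMr// cos_max.
split => //; apply: (exp_transform_continuation (Q' := Q + th) mS ihc) => q Qq.
have Qq2 : Q < q - th by lra.
have iN := exp_integrable_norm mS ih Qq2 th0.
pose f_ n x := h x * expR (q * S x) * series (cos_coeff (th * S x)) n.
have [] := @Rdominated_cvg _ _ _ mu D mD f_ (fun x => h x * cos (th * S x) * expR (q * S x)) _ _ _ iN.
- move=> n; apply: measurable_funM.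
    by apply: measurable_funM => //; exact: measurable_expS.
  rewrite /series/=; apply: measurable_sum => k.
  rewrite [X in measurable_fun D X](_ : _ = (fun x => ((~~ odd k)%:R * (-1) ^+ k./2 * (k`!)%:R^-1) * (th * S x) ^+ k)); last first.
    by apply/funext => x; rewrite cos_coeffE.
  apply: measurable_funM; first exact: measurable_cst.
  by apply: measurable_funX; apply: measurable_funM => //; exact: measurable_cst.
- move=> x Dx; rewrite mulrAC; apply: cvgM; first exact: cvg_cst.
  rewrite unlock; exact: is_cvg_series_cos_coeff.
- move=> n x Dx; rewrite /f_ !normrM (ger0_norm (expR_ge0 _)).
  apply: ler_wpM2l; first by rewrite mulr_ge0// expR_ge0.
  by apply: (le_trans (norm_series_cos_le _ _)); rewrite normrM (ger0_norm th0).
move=> _ cf; apply/esym; move: cf; apply: cvg_unique => //.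
apply: cvg_near_cst; apply: nearW => n /=.
pose c (k : nat) : R := ((~~ odd k)%:R * (-1) ^+ k./2 * (k`!)%:R^-1) * th ^+ k.
have Qq' : Q < q by lra.
have ik (k : nat) : mu.-integrable D (EFin \o (fun x => h x * S x ^+ k * expR (q * S x))).
  by have [[_ /(_ _ Qq')]] := exp_null_mulSX k mS h0.
transitivity (\int[mu]_(x in D) \sum_(0 <= k < n) (c k * (h x * S x ^+ k * expR (q * S x)))).
  apply: eq_Rintegral => x _; rewrite /f_ /series/= mulr_sumr.
  by apply: eq_bigr => k _; rewrite cos_coeffE /c exprMn; ring.
rewrite (Rintegral_sumR mD _ _).2//; last first.
  by move=> k; have := integrableZl mD (c k) (ik k).
apply: big1_seq => k _; rewrite RintegralZl//.
have [_ /(_ _ Qq')] := exp_null_mulSX k mS h0.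
by rewrite /exp_transform => ->; rewrite mulr0.
Qed.

Lemma exp_null_mulcosX S Q h th (k : nat) : measurable_fun D S ->
  exp_null S Q h -> 0 <= th -> exp_null S Q (fun x => h x * cos (th * S x) ^+ k).
Proof.
move=> mS h0 th0; elim: k => [|k ih].
  by under eq_fun do rewrite expr0 mulr1.
by under eq_fun do rewrite exprSr mulrA; exact: exp_null_mulcos.
Qed.

(** Limit of the vanishing transforms of h cos(th S / sqrt n)^n, by [cvg_cosX_gauss]. The cosines
    are bounded by 1, so nothing is lost in the threshold. *)
Lemma exp_null_gauss S Q h th q : measurable_fun D S ->
  exp_null S Q h -> 0 <= th -> Q < q ->
  \int[mu]_(x in D) (h x * expR (q * S x) * expR (- ((th * S x) ^+ 2 / 2))) = 0.
Proof.
move=> mS h0 th0 Qq; have [[mh ihq] _] := h0.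
have iN := integrable_norm (ihq _ Qq).
pose f_ n x := h x * expR (q * S x) * cos (th * S x / Num.sqrt n.+1%:R) ^+ n.+1.
have [] := @Rdominated_cvg _ _ _ mu D mD f_ (fun x => h x * expR (q * S x) * expR (- ((th * S x) ^+ 2 / 2))) _ _ _ iN.
- move=> n; apply: measurable_funM.
    by apply: measurable_funM => //; exact: measurable_expS.
  apply: measurable_funX.
  apply: measurableT_comp; first exact: measurable_cos.
  apply: measurable_funM; last exact: measurable_cst.
  by apply: measurable_funM => //; exact: measurable_cst.
- move=> x Dx; apply: cvgM; first exact: cvg_cst.
  exact: cvg_cosX_gauss.
- move=> n x Dx; rewrite /f_ normrM ler_piMr// normrX exprn_ile1// cos_max//.
move=> _ cf; apply/esym; move: cf; apply: cvg_unique => //.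
apply: cvg_near_cst; apply: nearW => n /=.
have th1 : 0 <= th / Num.sqrt (n.+1%:R : R) by rewrite divr_ge0 ?sqrtr_ge0.
have [_ /(_ _ Qq)] := exp_null_mulcosX n.+1 mS h0 th1.
rewrite /exp_transform => <-; apply: eq_Rintegral => x _.
by rewrite /f_ mulrAC [th * S x / _]mulrAC.
Qed.

Lemma exp_null_shift S Q h c : measurable_fun D S -> exp_null S Q h ->
  exp_null (fun x => S x - c) Q h.
Proof.
move=> mS [[mh ih] h0].
have E q x : h x * expR (q * (S x - c)) = expR (- (q * c)) * (h x * expR (q * S x)).
  by rewrite mulrBr expRD; ring.
split; first split => // q Qq.
  rewrite [X in mu.-integrable D X](_ : _ = (fun x => (expR (- (q * c)))%:E * (h x * expR (q * S x))%:E)%E); last first.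
    by apply/funext => x /=; rewrite E.
  by apply: (@integrableZl _ _ _ mu D mD _ (EFin \o (fun x => h x * expR (q * S x)))); exact: ih.
move=> q Qq; rewrite /exp_transform; under eq_Rintegral do rewrite E.
rewrite RintegralZl//; last exact: ih.
by move: (h0 _ Qq); rewrite /exp_transform => ->; rewrite mulr0.
Qed.

End exponential_family.

(** * Pointwise uniqueness for continuous functions *)

Section null_continuous.
Context {R : realType}.
Notation leb := (@lebesgue_measure R).
Variables (z0 : R).
Let D : set (measurableTypeR R) := `]z0, +oo[%classic.

(** If f c > 0, Gaussians of width 1/th in the variable S concentrate at c, since S is strictly
    increasing. The part near c contributes at least a constant times exp(- (th m/2)^2/2), the part
    away from c at worst exp(- (th m)^2/2) times the integral of |f|; for large th the integral
    cannot vanish. *)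
Lemma gauss_null_le0 (f S : R -> R) (c : R) : z0 < c ->
  leb.-integrable D (EFin \o f) -> measurable_fun D S ->
  {in D &, {homo S : x y / x < y}} ->
  {for c, continuous f} -> {for c, continuous S} ->
  (forall th : R, 0 <= th ->
    \int[leb]_(x in D) (f x * expR (- ((th * (S x - S c)) ^+ 2 / 2))) = 0) ->
  f c <= 0.
Proof.
move=> z0c If mS Si cf cS f0; rewrite leNgt; apply/negP => fc0.
have mD : measurable D by exact: measurable_itv.
have mf : measurable_fun D f by have /integrableP[/measurable_EFinP] := If.
pose eta := f c / 2.
have eta0 : 0 < eta by rewrite /eta; lra.
have [e1 e10 fe1] : exists2 e1 : R, 0 < e1 & forall x, `|x - c| < e1 -> eta <= f x.
  move/cvgrPdist_lt : cf => /(_ _ eta0) /nbhs_ballP[e1/= e10 h].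
  exists e1 => // x xc; have := h x; rewrite /ball/= distrC => /(_ xc).
  by rewrite ltr_norml /eta => /andP[]; lra.
pose e2 : R := Num.min (e1 / 2) ((c - z0) / 2).
have e20 : 0 < e2 by rewrite /e2 lt_min; apply/andP; split; lra.
have e2l : e2 <= (c - z0) / 2 by rewrite /e2 ge_min lexx orbT.
have e2e1 : e2 <= e1 / 2 by rewrite /e2 ge_min lexx.
have DcB : c - e2 \in D by rewrite inE /D/= in_itv/= andbT; lra.
have Dc : c \in D by rewrite inE /D/= in_itv/= andbT; lra.
have DcD : c + e2 \in D by rewrite inE /D/= in_itv/= andbT; lra.
(* [m] separates the values of S outside the e2-neighbourhood of c from S c. *)
pose m : R := Num.min (S (c + e2) - S c) (S c - S (c - e2)).
have m0 : 0 < m.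
  by rewrite /m lt_min !subr_gt0; apply/andP; split; apply: Si => //; lra.
have Sfar x : D x -> e2 <= `|x - c| -> m <= `|S x - S c|.
  move=> Dx; have Dx' : x \in D by rewrite inE.
  have hle y z : y \in D -> z \in D -> y <= z -> S y <= S z.
    by move=> Dy Dz; rewrite le_eqVlt => /predU1P[->//|yz]; exact/ltW/Si.
  have [xc|xc] := leP c x.
    rewrite ger0_norm ?subr_ge0// => h.
    have g : S (c + e2) <= S x by apply: hle => //; lra.
    rewrite [leRHS]ger0_norm ?subr_ge0 ?hle// /m.
    by rewrite ge_min; apply/orP; left; lra.
  rewrite ltr0_norm ?subr_lt0// => h.
  have g : S x <= S (c - e2) by apply: hle => //; lra.
  rewrite [leRHS]ltr0_norm ?subr_lt0 ?Si// /m.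
  by rewrite ge_min; apply/orP; right; lra.
have [e3 e30 Se3] : exists2 e3 : R, 0 < e3 & forall x, `|x - c| < e3 -> `|S x - S c| <= m / 2.
  have m20 : 0 < m / 2 by lra.
  move/cvgrPdist_lt : cS => /(_ _ m20) /nbhs_ballP[e3/= e30 h].
  exists e3 => // x xc; have := h x; rewrite /ball/= distrC => /(_ xc).
  by rewrite distrC => /ltW.
pose e4 : R := Num.min (e3 / 2) (e2 / 2).
have e40 : 0 < e4 by rewrite /e4 lt_min; apply/andP; split; lra.
have e4e3 : e4 <= e3 / 2 by rewrite /e4 ge_min lexx.
have e4e2 : e4 <= e2 / 2 by rewrite /e4 ge_min lexx orbT.
pose I : set (measurableTypeR R) := `[c - e4, c + e4]%classic.
have ID : I `<=` D.
  by move=> x; rewrite /I /D /= !in_itv/= andbT => /andP[h1 h2]; lra.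
pose N := \int[leb]_(x in D) `|f x|.
have lebI : leb I = (e4 *+ 2)%:E.
  rewrite /I lebesgue_measure_itv/= lte_fin ltrD2l.
  have -> : - e4 < e4 by lra.
  by rewrite -EFinB; congr EFin; rewrite mulr2n; lra.
have Iind : leb.-integrable D (EFin \o (\1_I : R -> R)).
  apply: (@integrableS _ _ _ _ setT) => //.
  apply/integrableP; split.
    by apply/measurable_EFinP; apply: measurable_indic; exact: measurable_itv.
  under eq_integral do rewrite gee0_abs ?lee_fin//=.
  rewrite integral_indic//; last exact: measurable_itv.
  by rewrite setIT; have := ltry (e4 *+ 2); rewrite -lebI.
have indE : \int[leb]_(x in D) (\1_I x) = e4 *+ 2.
  rewrite /Rintegral integral_indic//; last exact: measurable_itv.
  by rewrite setIidl//; exact: (congr1 fine lebI).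
(* On [I] the integrand is at least eta times the near Gaussian value; elsewhere within e2 of c it
   is nonnegative, and farther away it is at least - |f| times the far value. *)
have key (th : R) : 0 <= th -> e4 *+ 2 * eta * expR (- ((th * (m / 2)) ^+ 2 / 2)) <=
    expR (- ((th * m) ^+ 2 / 2)) * N.
  move=> th0; have Nf := integrable_norm If.
  set A := expR (- ((th * (m / 2)) ^+ 2 / 2)); set B := expR (- ((th * m) ^+ 2 / 2)).
  have i1 : leb.-integrable D (EFin \o (fun x => eta * A * \1_I x)) by exact: integrableR_Zl.
  have i2 : leb.-integrable D (EFin \o (fun x => B * `|f x|)) by exact: integrableR_Zl.
  have i3 : leb.-integrable D (EFin \o (fun x => f x * expR (- ((th * (S x - S c)) ^+ 2 / 2)))).
    apply: (le_integrableR mD _ _ Nf).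
      apply: measurable_funM => //; apply: measurableT_comp => //.
      apply: measurableT_comp => //; apply: measurable_funM => //.
      apply: measurable_funX; apply: measurable_funM => //.
      exact: measurable_funB.
    move=> x Dx /=; rewrite normrM ler_piMr// ger0_norm ?expR_ge0// expR_le1.
    by rewrite oppr_le0 divr_ge0// sqr_ge0.
  have : \int[leb]_(x in D) (eta * A * \1_I x - B * `|f x|) <= 0.
    rewrite -(f0 _ th0); apply: le_Rintegral => //; first exact: integrableR_B.
    move=> x Dx; set E := expR _.
    have E0 : 0 < E by exact: expR_gt0.
    have [xc|xc] := ltP `|x - c| e2.
      have fx : eta <= f x by apply: fe1; lra.
      rewrite (@le_trans _ _ (eta * A * \1_I x))//.
        by rewrite lerBlDr lerDl mulr_ge0// expR_ge0.
      have [xI|xI] := boolP (x \in I); last first.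
        by rewrite indicE (negbTE xI)/= mulr0 mulr_ge0; lra.
      rewrite indicE xI mulr1 ler_pM//; [lra|exact: expR_ge0|].
      rewrite /A /E ler_expR lerN2 ler_pM2r// -[leLHS]real_normK ?num_real//.
      rewrite -[leRHS]real_normK ?num_real//.
      rewrite lerXn2r ?nnegrE// normrM [leRHS]normrM ler_wpM2l//.
      rewrite [leRHS]ger0_norm; last by lra.
      apply: Se3; move: xI; rewrite inE /I/= in_itv/= => /andP[h1 h2].
      by rewrite ltr_norml; apply/andP; split; lra.
    have xI : x \notin I.
      apply/negP; rewrite inE /I /= in_itv/= => /andP[h1 h2].
      move: xc; rewrite leNgt => /negP; apply.
      have : `|x - c| <= e4 by rewrite ler_norml; apply/andP; split; lra.
      by move=> h; lra.
    rewrite indicE (negbTE xI) mulr0 sub0r.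
    rewrite (@le_trans _ _ (- (`|f x| * E)))//; last first.
      by rewrite -mulNr ler_pM2r// lerNl -normrN ler_norm.
    rewrite lerN2 mulrC ler_wpM2r// /E /B ler_expR lerN2 ler_pM2r//.
    rewrite -[leLHS]real_normK ?num_real// -[leRHS]real_normK ?num_real//.
    rewrite lerXn2r ?nnegrE// normrM [leRHS]normrM ler_wpM2l//.
    by rewrite (gtr0_norm m0) Sfar.
  rewrite RintegralB// RintegralZl// RintegralZl// indE -/N.
  rewrite subr_le0 (_ : eta * A * (e4 *+ 2) = e4 *+ 2 * eta * A)//; last first.
    by ring.
have N0 : 0 <= N by apply: Rintegral_ge0.
(* th^2 K is the gap between (th m)^2/2 and (th m/2)^2/2. *)
pose K := 3 * m ^+ 2 / 8.
have K0 : 0 < K by rewrite /K divr_gt0// mulr_gt0// exprn_gt0.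
have key2 (th : R) : 0 <= th -> e4 *+ 2 * eta * (1 + th ^+ 2 * K) <= N.
  move=> th0; have := key _ th0.
  have -> : - ((th * m) ^+ 2 / 2) = - ((th * (m / 2)) ^+ 2 / 2) - th ^+ 2 * K.
    by rewrite /K; field.
  rewrite expRD -[leRHS]mulrA [leLHS]mulrC ler_pM2l ?expR_gt0// => h.
  have h1 : 1 + th ^+ 2 * K <= expR (th ^+ 2 * K) by exact: expR_ge1Dx.
  move: h; rewrite expRN [_^-1 * _]mulrC ler_pdivlMr ?expR_gt0// => h.
  apply: le_trans h; rewrite ler_wpM2l//.
  by rewrite mulr_ge0 ?mulrn_wge0//; apply: ltW.
have a0 : 0 < e4 *+ 2 * eta by rewrite mulr_gt0// pmulrn_lgt0.
set a := e4 *+ 2 * eta in a0 key2.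
(* This th refutes [key2]: as th >= 1, th^2 a K >= th a K = N + a K, which exceeds N. *)
have := key2 (N / (a * K) + 1).
have -> : 0 <= N / (a * K) + 1 by rewrite addr_ge0// divr_ge0// mulr_ge0// ltW.
move=> /(_ isT); set t := N / (a * K).
have t0 : 0 <= t by rewrite /t divr_ge0// mulr_ge0// ltW.
have Nt : N = t * (a * K) by rewrite /t divfK// gt_eqF// mulr_gt0.
have aK : 0 < a * K by rewrite mulr_gt0.
rewrite Nt => h.
suff : t * (a * K) < a * (1 + (t + 1) ^+ 2 * K) by rewrite ltNge h.
have : 0 <= (t ^+ 2 + t + 1) * (a * K).
  by rewrite mulr_ge0//; [rewrite !addr_ge0 ?sqr_ge0|exact: ltW].
have -> : a * (1 + (t + 1) ^+ 2 * K) = a + t * (a * K) + (t ^+ 2 + t + 1) * (a * K) by ring.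
by lra.
Qed.

(** The one-sided bound is used for h and for - h. Shifting S so that it vanishes at c makes the
    weight exp((Q + 1) S), which ensures integrability, equal to 1 at c. *)
Lemma exp_null_eq0 (h S : R -> R) (Q c : R) : measurable_fun D S ->
  {in D &, {homo S : x y / x < y}} -> z0 < c ->
  {for c, continuous h} -> {for c, continuous S} ->
  exp_null leb D S Q h -> h c = 0.
Proof.
move=> mS Si z0c ch cS h0.
have mD : measurable D by exact: measurable_itv.
pose S' x := S x - S c.
have mS' : measurable_fun D S' by exact: measurable_funB.
have [[mh ih] _] := h0.
have h0' := exp_null_shift mD (S c) mS h0.
have Qq : Q < Q + 1 by lra.
have cE : {for c, continuous (fun x => expR ((Q + 1) * S' x))}.
  apply: (@continuous_comp _ _ _ (fun x => (Q + 1) * S' x) expR); last exact: continuous_expR.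
  by apply: continuousM; [exact: cst_continuous|apply: continuousB => //; exact: cst_continuous].
suff H k : {for c, continuous k} -> exp_null leb D S' Q k -> k c <= 0.
  apply/eqP; rewrite eq_le H//= -oppr_le0; apply: (H (fun x => - h x)).
    exact: continuousN.
  have [[mh' ih'] h0''] := h0'.
  have E q x : - h x * expR (q * S' x) = (- 1) * (h x * expR (q * S' x)) by ring.
  split; first split => [|q Qq'].
  - exact: measurableT_comp.
  - under eq_fun do rewrite E; apply: integrableR_Zl => //; exact: ih'.
  - move=> q Qq'; rewrite /exp_transform; under eq_Rintegral do rewrite E.
    rewrite RintegralZl//; last exact: ih'.
    by have := h0'' _ Qq'; rewrite /exp_transform => ->; rewrite mulr0.
move=> ck k0; have [[mk ik] _] := k0.
have /(_ _ _) := @gauss_null_le0 (fun x => k x * expR ((Q + 1) * S' x)) S' c z0c.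
rewrite /S' subrr mulr0 expR0 mulr1; apply => //.
- exact: ik.
- by move=> x y Dx Dy xy; rewrite ltrD2r; exact: Si.
- exact: continuousM.
- by apply: continuousB => //; exact: cst_continuous.
- move=> th th0; rewrite -[RHS](exp_null_gauss mD mS' k0 th0 Qq).
  by apply: eq_Rintegral => x _; rewrite /S' subr0.
Qed.

End null_continuous.

(** * The flow of -g *)

Section primitive.
Context {R : realType}.
Notation leb := (@lebesgue_measure R).
Variables (z0 theta : R) (g : R -> R).
Hypothesis z0theta : z0 < theta.
Hypothesis gC1 : C1_on_halfline z0 g.
Hypothesis gpos : forall z, z0 < z -> 0 < g z.
Hypothesis gz0 : g z0 = 0.
Hypothesis gint : (\int[leb]_(z in `[theta, +oo[) ((g z)^-1)%:E = +oo)%E.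

Lemma C1_halfline_continuous c : z0 < c -> {for c, continuous g}.
Proof.
move=> z0c; have [h [_ [dg _]]] := gC1.
have := dg _ z0c => -[d _].
exact/differentiable_continuous/derivable1_diffP.
Qed.

Lemma invg_continuous c : z0 < c -> {for c, continuous (fun s => (g s)^-1)}.
Proof.
move=> z0c; apply: continuousV; last exact: C1_halfline_continuous.
by rewrite gt_eqF// gpos.
Qed.

Lemma invg_within a b : z0 < a -> {within `[a, b], continuous (fun s => (g s)^-1)}.
Proof.
move=> z0a; apply: continuous_in_subspaceT => x.
rewrite inE/= in_itv/= => /andP[ax _]; apply: invg_continuous.
exact: lt_le_trans ax.
Qed.

Lemma invg_integrable a b : z0 < a ->
  leb.-integrable `[a, b] (EFin \o (fun s => (g s)^-1)).
Proof.
move=> z0a; apply: continuous_compact_integrable; first exact: segment_compact.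
exact: invg_within.
Qed.

Definition invg_primitive z := ointegral theta z (fun s => (g s)^-1).
Local Notation G := invg_primitive.

(** A base point to the left of both theta and z turns the oriented integral into an ordinary one
    with varying right end, to which the fundamental theorem applies on both sides of theta. *)
Lemma invg_primitiveE a z : z0 < a -> a <= theta -> a <= z ->
  G z = \int[leb]_(s in `[a, z]) (g s)^-1 - \int[leb]_(s in `[a, theta]) (g s)^-1.
Proof.
move=> z0a atheta az; rewrite /G /ointegral.
have H b c : a <= b -> b <= c ->
    \int[leb]_(s in `[a, c]) (g s)^-1 - \int[leb]_(s in `[a, b]) (g s)^-1 =
    \int[leb]_(s in `[b, c]) (g s)^-1.
  move=> ab bc; rewrite Rintegral_itvB//; last exact: invg_integrable.
  rewrite Rintegral_itv_obnd_cbnd//.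
  apply: (integrableS _ _ _ (invg_integrable c z0a)) => //.
  by move=> x /=; rewrite !in_itv/= => /andP[bx ->]; rewrite (le_trans ab (ltW bx)).
case: ifPn => [tz|]; first by rewrite H.
rewrite -ltNge => /ltW zt; rewrite -(H _ _ az zt) opprB//.
Qed.

Lemma is_derive_invg_primitive z : z0 < z -> is_derive z 1 G (g z)^-1.
Proof.
move=> z0z; pose a : R := Num.min ((z0 + z) / 2) theta.
have az : a < z by rewrite /a gt_min; apply/orP; left; lra.
have z0a : z0 < a by rewrite /a lt_min z0theta andbT; lra.
have at' : a <= theta by rewrite /a ge_min lexx orbT.
pose F x := \int[leb]_(t in `[a, x]) (g t)^-1.
have zz : z < z + 1 by lra.
have [dF F'] := continuous_FTC1_closed zz (invg_integrable (z + 1) z0a) az (invg_continuous z0z).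
pose K := \int[leb]_(s in `[a, theta]) (g s)^-1.
have dFK : is_derive z 1 (fun x => F x - K) (g z)^-1.
  rewrite -[(g z)^-1]subr0; apply: is_deriveB.
  by rewrite -F' derive1E; exact/derivableP.
apply: (near_eq_is_derive _ dFK); near=> x.
rewrite (@invg_primitiveE a)//; apply: ltW; near: x; exact: lt_nbhsr.
Unshelve. all: by end_near. Qed.

Lemma invg_primitive_continuous z : z0 < z -> {for z, continuous G}.
Proof.
move=> /is_derive_invg_primitive[d _].
exact/differentiable_continuous/derivable1_diffP.
Qed.

Lemma MVT_invg (F F' : R -> R) x y : z0 < x -> x < y ->
  (forall z, z0 < z -> is_derive z 1 F (F' z)) ->
  exists2 c, x < c < y & F y - F x = F' c * (y - x).
Proof.
move=> z0x xy dF.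
have [||c] := @MVT R F F' x y xy.
- by move=> z; rewrite in_itv/= => /andP[xz _]; apply: dF; exact: lt_trans xz.
- apply: continuous_in_subspaceT => z.
  rewrite inE/= in_itv/= => /andP[xz _].
  have [d _] := dF _ (lt_le_trans z0x xz).
  exact/differentiable_continuous/derivable1_diffP.
by rewrite in_itv/= => cxy E; exists c.
Qed.

Lemma invg_primitive_incr x y : z0 < x -> x < y -> G x < G y.
Proof.
move=> z0x xy; have [c /andP[xc cy] E] := MVT_invg z0x xy is_derive_invg_primitive.
rewrite -subr_gt0 E mulr_gt0 ?subr_gt0// invr_gt0 gpos//.
exact: lt_trans xc.
Qed.

Lemma invg_primitive_mono x y : z0 < x -> z0 < y -> (G x < G y) = (x < y).
Proof.
move=> z0x z0y; apply/idP/idP; last exact: invg_primitive_incr.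
apply: contraTT; rewrite -!leNgt le_eqVlt => /predU1P[->//|].
by move=> yx; exact/ltW/invg_primitive_incr.
Qed.

Lemma invg_primitive_inj x y : z0 < x -> z0 < y -> G x = G y -> x = y.
Proof.
move=> z0x z0y E; apply/eqP; rewrite eq_le !leNgt.
by rewrite -(invg_primitive_mono z0x z0y) -(invg_primitive_mono z0y z0x) E ltxx.
Qed.

(** A bound M on [G] would, by monotone convergence, bound the divergent integral of 1/g over
    [theta, +oo[. *)
Lemma invg_primitive_ubound (M : R) : exists2 z, z0 < z & M < G z.
Proof.
apply: contrapT => nM.
have GM z : z0 < z -> G z <= M.
  by move=> z0z; rewrite leNgt; apply/negP => h; apply: nM; exists z.
pose F n : set (measurableTypeR R) := `[theta, theta + n%:R]%classic.
have FU : \bigcup_n F n = `[theta, +oo[%classic.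
  apply/seteqP; split => [x [n _]|x]; rewrite /F/= !in_itv/=; first by case/andP => ->.
  rewrite andbT => tx; exists (Num.Def.truncn (x - theta)).+1 => //=.
  rewrite in_itv/= tx/= -lerBlDl ltW//; have := truncnS_gt (x - theta).
  by [].
have nd : nondecreasing_seq F.
  move=> m n mn; rewrite subsetEset => x; rewrite /F/= !in_itv/= => /andP[-> h]/=.
  by rewrite (le_trans h)// lerD2l ler_nat.
have /cvg_lim : (\int[leb]_(z in F n) ((g z)^-1)%:E)%E @[n --> \oo] -->
    (\int[leb]_(z in \bigcup_n F n) ((g z)^-1)%:E)%E.
  apply: ge0_nondecreasing_set_cvg_integral => //.
  - by move=> n; exact: measurable_itv.
  - by move=> n; have /integrableP[] := invg_integrable (theta + n%:R) z0theta.
  - move=> n x; rewrite /F/= in_itv/= => /andP[tx _].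
    by rewrite lee_fin invr_ge0 ltW// gpos// (lt_le_trans z0theta).
rewrite FU gint => /(_ (@ereal_hausdorff R)) limE.
have : (limn (fun n => \int[leb]_(z in F n) ((g z)^-1)%:E)%E <= M%:E)%E.
  apply: lime_le; last first.
    apply: nearW => n.
    have tn : theta <= theta + n%:R by rewrite lerDl.
    have z0n : z0 < theta + n%:R by exact: lt_le_trans tn.
    have := GM _ z0n; rewrite /G /ointegral tn -lee_fin /Rintegral fineK//.
    exact: (integrable_fin_num _ (invg_integrable (theta + n%:R) z0theta)).
  apply/ereal_nondecreasing_is_cvgn.
  apply: ge0_nondecreasing_set_nondecreasing_integral => //.
  - by move=> n; exact: measurable_itv.
  - by move=> n; have /integrableP[] := invg_integrable (theta + n%:R) z0theta.
  - move=> n x; rewrite /F/= in_itv/= => /andP[tx _].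
    by rewrite lee_fin invr_ge0 ltW// gpos// (lt_le_trans z0theta).
by rewrite limE leye_eq.
Qed.

(* Near z0 the C^1 hypothesis gives g z <= C (z - z0), so that the primitive of
   1/g lies below (1/C) ln (z - z0) up to a constant. *)
Lemma invg_primitive_lbound (M : R) : exists2 z, z0 < z & G z < M.
Proof.
have [h [_ [_ hd]]] := gC1.
pose C : R := `|h z0| + 1.
have C0 : 0 < C by rewrite /C ltr_wpDl.
have [d d0 gC] : exists2 d : R, 0 < d & forall z, z0 < z -> z < z0 + d -> g z <= C * (z - z0).
  move/cvgrPdist_lt : hd => /(_ 1 ltr01) [d /= d0 hd].
  exists d => // z z0z zd.
  have zz0 : 0 < z - z0 by rewrite subr_gt0.
  have := hd (z - z0); rewrite /ball/= sub0r normrN gtr0_norm// => /(_ _ zz0).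
  rewrite gz0 subr0 (_ : z0 + (z - z0) = z); last by ring.
  have zd' : z - z0 < d by lra.
  move=> /(_ zd') h1; rewrite -ler_pdivrMr//.
  have h2 := ler_norm (h z0).
  by move: h1; rewrite ltr_norml /C => /andP[h1 _]; lra.
pose K (z : R) := G z - C^-1 * ln (z - z0).
have dK z : z0 < z -> is_derive z 1 K ((g z)^-1 - C^-1 * (z - z0)^-1).
  move=> z0z; have dG := is_derive_invg_primitive z0z.
  have dl : is_derive z 1 (fun z : R => ln (z - z0)) (z - z0)^-1.
    have zz0 : 0 < z - z0 by rewrite subr_gt0.
    have d1 : is_derive z 1 (fun z : R => z - z0) 1.
      by rewrite -[X in is_derive _ _ _ X]subr0; exact: is_deriveB.
    have := @is_derive1_comp R (@ln R) (fun z : R => z - z0) z _ _ (is_derive1_ln zz0) d1.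
    by rewrite mulr1.
  exact: is_deriveB.
have z01 : z0 + d / 2 > z0 by lra.
have Kle z : z0 < z -> z < z0 + d / 2 -> K z <= K (z0 + d / 2).
  move=> z0z zd; have [c /andP[zc cd] E] := MVT_invg z0z zd dK.
  rewrite -subr_ge0 E mulr_ge0//; last by lra.
  have z0c : z0 < c by lra.
  rewrite subr_ge0 -invfM lef_pV2 ?posrE ?gpos ?mulr_gt0//; last by lra.
  by apply: gC => //; lra.
pose A : R := `|M| + `|K (z0 + d / 2)| + 1.
(* The second term gives ln e <= - C A, and [A] outweighs both |M| and the value of [K] at the
   reference point z0 + d/2. *)
pose e : R := Num.min (d / 4) (expR (- (C * A))).
have e0 : 0 < e by rewrite /e lt_min expR_gt0 andbT; lra.
have ed : e <= d / 4 by rewrite /e ge_min lexx.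
exists (z0 + e); first by lra.
have : K (z0 + e) <= K (z0 + d / 2) by apply: Kle; lra.
rewrite {1}/K (_ : z0 + e - z0 = e); last by ring.
have le : ln e <= - (C * A).
  rewrite -[leRHS]expRK ler_ln ?posrE ?expR_gt0//.
  by rewrite /e ge_min lexx orbT.
have le' : C^-1 * ln e <= - A.
  by rewrite ler_pdivrMl// mulrN.
have h1 := ler_norm (- M); have h2 := ler_norm (K (z0 + d / 2)).
rewrite normrN in h1.
by rewrite /A in le'; lra.
Qed.

(** [G] increases continuously from -oo at z0 to +oo at infinity, so its inverse [Gam] lives on the
    whole line and the flow is defined for times of both signs. *)
Lemma invg_flow_exists : exists Gam : R -> R,
  [/\ forall s : R, z0 < Gam s, forall s : R, G (Gam s) = s,
     forall z : R, z0 < z -> Gam (G z) = z &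
     forall s : R, is_derive s 1 Gam (g (Gam s))].
Proof.
have ex s : exists z, z0 < z /\ G z = s.
  have [a z0a Ga] := invg_primitive_lbound s.
  have [b z0b Gb] := invg_primitive_ubound s.
  have ab : a < b by rewrite -invg_primitive_mono//; exact: lt_trans Gb.
  have [||c] := @IVT R G a b s (ltW ab).
  - apply: continuous_in_subspaceT => x.
    rewrite inE/= in_itv/= => /andP[ax _]; apply: invg_primitive_continuous.
    exact: lt_le_trans ax.
  - rewrite min_l ?max_r ?(ltW Ga) ?(ltW Gb)//; apply/ltW; exact: lt_trans Gb.
  rewrite in_itv/= => /andP[ac _] <-; exists c; split => //.
  exact: lt_le_trans ac.
have [Gam HG] := choice ex.
have Gam0 s : z0 < Gam s by have [] := HG s.
have GK s : G (Gam s) = s by have [] := HG s.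
have GamK z : z0 < z -> Gam (G z) = z.
  by move=> z0z; apply: invg_primitive_inj.
exists Gam; split => // s.
rewrite -{1}(GK s) -[g (Gam s)]invrK.
have z0n : \forall z \near Gam s, z0 < z by exact: lt_nbhsr.
apply: is_derive_inverse.
- by apply: filterS z0n => z; exact: GamK.
- by apply: filterS z0n => z; exact: invg_primitive_continuous.
- exact: is_derive_invg_primitive.
- by rewrite invr_eq0 gt_eqF// gpos.
Qed.

Lemma ointegral_divg q z : z0 < z ->
  ointegral theta z (fun s => q / g s) = q * G z.
Proof.
move=> z0z; rewrite /G /ointegral; case: ifPn => [tz|].
  by rewrite RintegralZl//; exact: invg_integrable.
rewrite -ltNge => zt; rewrite RintegralZl//; last exact: invg_integrable.
by rewrite mulrN.
Qed.

End primitive.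

Section flow.
Context {R : realType}.
Notation leb := (@lebesgue_measure R).
Variables (z0 : R) (g G Gam : R -> R).
Hypothesis gpos : forall z, z0 < z -> 0 < g z.
Hypothesis gcont : forall z, z0 < z -> {for z, continuous g}.
Hypothesis dG : forall z : R, z0 < z -> is_derive z 1 G (g z)^-1.
Hypothesis Gmono : forall x y, z0 < x -> z0 < y -> (G x < G y) = (x < y).
Hypothesis Gam0 : forall s, z0 < Gam s.
Hypothesis GK : forall s, G (Gam s) = s.
Hypothesis GamK : forall z, z0 < z -> Gam (G z) = z.
Hypothesis dGam : forall s : R, is_derive s 1 Gam (g (Gam s)).

Definition flow (t z : R) := Gam (G z - t).

Lemma flow_gt t z : z0 < flow t z.
Proof. exact: Gam0. Qed.

Lemma G_flow t z : G (flow t z) = G z - t.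
Proof. by rewrite /flow GK. Qed.

Lemma flow0 z : z0 < z -> flow 0 z = z.
Proof. by move=> z0z; rewrite /flow subr0 GamK. Qed.

Lemma Gam_lt s s' : (Gam s < Gam s') = (s < s').
Proof. by rewrite -Gmono// !GK. Qed.

Lemma Gam_le s s' : (Gam s <= Gam s') = (s <= s').
Proof. by rewrite !leNgt Gam_lt. Qed.

Lemma is_derive_flow_time (t z : R) : is_derive t 1 (flow ^~ z) (- g (flow t z)).
Proof.
have d1 : is_derive t 1 (fun t : R => G z - t) (-1).
  by rewrite -[X in is_derive _ _ _ X]add0r; exact: is_deriveB.
have := @is_derive1_comp R Gam (fun t : R => G z - t) t _ _ (dGam _) d1.
by rewrite mulrN1.
Qed.

Lemma is_derive_flow (t z : R) : z0 < z ->
  is_derive z 1 (flow t) (g (flow t z) * (g z)^-1).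
Proof.
move=> z0z; have dGz := dG z0z.
have d1 : is_derive z 1 (fun z : R => G z - t) (g z)^-1.
  by rewrite -[X in is_derive _ _ _ X]subr0; exact: is_deriveB.
exact: (@is_derive1_comp R Gam (fun z : R => G z - t) z _ _ (dGam _) d1).
Qed.

Lemma flow_continuous (t z : R) : z0 < z -> {for z, continuous (flow t)}.
Proof.
move=> /(is_derive_flow t)[d _].
exact/differentiable_continuous/derivable1_diffP.
Qed.

Lemma flow_lt t x y : z0 < x -> z0 < y -> (flow t x < flow t y) = (x < y).
Proof. by move=> z0x z0y; rewrite /flow Gam_lt ltrD2r Gmono. Qed.

(** The ends are chosen so that the flow at time t carries the n-th interval for time 0 onto the
    n-th interval for time t. *)
Lemma bigcup_Gam (t : R) :
  \bigcup_n `[Gam (- n%:R - t), Gam (n%:R - t)]%classic = `]z0, +oo[%classic.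
Proof.
apply/seteqP; split => [x [n _]|x]; rewrite /= !in_itv/= andbT.
  by case/andP => h _; exact: lt_le_trans h.
move=> z0x; pose n := (Num.Def.truncn (`|G x| + `|t|)).+1.
exists n => //=; rewrite in_itv/=.
have nG : `|G x| + `|t| < n%:R by exact: truncnS_gt.
have := ler_norm (G x); have := ler_norm (- G x); have := ler_norm t; have := ler_norm (- t).
rewrite !normrN => h1 h2 h3 h4.
by rewrite -(GamK z0x) !Gam_le; apply/andP; split; lra.
Qed.

Lemma nondecreasing_Gam (t : R) :
  nondecreasing_seq (fun n => `[Gam (- n%:R - t), Gam (n%:R - t)]%classic : set R).
Proof.
move=> m n mn; rewrite subsetEset => x; rewrite /= !in_itv/= => /andP[h1 h2].
have mn' : m%:R <= n%:R :> R by rewrite ler_nat.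
apply/andP; split.
  by apply: le_trans h1; rewrite Gam_le; lra.
by apply: (le_trans h2); rewrite Gam_le; lra.
Qed.

Lemma continuous_halfline_measurable (F : R -> R) :
  (forall z, z0 < z -> {for z, continuous F}) ->
  measurable_fun (`]z0, +oo[%classic : set (measurableTypeR R)) F.
Proof.
move=> cF; apply: open_continuous_measurable_fun; first exact: interval_open.
by move=> x; rewrite inE/= in_itv/= andbT => /cF.
Qed.

(** Substitution on the compact intervals of [bigcup_Gam], followed by monotone convergence on both
    sides. *)
Lemma integral_flow (F : R -> R) t : (forall z, z0 < z -> 0 <= F z) ->
  (forall z, z0 < z -> {for z, continuous F}) ->
  (\int[leb]_(z in `]z0, +oo[) (F z)%:E =
   \int[leb]_(z in `]z0, +oo[) (F (flow t z) * (g (flow t z) * (g z)^-1))%:E)%E.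
Proof.
move=> F0 cF.
pose F' z := F (flow t z) * (g (flow t z) * (g z)^-1).
have cF' z : z0 < z -> {for z, continuous (fun z => g (flow t z) * (g z)^-1)}.
  move=> z0z; apply: continuousM.
    apply: (@continuous_comp _ _ _ (flow t) g); first exact: flow_continuous.
    by apply: gcont; exact: flow_gt.
  by apply: continuousV; [rewrite gt_eqF// gpos|exact: gcont].
have cFF' z : z0 < z -> {for z, continuous F'}.
  move=> z0z; apply: continuousM; last exact: cF'.
  apply: (@continuous_comp _ _ _ (flow t) F); first exact: flow_continuous.
  by apply: cF; exact: flow_gt.
have sub s n x : `[Gam (- n%:R - s), Gam (n%:R - s)]%classic x -> z0 < x.
  by rewrite /= in_itv/= => /andP[h _]; exact: lt_le_trans h.
have cvg1 s (H : R -> R) : (forall z, z0 < z -> 0 <= H z) ->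
    (forall z, z0 < z -> {for z, continuous H}) ->
    (\int[leb]_(z in `[Gam (- n%:R - s), Gam (n%:R - s)]) (H z)%:E)%E @[n --> \oo]
      --> (\int[leb]_(z in `]z0, +oo[) (H z)%:E)%E.
  move=> H0 cH; rewrite -(bigcup_Gam s).
  apply: (@ge0_nondecreasing_set_cvg_integral _ (measurableTypeR R)).
  - exact: nondecreasing_Gam.
  - by move=> n; exact: measurable_itv.
  - move=> n; apply/measurable_EFinP.
    apply: measurable_funS (continuous_halfline_measurable cH).
      exact: measurable_itv.
    by move=> x /sub; rewrite /= in_itv/= andbT.
  - by move=> n x /sub z0x; rewrite lee_fin H0.
have c1 := cvg1 t F F0 cF.
have F'0 z : z0 < z -> 0 <= F' z.
  move=> z0z; rewrite !mulr_ge0 ?invr_ge0//; [|exact/ltW/gpos/flow_gt|exact/ltW/gpos].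
  by apply: F0; exact: flow_gt.
have c2 := cvg1 0 F' F'0 cFF'.
apply: (cvg_unique _ c1) => //.
apply: cvg_trans c2; apply: near_eq_cvg; apply: nearW => n /=.
rewrite !subr0; set a := Gam (- n%:R); set b := Gam n%:R.
have ab : a <= b by rewrite Gam_le; have : 0 <= n%:R :> R by []; lra.
have z0a : z0 < a by exact: Gam0.
have D z : z0 < z -> derive1 (flow t) z = g (flow t z) * (g z)^-1.
  by move=> z0z; rewrite derive1E; have [_] := is_derive_flow t z0z.
have cD z : z0 < z -> derive1 (flow t) x @[x --> z] --> derive1 (flow t) z.
  move=> z0z; rewrite D//.
  apply: cvg_trans (cF' _ z0z); apply: near_eq_cvg; near=> x.
  by rewrite D//; near: x; exact: lt_nbhsr.
have -> : Gam (- n%:R - t) = flow t a by rewrite /flow GK.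
have -> : Gam (n%:R - t) = flow t b by rewrite /flow GK.
rewrite (integration_by_substitution_increasing ab).
- apply: eq_integral => x; rewrite inE/= in_itv/= => /andP[ax _].
  by congr EFin; rewrite /F' /= fctE D//; exact: lt_le_trans ax.
- move=> x y; rewrite !in_itv/= => /andP[ax _] /andP[ay _] xy.
  by rewrite flow_lt//; [exact: lt_le_trans ax|exact: lt_le_trans ay].
- move=> x; rewrite in_itv/= => /andP[ax _]; apply: cD; exact: lt_trans ax.
- by apply/cvg_ex; exists (derive1 (flow t) a); apply: cvg_at_right_filter; exact: cD.
- by apply/cvg_ex; exists (derive1 (flow t) b); apply: cvg_at_left_filter; apply: cD; exact: Gam0.
- split.
  + move=> x; rewrite in_itv/= => /andP[ax _].
    by have [] := is_derive_flow t (lt_trans z0a ax).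
  + by apply: cvg_at_right_filter; exact: flow_continuous.
  + by apply: cvg_at_left_filter; apply: flow_continuous; exact: Gam0.
- apply: continuous_in_subspaceT => x; rewrite inE/= in_itv/= => /andP[ax _].
  by apply: cF; apply: lt_le_trans ax; exact: flow_gt.
Unshelve. all: by end_near. Qed.

End flow.

(** * Markov property and first passage *)

Section process.
Context (R : realType) (d : measure_display) (Omega : measurableType d).
Variables (F : R -> set (set Omega)) (P : R -> probability Omega R)
          (X : R -> Omega -> R) (zeta : Omega -> \bar R).
Hypothesis Ffilt : filtration F.
Hypothesis zetaS : stopping_time F zeta.
Hypothesis Xcadlag : cadlag_paths X zeta.
Hypothesis Xnormal : normal P X zeta.
Hypothesis XM : strong_markov F P X zeta.
Implicit Types x y t s r lam v : R.

Definition Lint (lam t : R) (w : Omega) : R :=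
  if (t%:E < zeta w)%E then expR (- (lam * X t w)) else 0.

Lemma Lint_ge0 lam t w : 0 <= Lint lam t w.
Proof. by rewrite /Lint; case: ifP => // _; exact: expR_ge0. Qed.

Lemma Lint_le1 lam t w : 0 <= lam -> 0 <= t -> Lint lam t w <= 1.
Proof.
move=> lam0 t0; rewrite /Lint; case: ifPn => // tz.
rewrite expR_le1 oppr_le0 mulr_ge0//.
by have [/ltW] := Xcadlag t0 tz.
Qed.

(** The functional fed to [strong_markov]; the cemetery +oo contributes 0, also for lam = 0. *)
Definition path_exp (lam s : R) (u : R -> \bar R) : \bar R :=
  if (u s < +oo)%E then (expR (- (lam * fine (u s))))%:E else 0%E.

Lemma path_expE lam s r w :
  path_exp lam s (fun t => Xe X zeta (r + t) w) = (Lint lam (r + s) w)%:E.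
Proof.
rewrite /path_exp /Xe /Lint.
by have [tz|tz] := boolP ((r + s)%:E < zeta w)%E; rewrite /= ?ltry ?ltxx.
Qed.

Lemma path_exp_ge0 lam s u : (0 <= path_exp lam s u)%E.
Proof. by rewrite /path_exp; case: ifP => // _; rewrite lee_fin expR_ge0. Qed.

Local Notation paths := (g_sigma_algebraType (@cylinders R)).

Lemma path_measurableP (H : (R -> \bar R) -> \bar R) :
  measurable_fun [set: paths] (H : paths -> \bar R) -> path_measurable H.
Proof.
move=> mH B mB; have := mH measurableT B mB.
by rewrite setTI.
Qed.

Lemma measurable_coordinate s : 0 <= s ->
  measurable_fun [set: paths] (fun u : paths => (u : R -> \bar R) s).
Proof.
move=> s0 _ B mB; rewrite setTI; apply: sub_sigma_algebra.
by exists s, B.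
Qed.

Lemma path_measurable_exp lam s : 0 <= s -> path_measurable (path_exp lam s).
Proof.
move=> s0; apply: path_measurableP; rewrite /path_exp.
have mc := measurable_coordinate s0.
apply: measurable_fun_ifT => //.
  apply: measurable_fun_lte => //; exact: measurable_cst.
apply/measurable_EFinP; apply: measurableT_comp => //.
apply: measurableT_comp => //; apply: measurable_funM => //.
exact: measurableT_comp mc.
Qed.

Lemma F_sigma t : 0 <= t -> sigma_algebra setT (F t).
Proof. by move=> t0; have [] := Ffilt.1 _ t0. Qed.

Lemma F_measurable t A : 0 <= t -> F t A -> measurable A.
Proof. by move=> t0; have [_] := Ffilt.1 _ t0; exact. Qed.

Local Notation Om t := (g_sigma_algebraType (F t)).

Lemma F_sigmaE t : 0 <= t -> (@measurable _ (Om t)) = F t.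
Proof. by move=> t0; rewrite /measurable/= sigma_algebra_id//; exact: F_sigma. Qed.

Lemma F_mono s t A : 0 <= s -> s <= t -> F s A -> F t A.
Proof. by move=> s0 st; apply: Ffilt.2; rewrite s0. Qed.

Lemma F_alive t : 0 <= t -> F t [set w | (t%:E < zeta w)%E].
Proof.
move=> t0; rewrite -F_sigmaE//.
rewrite [X in measurable X](_ : _ = ~` [set w | (zeta w <= t%:E)%E]); last first.
  by apply/seteqP; split => w /=; rewrite ltNge => /negP.
by apply: measurableC; rewrite F_sigmaE//; exact: zetaS.2.
Qed.

Lemma stopping_cst t : 0 <= t -> stopping_time F (fun=> t%:E).
Proof.
move=> t0; split => [w|s s0]; first by rewrite lee_fin.
rewrite -F_sigmaE//; have [ts|ts] := boolP (t%:E <= s%:E)%E.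
  by rewrite [X in measurable X](_ : _ = setT)//; apply/seteqP; split.
by rewrite [X in measurable X](_ : _ = set0)//; apply/seteqP; split => // w /=; rewrite (negbTE ts).
Qed.

Lemma F_at_cst t A : 0 <= t -> F_at F (fun=> t%:E) A <-> F t A.
Proof.
move=> t0; split => [[_ /(_ _ t0)]|FA].
  by rewrite [X in _ `&` X](_ : _ = setT) ?setIT//; apply/seteqP; split => // w _ /=.
split; first by apply: sub_sigma_algebra; exists t.
move=> s s0; have [ts|ts] := boolP (t <= s).
  rewrite [X in _ `&` X](_ : _ = setT) ?setIT; first exact: (F_mono t0).
  by apply/seteqP; split => // w _ /=; rewrite lee_fin.
rewrite [X in _ `&` X](_ : _ = set0) ?setI0; last first.
  by apply/seteqP; split => // w /=; rewrite lee_fin (negbTE ts).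
by rewrite -F_sigmaE.
Qed.

Lemma EH_exp lam s y : EH P X zeta y (path_exp lam s) = (\int[P y]_w (Lint lam s w)%:E)%E.
Proof.
apply: eq_integral => w _.
rewrite -[in RHS](add0r s) -path_expE; congr path_exp.
by apply/funext => t; rewrite add0r.
Qed.

Lemma integral_Lint0 lam x : 0 < x ->
  (\int[P x]_w (Lint lam 0 w)%:E = (expR (- (lam * x)))%:E)%E.
Proof.
move=> x0; transitivity (\int[P x]_w (expR (- (lam * x)))%:E)%E; last first.
  by rewrite integral_cst//= probability_setT mule1.
apply: ae_eq_integral_nonmeas => [w|w|].
- by rewrite lee_fin Lint_ge0.
- by rewrite lee_fin expR_ge0.
have := Xnormal x0; apply: negligibleS => w /=.
apply: contra_notP => /contrapT; rewrite /Xe /Lint.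
by case: ifPn => // _ [->].
Qed.

(* Adaptedness is not part of the setting; the strong Markov property at a
   constant time yields it up to a P_x-null set. *)
Lemma Lint_version x t : 0 < x -> 0 <= t -> exists V : Omega -> R,
  [/\ measurable_fun [set: Om t] (V : Om t -> R),
      forall w, 0 <= V w <= 1 & {ae P x, forall w, V w = Lint 1 t w}].
Proof.
move=> x0 t0.
have [Y [Y0 mY _ YE]] := XM (stopping_cst t0) (path_measurable_exp 1 (lexx 0)) (path_exp_ge0 1 0) x0.
have mY' : measurable_fun [set: Om t] (Y : Om t -> \bar R).
  move=> _ B mB; rewrite setTI F_sigmaE//.
  by apply/(F_at_cst _ t0); exact: mY.
(* [Y] is pinned down only almost everywhere on {t < zeta}. Clamping gives the bounds at every w and
   changes nothing where [Y] is exp(- X_t). *)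
pose V (w : Omega) : R := if (t%:E < zeta w)%E then Num.max 0 (Num.min 1 (fine (Y w))) else 0.
have mz : @measurable _ (Om t) [set w | (t%:E < zeta w)%E] by rewrite F_sigmaE//; exact: F_alive.
exists V; split.
- apply: measurable_fun_ifT => //.
    apply: (@measurable_fun_bool _ (Om t) setT _ true) => //.
    by rewrite setTI [X in measurable X](_ : _ = [set w | (t%:E < zeta w)%E])//.
  apply: measurable_maxr => //; apply: measurable_minr => //.
  by apply: measurableT_comp mY'.
- move=> w; rewrite /V; case: ifP => _; last by rewrite lexx ler01.
  by rewrite le_max lexx/= ge_max ler01/= ge_min lexx.
apply: filterS YE => w; rewrite /V /Lint; case: ifPn => // tz /(_ isT) ->.
have [X0 _] := Xcadlag t0 tz.
rewrite /= /Xe tz /= EH_exp integral_Lint0//= mul1r.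
rewrite min_r ?max_r ?expR_ge0//.
by rewrite expR_le1 oppr_le0 ltW.
Qed.

(** The conditional expectation [Y] of [strong_markov] is an intermediary: it agrees almost
    everywhere on A with the right integrand, which may replace it in the integral without being
    known to be measurable. *)
Lemma markov_at t H x A : 0 <= t -> path_measurable H -> (forall u, (0 <= H u)%E) ->
  0 < x -> F t A -> A `<=` [set w | (t%:E < zeta w)%E] ->
  (\int[P x]_(w in A) H (fun u => Xe X zeta (t + u) w) =
   \int[P x]_(w in A) EH P X zeta (X t w) H)%E.
Proof.
move=> t0 mH H0 x0 FA Az.
have [Y [Y0 mY YH YE]] := XM (stopping_cst t0) mH H0 x0.
have FA' : F_at F (fun=> t%:E) A by exact/F_at_cst.
have EH0 y : (0 <= EH P X zeta y H)%E by apply: integral_ge0 => w _.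
rewrite -(YH _ FA') !(integral_mkcond A).
apply: ae_eq_integral_nonmeas.
- by apply: erestrict_ge0 => w _.
- by apply: erestrict_ge0 => w _.
apply: filterS YE => w Yw; rewrite !patchE; case: ifPn => // wA.
have tz : (t%:E < zeta w)%E by apply: Az; exact: set_mem.
by rewrite Yw//= /Xe tz.
Qed.

Lemma Lint_semigroup x t s lam v : 0 < x -> 0 <= t -> 0 <= s ->
  (forall y, 0 < y -> (\int[P y]_w (Lint lam s w)%:E = (expR (- (y * v)))%:E)%E) ->
  (\int[P x]_w (Lint lam (t + s) w)%:E = \int[P x]_w (Lint v t w)%:E)%E.
Proof.
move=> x0 t0 s0 Hv.
have H := markov_at t0 (path_measurable_exp lam s0) (path_exp_ge0 lam s) x0 (F_alive t0) (@subset_refl _ _).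
transitivity (\int[P x]_(w in [set w | (t%:E < zeta w)%E]) (Lint lam (t + s) w)%:E)%E.
  rewrite [in RHS]integral_mkcond; apply: eq_integral => w _; rewrite patchE.
  case: ifPn => // /negP; rewrite inE/= => /negP; rewrite -leNgt => zt.
  rewrite /Lint ifF//; apply/negbTE; rewrite -leNgt (le_trans zt)// lee_fin lerDl//.
transitivity (\int[P x]_(w in [set w | (t%:E < zeta w)%E]) path_exp lam s (fun u => Xe X zeta (t + u) w))%E.
  by apply: eq_integral => w _; rewrite path_expE.
rewrite H integral_mkcond; apply: eq_integral => w _; rewrite patchE.
rewrite /Lint; case: ifPn => [|/negP]; rewrite inE/= => tz; last by rewrite ifF//; exact/negbTE/negP.
have [X0 _] := Xcadlag t0 tz.
by rewrite tz EH_exp Hv// mulrC.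
Qed.

End process.

(** * Strict first passage as a measurable path functional *)

Section passage_functional.
Context {R : realType}.
Implicit Types (q l r s t : R).

(** An enumeration of the nonnegative rationals: negative ones, and indices that code no rational,
    are sent to 0. *)
Definition nnrat (n : nat) : R := Num.max 0 (ratr (odflt 0 (unpickle n))).

Lemma nnrat_ge0 n : 0 <= nnrat n.
Proof. by rewrite /nnrat le_max lexx. Qed.

Lemma nnrat_dense (a b : R) : 0 <= a -> a < b -> exists2 n, a < nnrat n & nnrat n < b.
Proof.
move=> a0 ab; have [r] := rat_in_itvoo ab.
rewrite in_itv/= => /andP[ar rb]; exists (pickle r).
  by rewrite /nnrat pickleK/= lt_max ar orbT.
by rewrite /nnrat pickleK/= gt_max rb andbT (le_lt_trans a0).
Qed.

Definition passage_term q l n (u : R -> \bar R) : \bar R :=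
  if (u (nnrat n) < l%:E)%E then (expR (- (q * nnrat n)))%:E else 0%E.

(** For a right-continuous path this is exp(-q T), with T the first time strictly below l.
    Strictness lets rational times detect the passage, so the functional depends on countably many
    coordinates and is measurable. *)
Definition passage q l (u : R -> \bar R) : \bar R :=
  ereal_sup (range (fun n => passage_term q l n u)).

Lemma passage_term_ge0 q l n u : (0 <= passage_term q l n u)%E.
Proof. by rewrite /passage_term; case: ifP => // _; rewrite lee_fin expR_ge0. Qed.

Lemma passage_term_le q l n u : (passage_term q l n u <= passage q l u)%E.
Proof. by apply: ereal_sup_ubound; exists n. Qed.

Lemma passage_ge0 q l u : (0 <= passage q l u)%E.
Proof. exact: le_trans (passage_term_ge0 q l 0 u) (passage_term_le _ _ _ _). Qed.

Lemma measurable_ereal_sup_range d (T : measurableType d) (f : nat -> T -> \bar R) :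
  (forall n, measurable_fun setT (f n)) ->
  measurable_fun setT (fun x => ereal_sup (range (f ^~ x))).
Proof.
move=> mf; rewrite [X in measurable_fun _ X](_ : _ = (fun x => esups (f ^~ x) 0)).
  exact: measurable_fun_esups.
by apply/funext => x; rewrite /esups/= /sdrop; congr ereal_sup; apply/seteqP; split => y [n _ <-]; exists n.
Qed.

Lemma path_measurable_passage q l : path_measurable (passage q l).
Proof.
apply: path_measurableP; apply: measurable_ereal_sup_range => n.
have mc := measurable_coordinate (nnrat_ge0 n).
apply: measurable_fun_ifT => //.
by apply: measurable_fun_lte => //; exact: measurable_cst.
Qed.

(** A delay of h after s costs at most exp(-q s) q h, which is arbitrarily small. *)
Lemma expR_time_le q s (y : \bar R) : 0 <= q -> (0 <= y)%E ->
  (forall e, 0 < e -> exists2 r, r < s + e & ((expR (- (q * r)))%:E <= y)%E) ->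
  ((expR (- (q * s)))%:E <= y)%E.
Proof.
move=> q0 y0 H; have [->|yoo] := eqVneq y +oo%E; first by rewrite leey.
have yfin : y \is a fin_num by rewrite ge0_fin_numE// ltey.
rewrite -(fineK yfin) lee_fin; apply/ler_addgt0Pr => e e0.
pose c := expR (- (q * s)).
have c0 : 0 < c by exact: expR_gt0.
have k0 : 0 < c * q + 1 by rewrite ltr_wpDl// mulr_ge0// ltW.
have [r rs] := H _ (divr_gt0 e0 k0).
rewrite -(fineK yfin) lee_fin => ry.
apply: (@le_trans _ _ (expR (- (q * r)) + e)); last by rewrite lerD2r.
pose h := e / (c * q + 1).
have h1 : c * (1 - q * h) <= expR (- (q * r)).
  apply: (@le_trans _ _ (c * expR (- (q * h)))).
    by rewrite ler_pM2l//; exact: expR_ge1Dx.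
  rewrite -expRD ler_expR -opprD lerN2 -mulrDr ler_wpM2l// ltW//.
rewrite -/c; have h2 : c * q * h <= e.
  rewrite /h mulrA ler_pdivrMr//; nra.
by nra.
Qed.

End passage_functional.

Section martingale.
Context (R : realType) (d : measure_display) (Omega : measurableType d).
Variables (F : R -> set (set Omega)) (P : R -> probability Omega R)
          (X : R -> Omega -> R) (zeta : Omega -> \bar R).
Hypothesis Ffilt : filtration F.
Hypothesis zetaS : stopping_time F zeta.
Hypothesis Xcadlag : cadlag_paths X zeta.
Hypothesis Xnormal : normal P X zeta.
Hypothesis XM : strong_markov F P X zeta.
Implicit Types x y t s r q l : R.

Local Notation Xe := (Xe X zeta).

Lemma Xe_lt s w l : (Xe s w < l%:E)%E -> (s%:E < zeta w)%E /\ X s w < l.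
Proof. by rewrite /Defs.Xe; case: ifPn => // _; rewrite lte_fin. Qed.

Lemma XeE s w : (s%:E < zeta w)%E -> Xe s w = (X s w)%:E.
Proof. by rewrite /Defs.Xe => ->. Qed.

Lemma Xe_lt_right s w l e : 0 <= s -> (Xe s w < l%:E)%E -> 0 < e ->
  exists2 e' : R, 0 < e' <= e & forall r, s < r -> r < s + e' -> (Xe r w < l%:E)%E.
Proof.
move=> s0 /Xe_lt[sz Xl] e0.
have [_ [rc _]] := Xcadlag s0 sz.
have lX : 0 < l - X s w by rewrite subr_gt0.
move/cvgrPdist_lt : rc => /(_ _ lX)[e1 /= e10 He1].
have [e2 e20 He2] : exists2 e2 : R, 0 < e2 & forall r, r < s + e2 -> (r%:E < zeta w)%E.
  case: (zeta w) sz => [z| |] //.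
  - rewrite lte_fin => sz; exists (z - s); first by rewrite subr_gt0.
    by move=> r; rewrite lte_fin; lra.
  - by move=> _; exists 1 => // r _; rewrite ltry.
pose e' : R := Num.min e (Num.min e1 e2).
exists e'; first by rewrite /e' !lt_min e0 e10 e20 ge_min lexx.
move=> r sr; rewrite /e' -ltrBlDl !lt_min => /and3P[_ re1 re2].
rewrite XeE; last by apply: He2; lra.
have := He1 r; rewrite /ball/= distrC gtr0_norm ?subr_gt0// => /(_ re1 sr).
by rewrite ltr_norml lte_fin => /andP[h _]; lra.
Qed.

(** By right-continuity the path is still below l just after t + s, hence at times t + r with r
    rational and arbitrarily close to s. *)
Lemma expR_le_passage q l t s w : 0 <= q -> 0 <= t -> 0 <= s ->
  (Xe (t + s) w < l%:E)%E ->
  ((expR (- (q * s)))%:E <= passage q l (fun u => Xe (t + u) w))%E.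
Proof.
move=> q0 t0 s0 Xl; apply: expR_time_le => //; first exact: passage_ge0.
move=> e e0; have [e' /andP[e'0 e'e] He'] := Xe_lt_right (addr_ge0 t0 s0) Xl e0.
have se' : s < s + e' by lra.
have [n sn ne] := nnrat_dense s0 se'.
exists (nnrat n); first by lra.
have := passage_term_le q l n (fun u => Xe (t + u) w).
by rewrite /passage_term He'//; lra.
Qed.

Definition passage_integrand q l w : \bar R :=
  if (T_below X zeta l w < zeta w)%E
  then (expR (- (q * fine (T_below X zeta l w))))%:E else 0%E.

Lemma passage_integrand_ge0 q l w : (0 <= passage_integrand q l w)%E.
Proof. by rewrite /passage_integrand; case: ifP => // _; rewrite lee_fin expR_ge0. Qed.

Lemma T_below_ge0 l w : (0 <= T_below X zeta l w)%E.
Proof. by apply: le_ereal_inf_tmp => _ [t [t0 _] <-]; rewrite lee_fin. Qed.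

Lemma Xe0_fun w : (fun u => Xe (0 + u) w) = (fun u => Xe u w).
Proof. by apply/funext => u; rewrite add0r. Qed.

(** Being at or below l' means being strictly below l. With the next lemma this places the strict
    passage at l between the weak passages at l' and at l. *)
Lemma passage_integrand_le q l l' w : 0 <= q -> l' < l ->
  (passage_integrand q l' w <= passage q l (fun u => Xe u w))%E.
Proof.
move=> q0 ll; rewrite /passage_integrand; case: ifPn => [Tz|_]; last exact: passage_ge0.
have Tfin : T_below X zeta l' w \is a fin_num.
  by rewrite ge0_fin_numE ?T_below_ge0// (lt_le_trans Tz)// leey.
apply: expR_time_le => //; first exact: passage_ge0.
move=> e e0.
have : (T_below X zeta l' w < (fine (T_below X zeta l' w) + e)%:E)%E.
  by rewrite EFinD fineK// lteDl// lte_fin.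
rewrite {1}/T_below => /ereal_inf_lt [_ [t [t0 [tz Xt]] <-]].
rewrite lte_fin => tT; exists t => //.
rewrite -Xe0_fun; apply: expR_le_passage => //.
by rewrite add0r XeE// lte_fin; lra.
Qed.

Lemma passage_le_integrand q l w : 0 <= q ->
  (passage q l (fun u => Xe u w) <= passage_integrand q l w)%E.
Proof.
move=> q0; apply: ge_ereal_sup => _ [n _ <-].
rewrite /passage_term; case: ifPn => [|_]; last exact: passage_integrand_ge0.
move=> /Xe_lt[nz Xn].
have Tn : (T_below X zeta l w <= (nnrat n)%:E)%E.
  apply: ereal_inf_lbound; exists (nnrat n) => //; split; first exact: nnrat_ge0.
  by split => //; exact: ltW.
rewrite /passage_integrand (le_lt_trans Tn nz) lee_fin ler_expR lerN2 ler_wpM2l//.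
have Tfin : T_below X zeta l w \is a fin_num.
  by rewrite ge0_fin_numE ?T_below_ge0// (le_lt_trans Tn)// ltry.
by rewrite -lee_fin fineK.
Qed.

(** Only rational times up to t and the time t itself are inspected: this keeps the event in [F t]
    up to a null set, and by right-continuity it excludes any passage strictly below l up to t. *)
Definition stays_above l t w := [/\ (t%:E < zeta w)%E,
  forall n, nnrat n <= t -> ~ (Xe (nnrat n) w < l%:E)%E & l <= X t w].

(** Shifting by t does not preserve the rationals, so in both directions a passage at a possibly
    irrational time is brought back to rational ones by [expR_le_passage]. *)
Lemma passage_shift q l t w : 0 <= q -> 0 <= t -> stays_above l t w ->
  passage q l (fun u => Xe u w) =
  ((expR (- (q * t)))%:E * passage q l (fun u => Xe (t + u) w))%E.
Proof.
move=> q0 t0 [tz An Xt]; apply/eqP; rewrite eq_le; apply/andP; split.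
  apply: ge_ereal_sup => _ [n _ <-]; rewrite {1}/passage_term.
  case: ifPn => [Xn|_]; last by rewrite mule_ge0 ?passage_ge0// lee_fin expR_ge0.
  have tn : t <= nnrat n by rewrite leNgt; apply/negP => nt; apply: (An n) => //; exact: ltW.
  have := @expR_le_passage q l t (nnrat n - t) w q0 t0.
  rewrite subr_ge0 tn subrKC => /(_ isT Xn) h.
  rewrite (_ : - (q * nnrat n) = - (q * t) + - (q * (nnrat n - t))); last by ring.
  by rewrite expRD EFinM lee_wpmul2l// lee_fin expR_ge0.
rewrite -lee_pdivlMl ?expR_gt0//; apply: ge_ereal_sup => _ [n _ <-].
rewrite lee_pdivlMl ?expR_gt0// /passage_term.
case: ifPn => [Xn|_]; last by rewrite mule0 passage_ge0.
have n0 := @nnrat_ge0 R n.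
have := @expR_le_passage q l 0 (t + nnrat n) w q0 (lexx _) (addr_ge0 t0 n0).
rewrite add0r Xe0_fun => /(_ Xn).
by rewrite -EFinM -expRD mulrDr opprD.
Qed.

(** A passage then happens at some s <= t, if at all, and exp(-q s) = exp((q' - q) s) exp(-q' s)
    with s <= t in the first factor. *)
Lemma passage_not_above q q' l t w : 0 <= q -> q <= q' -> 0 <= t ->
  ~ stays_above l t w -> (passage q l (fun u => Xe u w) <=
  (expR ((q' - q) * t))%:E * passage q' l (fun u => Xe u w))%E.
Proof.
move=> q0 qq' t0 nA; have q'0 : 0 <= q' by lra.
apply: ge_ereal_sup => _ [n _ <-]; rewrite {1}/passage_term.
case: ifPn => [Xn|_]; last by rewrite mule_ge0 ?passage_ge0// lee_fin expR_ge0.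
have n0 := @nnrat_ge0 R n.
have P0 s : 0 <= s -> (Xe s w < l%:E)%E ->
    ((expR (- (q' * s)))%:E <= passage q' l (fun u => Xe u w))%E.
  by move=> s0 Xs; rewrite -Xe0_fun; apply: expR_le_passage => //; rewrite add0r.
have [s [s0 st sn Xs]] : exists s, [/\ 0 <= s, s <= t, s <= nnrat n & (Xe s w < l%:E)%E].
  have [nt|tn] := leP (nnrat n) t; first by exists (nnrat n); split.
  have tz : (t%:E < zeta w)%E.
    by have [nz _] := Xe_lt Xn; apply: lt_trans nz; rewrite lte_fin.
  apply: contrapT => H; apply: nA; split => // [m mt Xm|].
    by apply: H; exists (nnrat m); split => //; [exact: nnrat_ge0|exact/ltW/(le_lt_trans mt)].
  rewrite leNgt; apply/negP => Xt; apply: H; exists t; split => //; first exact: ltW.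
  by rewrite XeE.
apply: (@le_trans _ _ ((expR ((q' - q) * t))%:E * (expR (- (q' * s)))%:E)%E); last first.
  by rewrite lee_wpmul2l ?lee_fin ?expR_ge0// P0.
rewrite -EFinM -expRD lee_fin ler_expR; nra.
Qed.

(** Let b be the supremum of the times up to which a positive lower bound exists. The left limit at
    b is positive, and right-continuity at b extends the bound beyond b, so b = t. This is what lets
    the levels l exhaust {t < zeta} as l tends to 0. *)
Lemma infimum_pos t w : 0 <= t -> (t%:E < zeta w)%E ->
  exists2 l, 0 < l & forall s, 0 <= s -> s <= t -> l <= X s w.
Proof.
move=> t0 tz.
pose A : set R := [set r | 0 <= r <= t /\ exists2 l : R, 0 < l & forall s, 0 <= s -> s <= r -> l <= X s w].
have z s : s <= t -> (s%:E < zeta w)%E by move=> st; apply: le_lt_trans tz; rewrite lee_fin.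
have A0 : A 0.
  split; first by rewrite lexx.
  have [X0 _] := Xcadlag (lexx 0) (z _ t0).
  exists (X 0 w) => // s s0 s0'.
  by have -> : s = 0 by apply/eqP; rewrite eq_le s0 s0'.
have supA : has_sup A by split; [exists 0|exists t => r [/andP[]]].
pose b := sup A.
have b0 : 0 <= b by apply: sup_upper_bound.
have bt : b <= t by apply: sup_le_ub; [exists 0|move=> r [/andP[]]].
have [Xb [rcb lcb]] := Xcadlag b0 (z _ bt).
have [e1 e10 He1] : exists2 e : R, 0 < e & forall s, b <= s -> s < b + e -> X b w / 2 <= X s w.
  have h : 0 < X b w / 2 by lra.
  move/cvgrPdist_lt : rcb => /(_ _ h)[e /= e0 He]; exists e => // s bs se.
  move: bs; rewrite le_eqVlt => /predU1P[<-|bs]; first by lra.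
  have := He s; rewrite /ball/= distrC gtr0_norm ?subr_gt0// => /(_ _ bs).
  have se' : s - b < e by lra.
  by move=> /(_ se'); rewrite ltr_norml => /andP[h1 h2]; lra.
have [e2 e20 [l2 l20 He2]] : exists2 e : R, 0 < e & exists2 l : R, 0 < l & forall s, 0 <= s -> b - e < s -> s < b -> l <= X s w.
  move: b0; rewrite le_eqVlt => /predU1P[<-|b0].
    by exists 1 => //; exists 1 => // s s0 _ s0'; lra.
  have [l l0 lc] := lcb b0.
  have h : 0 < l / 2 by lra.
  move/cvgrPdist_lt : lc => /(_ _ h)[e /= e0 He]; exists e => //; exists (l / 2) => // s s0 be sb.
  have := He s; rewrite /ball/= gtr0_norm ?subr_gt0// => /(_ _ sb).
  have se' : b - s < e by lra.
  by move=> /(_ se'); rewrite ltr_norml => /andP[h1 h2]; lra.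
have [r Ar br] : exists2 r, A r & b - e2 < r.
  by have [r Ar br] := sup_adherent e20 supA; exists r.
have [/andP[r0 rt] [l l0 Hl]] := Ar.
have rb : r <= b by apply: sup_upper_bound.
pose m := Num.min l (Num.min l2 (X b w / 2)).
have m0 : 0 < m by rewrite /m !lt_min l0 l20/=; lra.
have Hm s : 0 <= s -> s < b + e1 -> m <= X s w.
  move=> s0 se; have [sr|rs] := leP s r.
    by apply: (@le_trans _ _ l); [rewrite /m ge_min lexx|exact: Hl].
  have [bs|sb] := leP b s.
    by apply: (@le_trans _ _ (X b w / 2)); [rewrite /m !ge_min lexx !orbT|exact: He1].
  by apply: (@le_trans _ _ l2); [rewrite /m !ge_min lexx orbT|apply: He2 => //; lra].
exists m => // s s0 st; apply: (Hm s) => //.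
apply: (le_lt_trans st); rewrite ltNge; apply/negP => bet.
have Abe : A (b + e1 / 2).
  split; first by apply/andP; split; lra.
  by exists m => // s' s'0 s'b; apply: Hm => //; lra.
have : b + e1 / 2 <= b by apply: sup_upper_bound.
lra.
Qed.

End martingale.

Lemma measurable_le_cst d (T : measurableType d) (R : realType) (f : T -> R) (c : R) :
  measurable_fun setT f -> measurable [set x | f x <= c].
Proof.
move=> mf; have := mf measurableT `]-oo, c]%classic (measurable_itv _).
by rewrite setTI; congr measurable; apply/seteqP; split => x /=; rewrite in_itv.
Qed.

(** * The martingale identity for the passage functions *)

Section martingale2.
Context (R : realType) (d : measure_display) (Omega : measurableType d).
Variables (F : R -> set (set Omega)) (P : R -> probability Omega R)
          (X : R -> Omega -> R) (zeta : Omega -> \bar R).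
Hypothesis Ffilt : filtration F.
Hypothesis zetaS : stopping_time F zeta.
Hypothesis Xcadlag : cadlag_paths X zeta.
Hypothesis Xnormal : normal P X zeta.
Hypothesis XM : strong_markov F P X zeta.
Variables (Q : R) (Phi : R -> R -> R).
Hypothesis Q0 : 0 < Q.
Hypothesis Phi0 : forall q y : R, Q < q -> 0 < y -> 0 < Phi q y.
Hypothesis Phic : forall q y : R, Q < q -> 0 < y -> {for y, continuous (Phi q)}.
Hypothesis Phir : forall q q' e : R, Q < q -> q < q' -> 0 < e ->
  exists2 l0 : R, 0 < l0 & forall l : R, 0 < l -> l < l0 -> Phi q l <= e * Phi q' l.
Hypothesis passageE : forall l x q : R, 0 < l -> l <= x -> Q < q ->
  laplace_passage P X zeta x q l = (Phi q x / Phi q l)%:E.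
Implicit Types x y t s r q l : R.

Local Notation Xe := (Xe X zeta).
Local Notation LX := (Lint X zeta).

(** Squeezed between the passage formulas at levels l and l' < l; continuity of [Phi q] closes the
    gap as l' increases to l. *)
Lemma EH_passage q l y : Q < q -> 0 < l -> l <= y ->
  EH P X zeta y (passage q l) = (Phi q y / Phi q l)%:E.
Proof.
move=> Qq l0 ly; have q0 : 0 <= q by exact/ltW/(lt_trans Q0).
have y0 : 0 < y by exact: lt_le_trans ly.
have ub : (EH P X zeta y (passage q l) <= (Phi q y / Phi q l)%:E)%E.
  rewrite -passageE// /EH; apply: ae_le_integral_nonmeas => [w|w|].
  - exact: passage_ge0.
  - exact: passage_integrand_ge0.
  - by apply: aeW => w; exact: passage_le_integrand.
have lb l' : 0 < l' -> l' < l -> ((Phi q y / Phi q l')%:E <= EH P X zeta y (passage q l))%E.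
  move=> l'0 l'l; rewrite -passageE//; last by lra.
  apply: ae_le_integral_nonmeas => [w|w|].
  - exact: passage_integrand_ge0.
  - exact: passage_ge0.
  - by apply: aeW => w; exact: (passage_integrand_le Xcadlag).
apply/eqP; rewrite eq_le ub/=.
have fin : EH P X zeta y (passage q l) \is a fin_num.
  rewrite ge0_fin_numE; first by rewrite (le_lt_trans ub)// ltry.
  by apply: integral_ge0 => w _; exact: passage_ge0.
rewrite -(fineK fin) lee_fin.
have c1 : Phi q y / Phi q l' @[l' --> l^'-] --> Phi q y / Phi q l.
  apply: cvg_at_left_filter; apply: cvgM; first exact: cvg_cst.
  apply: cvgV; first by rewrite gt_eqF// Phi0.
  exact: Phic.
rewrite -(cvg_lim _ c1)//; apply: limr_le; first by apply/cvg_ex; eexists; exact: c1.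
near=> l'.
by rewrite -lee_fin fineK//; apply: lb; near: l'; [exact: nbhs_left_gt|exact: nbhs_left_lt].
Unshelve. all: by end_near. Qed.

Lemma Lint_gt l s w : 0 <= s -> (expR (- l) < LX 1 s w) = (Xe s w < l%:E)%E.
Proof.
move=> s0; rewrite /Lint /Defs.Xe; case: ifPn => _.
  by rewrite ltr_expR ltrN2 mul1r lte_fin.
by rewrite ltNge expR_ge0.
Qed.

Lemma Phi_Lint_measurable q : Q < q ->
  measurable_fun [set: R] (fun v : R => if 0 < v < 1 then Phi q (- ln v) else 0).
Proof.
move=> Qq; apply: measurable_fun_if => //.
- apply: measurable_and; exact: measurable_fun_ltr.
- rewrite [X in measurable_fun X](_ : _ = `]0, 1[%classic); last first.
    by apply/seteqP; split => v /=; rewrite in_itv/= => //; case.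
  apply: open_continuous_measurable_fun; first exact: interval_open.
  move=> v; rewrite inE/= in_itv/= => /andP[v0 v1].
  apply: (@continuous_comp _ _ _ (fun v => - ln v) (Phi q)).
    by apply: continuousN; exact: continuous_ln.
  by apply: Phic => //; rewrite oppr_gt0 ln_lt0// v0.
Qed.

Lemma Phi_martingale x t q : 0 < x -> 0 <= t -> Q < q ->
  (\int[P x]_w (if (t%:E < zeta w)%E then Phi q (X t w) else 0)%:E =
   (expR (q * t) * Phi q x)%:E)%E.
Proof.
move=> x0 t0 Qq; have q0 : 0 <= q by exact/ltW/(lt_trans Q0).
have := fun n : nat => Lint_version Ffilt zetaS Xcadlag Xnormal XM x0 (@nnrat_ge0 R n).
move=> /choice[V HV].
have [U [mU _ UE]] := Lint_version Ffilt zetaS Xcadlag Xnormal XM x0 t0.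
(* Outside one null set all the versions, at rational times and at t, agree with the process. *)
pose good w := (forall n, V n w = LX 1 (nnrat n) w) /\ U w = LX 1 t w.
have aegood : {ae P x, forall w, good w}.
  have VE : {ae P x, forall w n, V n w = LX 1 (nnrat n) w}.
    by apply/ae_foralln => n; have [] := HV n.
  by apply: filterS2 VE UE => w.
(* [stays_above] rewritten with the versions: X_s >= l becomes V <= exp(-l), so that [A l] is a
   genuine event of [F t]. *)
pose A l : set Omega := [set w | (t%:E < zeta w)%E] `&`
  \bigcap_(n in [set n | nnrat n <= t]) [set w | V n w <= expR (- l)] `&`
  [set w | U w <= expR (- l)].
have FA l : F t (A l).
  rewrite -(F_sigmaE Ffilt t0); apply: measurableI; first apply: measurableI.
  - by rewrite F_sigmaE//; exact: F_alive.
  - apply: bigcap_measurableType => n /= nt.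
    rewrite F_sigmaE//; apply: (F_mono Ffilt (@nnrat_ge0 R n) nt).
    rewrite -(F_sigmaE Ffilt (@nnrat_ge0 R n)).
    have [mV _ _] := HV n.
    exact: measurable_le_cst mV.
  - exact: measurable_le_cst mU.
have mA l : measurable (A l) by exact: F_measurable (FA l).
have Agood l w : good w -> A l w <-> stays_above X zeta l t w.
  move=> [Vw Uw]; split => [[[tz HA] HU]|[tz HA HU]].
    split => // [n nt|].
      by rewrite -Lint_gt ?nnrat_ge0// -Vw ltNge => /negP; apply; exact: HA.
    have tz' : (t%:E < zeta w)%E := tz.
    have := HU; rewrite /= Uw leNgt Lint_gt// XeE// lte_fin -leNgt//.
  split; first split => // n /= nt.
    by rewrite Vw leNgt Lint_gt ?nnrat_ge0//; apply/negP; exact: HA.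
  by rewrite /= Uw leNgt Lint_gt// XeE// lte_fin -leNgt.
have mVO n : measurable_fun [set: Omega] (V n).
  have [mV _ _] := HV n; move=> _ B mB; rewrite setTI.
  apply: (F_measurable Ffilt (@nnrat_ge0 R n)).
  by rewrite -F_sigmaE ?nnrat_ge0// -[X in measurable X]setTI; exact: mV.
have mUO : measurable_fun [set: Omega] U.
  move=> _ B mB; rewrite setTI; apply: (F_measurable Ffilt t0).
  by rewrite -F_sigmaE// -[X in measurable X]setTI; exact: mU.
pose Hn l n w : \bar R := if expR (- l) < V n w then (expR (- (q * nnrat n)))%:E else 0%E.
pose H l w := ereal_sup (range (fun n => Hn l n w)).
have mH l : measurable_fun setT (H l).
  apply: measurable_ereal_sup_range => n; apply: measurable_fun_ifT => //.
  exact: measurable_fun_ltr.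
have Hgood l w : good w -> H l w = passage q l (fun u => Xe u w).
  move=> [Vw _]; rewrite /H /passage; congr ereal_sup; apply: eq_imagel => n _.
  by rewrite /Hn /passage_term Vw Lint_gt ?nnrat_ge0.
have H0 l w : (0 <= H l w)%E.
  apply: (@le_trans _ _ (Hn l 0%N w)); last by apply: ereal_sup_ubound; exists 0%N.
  by rewrite /Hn; case: ifP => // _; rewrite lee_fin expR_ge0.
pose Z w : R := if 0 < U w < 1 then Phi q (- ln (U w)) else 0.
have mZ : measurable_fun [set: Omega] (EFin \o Z).
  apply/measurable_EFinP.
  exact: (measurableT_comp (Phi_Lint_measurable Qq) mUO).
have Z0 w : 0 <= Z w.
  rewrite /Z; case: ifPn => // /andP[u0 u1]; apply/ltW/Phi0 => //.
  by rewrite oppr_gt0 ln_lt0// u0.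
have Zgood w : good w -> Z w = if (t%:E < zeta w)%E then Phi q (X t w) else 0.
  move=> [_ Uw]; rewrite /Z Uw /Lint.
  have [tz|tz] := boolP (t%:E < zeta w)%E; last by rewrite ltxx.
  have [X0 _] := Xcadlag t0 tz.
  by rewrite expR_gt0 expR_lt1 mul1r oppr_lt0 X0/= expRK opprK.
(* The passage formula multiplied by Phi_q(l) and split over [A l] and its complement. Only the
   remainder, bounded through q', still contains l, as the ratio Phi_q(l)/Phi_q'(l). *)
have split_l l q' : 0 < l -> l <= x -> q < q' ->
    ((expR (- (q * t)))%:E * (\int[P x]_(w in A l) (Z w)%:E) <= (Phi q x)%:E /\
     (Phi q x)%:E <= (expR (- (q * t)))%:E * (\int[P x]_(w in A l) (Z w)%:E) +
       (expR ((q' - q) * t) * Phi q' x * (Phi q l / Phi q' l))%:E)%E.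
  move=> l0 lx qq'; have Qq' : Q < q' by lra.
  have Pl0 : 0 < Phi q l by exact: Phi0.
  have Pl'0 : 0 < Phi q' l by exact: Phi0.
  have total : (\int[P x]_w H l w = (Phi q x / Phi q l)%:E)%E.
    rewrite -EH_passage//; apply: ae_eq_integral_nonmeas => //.
      by move=> w; exact: passage_ge0.
    by apply: filterS aegood => w; exact: Hgood.
  have partA : (\int[P x]_(w in A l) H l w =
      (expR (- (q * t)) / Phi q l)%:E * \int[P x]_(w in A l) (Z w)%:E)%E.
    have := markov_at Ffilt XM t0 (path_measurable_passage q l)
      (@passage_ge0 R q l) x0 (FA l) (fun w Aw => Aw.1.1).
    rewrite !(integral_mkcond (A l)) => ME.
    transitivity (\int[P x]_w ((expR (- (q * t)))%:E *
        ((fun w => passage q l (fun u => Xe (t + u) w)) \_ (A l)) w))%E.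
      apply: ae_eq_integral_nonmeas.
      - by apply: erestrict_ge0 => w _.
      - move=> w; apply: mule_ge0; first by rewrite lee_fin expR_ge0.
        by apply: erestrict_ge0 => w' _; exact: passage_ge0.
      apply: filterS aegood => w gw; rewrite !patchE; case: ifPn => [wA|_]; last by rewrite mule0.
      rewrite Hgood//; apply: (passage_shift Xcadlag) => //.
      by apply/(Agood l w gw); exact: set_mem.
    rewrite integralZl_nonmeas ?expR_gt0//; last first.
      by apply: erestrict_ge0 => w _; exact: passage_ge0.
    rewrite ME EFinM -muleA; congr (_ * _)%E.
    rewrite -integralZl_nonmeas ?invr_gt0//; last first.
      by apply: erestrict_ge0 => w _; rewrite lee_fin.
    apply: ae_eq_integral_nonmeas.
    - apply: erestrict_ge0 => w _; apply: integral_ge0 => w' _; exact: passage_ge0.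
    - move=> w; apply: mule_ge0; first by rewrite lee_fin invr_ge0 ltW.
      by apply: erestrict_ge0 => w' _; rewrite lee_fin.
    apply: filterS aegood => w gw; rewrite !patchE; case: ifPn => [wA|_]; last by rewrite mule0.
    have [tz _ lX] : stays_above X zeta l t w by apply/(Agood l w gw); exact: set_mem.
    by rewrite EH_passage// Zgood// tz -EFinM mulrC.
  have partC : (\int[P x]_(w in ~` A l) H l w <=
      (expR ((q' - q) * t) * (Phi q' x / Phi q' l))%:E)%E.
    rewrite EFinM -EH_passage// -integralZl_nonmeas ?expR_gt0//; last first.
      by move=> w; exact: passage_ge0.
    rewrite [leLHS]integral_mkcond; apply: ae_le_integral_nonmeas.
    - by apply: erestrict_ge0 => w _.
    - by move=> w; apply: mule_ge0; rewrite ?passage_ge0// lee_fin expR_ge0.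
    apply: filterS aegood => w gw; rewrite patchE; case: ifPn => [wA|_]; last first.
      by apply: mule_ge0; rewrite ?passage_ge0// lee_fin expR_ge0.
    rewrite Hgood//; apply: (passage_not_above Xcadlag) => //; first exact: ltW.
    by move/(Agood l w gw); move/set_mem : wA.
  have decomp : (\int[P x]_w H l w = \int[P x]_(w in A l) H l w + \int[P x]_(w in ~` A l) H l w)%E.
    rewrite -ge0_integral_setU//; first by rewrite setUv.
    - exact: measurableC.
    - by rewrite setUv.
    - by rewrite disj_set2E setICr.
  move: decomp; rewrite total partA => decomp.
  have HE : ((Phi q x)%:E = (Phi q l)%:E * (Phi q x / Phi q l)%:E)%E.
    by rewrite -EFinM mulrC divfK// gt_eqF.
  have HE2 : ((Phi q l)%:E * ((expR (- (q * t)) / Phi q l)%:E * \int[P x]_(w in A l) (Z w)%:E) =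
     (expR (- (q * t)))%:E * \int[P x]_(w in A l) (Z w)%:E)%E.
    by rewrite muleA -EFinM mulrC divfK// gt_eqF.
  rewrite -HE2; split.
    rewrite HE lee_pmul2l// decomp leeDl//.
    by apply: integral_ge0 => w _.
  rewrite HE decomp muleDr//; last first.
    apply: ge0_adde_def; rewrite inE.
      apply: mule_ge0; first by rewrite lee_fin divr_ge0 ?expR_ge0// ltW.
      by apply: integral_ge0 => w _; rewrite lee_fin.
    by apply: integral_ge0 => w _.
  rewrite leeD2l// (le_trans (lee_wpmul2l _ partC))//; first by rewrite lee_fin ltW.
  rewrite -EFinM lee_fin; rewrite le_eqVlt; apply/orP; left; apply/eqP; field.
  by rewrite gt_eqF.
pose l_ n : R := x / n.+1%:R.
have l0 n : 0 < l_ n by rewrite /l_ divr_gt0.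
have lx n : l_ n <= x by rewrite /l_ ler_pdivrMr// ler_peMr ?(ltW x0)// ler1n.
have lmono m n : (m <= n)%N -> l_ n <= l_ m.
  by move=> mn; rewrite /l_ ler_pM2l// lef_pV2 ?posrE// ler_nat.
have lim1 : (\int[P x]_(w in A (l_ n)) (Z w)%:E)%E @[n --> \oo] -->
    (\int[P x]_(w in \bigcup_n A (l_ n)) (Z w)%:E)%E.
  apply: ge0_nondecreasing_set_cvg_integral => //.
  - move=> m n mn; rewrite subsetEset => w [[tz HA] HU]; split; first split => //.
      move=> k kt; apply: (le_trans (HA _ kt)).
      by rewrite ler_expR lerN2 lmono.
    by apply: (le_trans HU); rewrite ler_expR lerN2 lmono.
  - by move=> n; exact: measurable_funTS.
  - by move=> n w _; rewrite lee_fin.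
(* By [infimum_pos], a path alive at t almost surely belongs to [A (l_ n)] for some n. *)
have intE : (\int[P x]_w (if (t%:E < zeta w)%E then Phi q (X t w) else 0)%:E =
    \int[P x]_(w in \bigcup_n A (l_ n)) (Z w)%:E)%E.
  rewrite [RHS]integral_mkcond; apply: ae_eq_integral_nonmeas.
  - move=> w; rewrite lee_fin; case: ifPn => // tz; apply/ltW/Phi0 => //.
    by have [] := Xcadlag t0 tz.
  - by apply: erestrict_ge0 => w _; rewrite lee_fin.
  apply: filterS aegood => w gw; rewrite patchE -Zgood//; case: ifPn => // /negP wA.
  rewrite Zgood//; case: ifPn => // tz; exfalso; apply: wA; rewrite inE.
  have [m m0 Hm] := infimum_pos Xcadlag t0 tz.
  have [n ln] : exists n, l_ n <= m.
    exists (Num.Def.truncn (x / m)); rewrite /l_ ler_pdivrMr// mulrC -ler_pdivrMr//.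
    by apply/ltW; exact: truncnS_gt.
  exists n => //; apply/(Agood _ w gw); split => //; last first.
    by apply: (le_trans ln); exact: Hm.
  move=> k kt; have kz : ((nnrat k : R)%:E < zeta w)%E by apply: le_lt_trans tz; rewrite lee_fin.
  rewrite XeE// lte_fin; apply/negP; rewrite -leNgt; apply: (le_trans ln).
  by apply: Hm => //; exact: nnrat_ge0.
rewrite intE; set I := (X in X = _); have I0 : (0 <= I)%E.
  by apply: integral_ge0 => w _; rewrite lee_fin.
suff : ((expR (- (q * t)))%:E * I = (Phi q x)%:E)%E.
  move=> h; rewrite -[LHS]mul1e -(_ : (expR (q * t))%:E * (expR (- (q * t)))%:E = 1)%E; last first.
    by rewrite -EFinM -expRD subrr expR0.
  by rewrite -muleA h -EFinM.
have lim2 : ((expR (- (q * t)))%:E * \int[P x]_(w in A (l_ n)) (Z w)%:E)%E @[n --> \oo] -->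
    ((expR (- (q * t)))%:E * I)%E by exact: cvgeZl.
apply/eqP; rewrite eq_le; apply/andP; split.
  rewrite -(cvg_lim _ lim2)//; apply: lime_le; first by apply/cvg_ex; eexists; exact: lim2.
  apply: nearW => n.
  by have [] := split_l _ (q + 1) (l0 n) (lx n); first by lra.
apply/lee_addgt0Pr => e e0.
have q1 : q < q + 1 by lra.
pose C : R := expR ((q + 1 - q) * t) * Phi (q + 1) x.
have C0 : 0 < C by rewrite /C mulr_gt0 ?expR_gt0// Phi0//; lra.
have [r r0 Hr] := Phir Qq q1 (divr_gt0 e0 C0).
have [n ln] : exists n, l_ n < r.
  exists (Num.Def.truncn (x / r)); rewrite /l_ ltr_pdivrMr// mulrC -ltr_pdivrMr//.
  exact: truncnS_gt.
have [_ h] := split_l _ _ (l0 n) (lx n) q1.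
apply: (le_trans h); apply: leeD.
  rewrite lee_pmul2l ?lte_fin ?expR_gt0//.
  apply: ge0_subset_integral => //.
  - by apply: bigcup_measurable => k _.
  - exact: measurable_funTS.
  - by move=> w _; rewrite lee_fin.
  - by move=> w Aw; exists n.
have Pl'0 : 0 < Phi (q + 1) (l_ n) by apply: Phi0 => //; lra.
rewrite lee_fin -/C mulrC -ler_pdivlMr// ler_pdivrMr//.
exact: Hr.
Qed.

End martingale2.

(** * Laplace transforms above z0 *)

Section killed_power.
Context {R : realType}.
Implicit Types v z : R.

(* kpow 0 0 = 0: a path killed before t contributes 0 to every transform,
   also at z = 0. *)
Definition kpow v z : R := if 0 < v then expR (z * ln v) else 0.

Lemma kpow_ge0 v z : 0 <= kpow v z.
Proof. by rewrite /kpow; case: ifP => // _; exact: expR_ge0. Qed.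

Lemma kpow_le1 v z : v <= 1 -> 0 <= z -> kpow v z <= 1.
Proof.
move=> v1 z0; rewrite /kpow; case: ifP => // _.
by rewrite expR_le1 mulr_ge0_le0// ln_le0.
Qed.

Lemma kpow_continuous v : continuous (kpow v).
Proof.
move=> z; rewrite /kpow; case: (ltP 0 v) => v0; last exact: cvg_cst.
apply: (@continuous_comp _ _ _ (fun z => z * ln v) expR); last exact: continuous_expR.
by apply: continuousM; [exact: cvg_id|exact: cst_continuous].
Qed.

Lemma measurable_kpow d (T : measurableType d) (f h : T -> R) :
  measurable_fun setT f -> measurable_fun setT h ->
  measurable_fun setT (fun x => kpow (f x) (h x)).
Proof.
move=> mf mh; apply: measurable_fun_ifT => //; first exact: measurable_fun_ltr.
apply: measurableT_comp => //; apply: measurable_funM => //.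
exact: measurableT_comp.
Qed.

End killed_power.

Lemma Rintegral_pos d (T : measurableType d) (R : realType)
  (mu : {measure set T -> \bar R}) (D : set T) (f : T -> R) :
  measurable D -> mu D != 0%E -> mu.-integrable D (EFin \o f) ->
  (forall x, D x -> 0 < f x) -> 0 < \int[mu]_(x in D) f x.
Proof.
move=> mD muD If f0; rewrite lt_neqAle eq_sym Rintegral_ge0 ?andbT; last first.
  by move=> x Dx; exact/ltW/f0.
apply: contra_neq muD => I0.
have /integrableP[mf _] := If.
have : (\int[mu]_(x in D) `|(EFin \o f) x| = 0)%E.
  transitivity (\int[mu]_(x in D) (EFin \o f) x)%E.
    apply: eq_integral => x /set_mem Dx /=; rewrite ger0_norm//; exact/ltW/f0.
  have fin : (\int[mu]_(x in D) (EFin \o f) x)%E \is a fin_num by exact: integrable_fin_num.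
  by rewrite -(fineK fin); congr EFin.
move/(ae_eq_integral_abs _ mD mf) => [N [mN N0 DN]].
apply: (@subset_measure0 _ _ _ mu D N) => //.
move=> x Dx; apply: DN => /= /(_ Dx) [fx0].
by have := f0 _ Dx; rewrite fx0 ltxx.
Qed.

Section versions.
Context (R : realType) (d : measure_display) (Omega : measurableType d).
Variables (F : R -> set (set Omega)) (P : R -> probability Omega R)
          (X : R -> Omega -> R) (zeta : Omega -> \bar R).
Hypothesis Ffilt : filtration F.
Hypothesis zetaS : stopping_time F zeta.
Hypothesis Xcadlag : cadlag_paths X zeta.
Hypothesis Xnormal : normal P X zeta.
Hypothesis XM : strong_markov F P X zeta.
Implicit Types x t z : R.

(** A version of exp(- X_t), set to 0 after killing, determines exp(-z X_t) as its power z. One null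
    set therefore serves all z, and w and z become jointly measurable. *)
Lemma kpow_version x t : 0 < x -> 0 <= t -> exists U : Omega -> R,
  [/\ measurable_fun [set: Omega] U, forall w, 0 <= U w <= 1,
   {ae P x, forall w, U w = Lint X zeta 1 t w},
   {ae P x, forall w z, Lint X zeta z t w = kpow (U w) z} &
   forall z, (\int[P x]_w (Lint X zeta z t w)%:E = \int[P x]_w (kpow (U w) z)%:E)%E].
Proof.
move=> x0 t0.
have [U [mU U01 UE]] := Lint_version Ffilt zetaS Xcadlag Xnormal XM x0 t0.
have mUO : measurable_fun [set: Omega] U.
  move=> _ B mB; rewrite setTI; apply: (F_measurable Ffilt t0).
  by rewrite -F_sigmaE// -[X in measurable X]setTI; exact: mU.
have UE' : {ae P x, forall w z, Lint X zeta z t w = kpow (U w) z}.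
  apply: filterS UE => w -> z; rewrite /Lint /kpow.
  have [tz|tz] := boolP (t%:E < zeta w)%E; last by rewrite ltxx.
  by rewrite expR_gt0 expRK mul1r mulrN.
exists U; split => // z; apply: ae_eq_integral_nonmeas.
- by move=> w; rewrite lee_fin Lint_ge0.
- by move=> w; rewrite lee_fin kpow_ge0.
- by apply: filterS UE' => w ->.
Qed.

Lemma integrable_kpow x (U : Omega -> R) z : measurable_fun [set: Omega] U ->
  (forall w, 0 <= U w <= 1) -> 0 <= z ->
  (P x).-integrable setT (EFin \o (fun w => kpow (U w) z)).
Proof.
move=> mU U01 z0; apply: (le_integrableR measurableT (g := fun=> 1)).
- exact: measurable_kpow.
- move=> w _; rewrite ger0_norm ?kpow_ge0// kpow_le1//.
  by have /andP[] := U01 w.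
- exact: finite_measure_integrable_cst.
Qed.

End versions.

(** * Growth and regularity of the passage functions *)

Section passage_transform.
Context {R : realType}.
Notation leb := (@lebesgue_measure R).
Variables (Q z0 theta : R) (g : R -> R).
Hypothesis z0_ge0 : 0 <= z0.
Hypothesis z0theta : z0 < theta.
Hypothesis gC1 : C1_on_halfline z0 g.
Hypothesis gpos : forall z, z0 < z -> 0 < g z.
Hypothesis gz0 : g z0 = 0.
Hypothesis gint : (\int[leb]_(z in `[theta, +oo[) ((g z)^-1)%:E = +oo)%E.
Hypothesis Ngfin : forall q y : R, Q < q -> 0 < y -> Ng g z0 theta q y \is a fin_num.
Implicit Types q y z l x t : R.

Local Notation G := (invg_primitive theta g).
Let D : set (measurableTypeR R) := `]z0, +oo[%classic.
Let mD : measurable D. Proof. exact: measurable_itv. Qed.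

(** The density of the measure exp(q G) dG. *)
Definition Nker q z : R := (g z)^-1 * expR (q * G z).
Local Notation k := Nker.

Lemma Nker_pos q z : z0 < z -> 0 < k q z.
Proof. by move=> z0z; rewrite mulr_gt0 ?expR_gt0// invr_gt0 gpos. Qed.

Lemma Nker_continuous q z : z0 < z -> {for z, continuous (k q)}.
Proof.
move=> z0z; apply: continuousM; first exact: (invg_continuous gC1).
apply: (@continuous_comp _ _ _ (fun z => q * G z) expR); last exact: continuous_expR.
apply: continuousM; first exact: cst_continuous.
exact: (invg_primitive_continuous z0theta gC1).
Qed.

Lemma expRM_continuous y : continuous (fun z : R => expR (- (y * z))).
Proof.
move=> z; apply: (@continuous_comp _ _ _ (fun z => - (y * z)) expR); last exact: continuous_expR.
by apply: continuousN; apply: continuousM; [exact: cst_continuous|exact: cvg_id].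
Qed.

Lemma cexpR_continuous (c z : R) : continuous (fun y : R => c * expR (- (y * z))).
Proof.
move=> y; apply: (@continuousM _ _ (fun=> c) (fun y : R => expR (- (y * z)))).
  exact: cst_continuous.
apply: (@continuous_comp _ _ _ (fun y : R => - (y * z)) expR); last exact: continuous_expR.
by apply: continuousN; apply: continuousM; [exact: cvg_id|exact: cst_continuous].
Qed.

Lemma measurable_Nker q : measurable_fun D (k q).
Proof. by apply: continuous_halfline_measurable => z; exact: Nker_continuous. Qed.

Lemma measurable_Nkerexp q y : measurable_fun D (fun z => k q z * expR (- (y * z))).
Proof.
apply: measurable_funM; first exact: measurable_Nker.
by apply: continuous_halfline_measurable => z _; exact: expRM_continuous.
Qed.

Lemma NgE q y : Ng g z0 theta q y =
  (\int[leb]_(z in D) (k q z * expR (- (y * z)))%:E)%E.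
Proof.
rewrite /Ng.
have E z : z0 < z -> (g z)^-1 * expR (- (y * z) + ointegral theta z (fun s => q / g s)) =
    k q z * expR (- (y * z)).
  by move=> z0z; rewrite (ointegral_divg z0theta gC1)// expRD /Nker mulrAC -mulrA.
rewrite -(@integral_itv_obnd_cbnd _ z0 (BInfty _ false)); last first.
  apply/measurable_EFinP; apply: (eq_measurable_fun _ _ (measurable_Nkerexp q y)).
  by move=> z /set_mem; rewrite /D/= in_itv/= andbT => z0z; rewrite E.
by apply: eq_integral => z; rewrite inE/= in_itv/= andbT => z0z; rewrite E.
Qed.

Lemma integrable_Nker q y : Q < q -> 0 < y ->
  leb.-integrable D (EFin \o (fun z => k q z * expR (- (y * z)))).
Proof.
move=> Qq y0; apply/integrableP; split; first by apply/measurable_EFinP; exact: measurable_Nkerexp.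
under eq_integral => z zD.
  rewrite gee0_abs; last first.
    move: zD; rewrite inE /D /= in_itv/= andbT => z0z.
    by rewrite lee_fin mulr_ge0 ?expR_ge0// ltW// Nker_pos.
  over.
rewrite [X in (X < _)%E](_ : _ = Ng g z0 theta q y); last by rewrite NgE.
by have := Ngfin Qq y0; rewrite fin_numE ltey => /andP[_].
Qed.

Definition Phi q y : R := \int[leb]_(z in D) (k q z * expR (- (y * z))).

Lemma PhiE q y : Phi q y = fine (Ng g z0 theta q y).
Proof. by rewrite NgE. Qed.

Lemma lebD : leb D != 0%E.
Proof. by rewrite /D lebesgue_measure_itv/= ltry. Qed.

Lemma Phi_pos q y : Q < q -> 0 < y -> 0 < Phi q y.
Proof.
move=> Qq y0; apply: Rintegral_pos => //; first exact: lebD.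
  exact: integrable_Nker.
move=> z; rewrite /D/= in_itv/= andbT => z0z.
by rewrite mulr_gt0 ?expR_gt0// Nker_pos.
Qed.

Lemma Phi_continuous q y : Q < q -> 0 < y -> {for y, continuous (Phi q)}.
Proof.
move=> Qq y0.
have y20 : 0 < y / 2 by lra.
have := @continuity_under_integral R _ (measurableTypeR R) leb
  (fun y z => k q z * expR (- (y * z))) D mD (y / 2) (y + 1)
  _ _ (fun z => k q z * expR (- (y / 2 * z))).
apply.
- move=> y' /=; rewrite in_itv/= => /andP[y'1 y'2]; apply: integrable_Nker => //; lra.
- by apply: aeW => z _ y' _; exact: cexpR_continuous.
- exact: integrable_Nker.
- move=> y' /=; rewrite in_itv/= => /andP[y'1 y'2]; apply: aeW => z.
  rewrite /D/= in_itv/= andbT => z0z.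
  rewrite ger0_norm; last by rewrite mulr_ge0 ?expR_ge0// ltW// Nker_pos.
  rewrite ler_wpM2l ?(ltW (Nker_pos _ _))// ler_expR lerN2 ler_wpM2r//; last exact: ltW.
  by apply/ltW; exact: le_lt_trans z0z.
- by rewrite inE/= in_itv/=; apply/andP; split; lra.
Qed.

(** On [theta, Z] with l <= 1/Z one has exp(-l z) >= exp(-1), and exp(q G) >= 1 since G >= 0 there.
    So Phi_q(l) >= exp(-1) G(Z), and [Z] is chosen with G(Z) > e |M|. *)
Lemma Phi_unbounded q (M : R) : Q < q -> 0 <= q ->
  exists2 l0 : R, 0 < l0 & forall l, 0 < l -> l < l0 -> M <= Phi q l.
Proof.
move=> Qq q0.
have [Z z0Z MZ] := invg_primitive_ubound z0theta gC1 gpos gint (`|M| * expR 1).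
have Gt : G theta = 0 by rewrite /invg_primitive /ointegral lexx set_itv1 Rintegral_set1.
have GZ0 : 0 <= G Z by apply: le_trans (ltW MZ); rewrite mulr_ge0 ?expR_ge0.
have tZ : theta <= Z.
  rewrite leNgt; apply/negP => Zt.
  by have := invg_primitive_incr z0theta gC1 gpos z0Z Zt; rewrite Gt ltNge GZ0.
have Z0 : 0 < Z by exact: le_lt_trans z0Z.
exists Z^-1; first by rewrite invr_gt0.
move=> l l0 lZ; have lZ1 : l * Z <= 1 by rewrite -ler_pdivlMr// mul1r ltW.
have I1 := invg_integrable gC1 gpos Z z0theta.
have sub : (`[theta, Z]%classic : set (measurableTypeR R)) `<=` D.
  by move=> z; rewrite /D/= !in_itv/= andbT => /andP[h _]; exact: lt_le_trans h.
have Il := integrable_Nker Qq l0.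
have Il2 := integrableS mD (measurable_itv `[theta, Z]) sub Il.
apply: (@le_trans _ _ (\int[leb]_(z in `[theta, Z]) (k q z * expR (- (l * z))))); last first.
  rewrite /Phi /Rintegral fine_le//; try exact: integrable_fin_num.
  apply: ge0_subset_integral => //.
  - by apply/measurable_EFinP; exact: measurable_Nkerexp.
  - move=> z; rewrite /D/= in_itv/= andbT => z0z.
    by rewrite lee_fin mulr_ge0 ?expR_ge0// ltW// Nker_pos.
apply: (@le_trans _ _ (\int[leb]_(z in `[theta, Z]) (expR (- 1) * (g z)^-1))).
  rewrite RintegralZl//.
  have -> : \int[leb]_(z in `[theta, Z]) (g z)^-1 = G Z by rewrite /invg_primitive /ointegral tZ.
  rewrite expRN -ler_pdivrMl ?invr_gt0 ?expR_gt0// invrK mulrC.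
  apply: le_trans (ltW MZ); rewrite ler_wpM2r ?expR_ge0// ler_norm//.
apply: le_Rintegral => //; first exact: integrableR_Zl.
move=> z /=; rewrite in_itv/= => /andP[tz zZ].
have z0z : z0 < z by exact: lt_le_trans tz.
have Gz : 0 <= G z.
  move: tz; rewrite le_eqVlt => /predU1P[<-|tz]; first by rewrite Gt.
  by rewrite -Gt; exact/ltW/(invg_primitive_incr z0theta gC1 gpos).
rewrite /Nker -mulrA mulrC ler_wpM2l//; first by rewrite invr_ge0 ltW// gpos.
rewrite -expRD ler_expR.
have h1 : l * z <= 1 by apply: le_trans lZ1; rewrite ler_pM2l.
have h2 : 0 <= q * G z by rewrite mulr_ge0.
lra.
Qed.

(** [K] is the level of G beyond which exp(q G) <= (e/2) exp(q' G). Where G <= K, z stays below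
    [Gam K] and the contribution is at most [B], independently of l; it is absorbed because
    Phi_q'(l) tends to infinity. *)
Lemma Phi_ratio q q' (e : R) : 0 <= Q -> Q < q -> q < q' -> 0 < e ->
  exists2 l0 : R, 0 < l0 & forall l, 0 < l -> l < l0 -> Phi q l <= e * Phi q' l.
Proof.
move=> Q0 Qq qq' e0; have Qq' : Q < q' by lra.
have [Gam [Gam0 GK GamK _]] := invg_flow_exists z0theta gC1 gpos gz0 gint.
pose K : R := - ln (e / 2) / (q' - q).
have qq0 : 0 < q' - q by lra.
have eK : expR (- ((q' - q) * K)) = e / 2.
  rewrite /K mulrC divfK ?gt_eqF// opprK lnK// posrE; lra.
pose B := expR (Gam K) * Phi q 1.
have [l1 l10 Hl1] := Phi_unbounded (2 * B / e) Qq' (ltW (le_lt_trans Q0 Qq')).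
exists (Num.min l1 1); first by rewrite lt_min l10 ltr01.
move=> l l0; rewrite lt_min => /andP[ll1 l_1].
have i1 := integrableR_Zl mD (expR (Gam K)) (integrable_Nker Qq ltr01).
have i2 := integrableR_Zl mD (e / 2) (integrable_Nker Qq' l0).
apply: (@le_trans _ _ (B + e / 2 * Phi q' l)); last first.
  have : 2 * B / e <= Phi q' l by exact: Hl1.
  by rewrite ler_pdivrMr//; lra.
have -> : B = \int[leb]_(z in D) (expR (Gam K) * (k q z * expR (- (1 * z)))).
  by rewrite RintegralZl//; exact: integrable_Nker.
have -> : e / 2 * Phi q' l = \int[leb]_(z in D) (e / 2 * (k q' z * expR (- (l * z)))).
  by rewrite RintegralZl//; exact: integrable_Nker.
rewrite -RintegralD//.
suff key z : z0 < z -> k q z * expR (- (l * z)) <=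
    expR (Gam K) * (k q z * expR (- (1 * z))) + e / 2 * (k q' z * expR (- (l * z))).
  apply: le_Rintegral => //; [exact: integrable_Nker|exact: integrableR_D|].
  by move=> z; rewrite /D/= in_itv/= andbT; exact: key.
move=> z0z.
have z_gt0 : 0 < z by exact: le_lt_trans z0z.
have kq := Nker_pos q z0z; have kq' := Nker_pos q' z0z.
have [GzK|KGz] := leP (G z) K.
  have zK : z <= Gam K.
    rewrite leNgt; apply/negP => Kz.
    by have := invg_primitive_incr z0theta gC1 gpos (Gam0 K) Kz; rewrite GK ltNge GzK.
  apply: (@le_trans _ _ (expR (Gam K) * (k q z * expR (- (1 * z))))); last first.
    by rewrite lerDl mulr_ge0//; [rewrite divr_ge0// ltW|rewrite mulr_ge0 ?expR_ge0// ltW].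
  rewrite mulrCA ler_wpM2l ?(ltW kq)// -expRD ler_expR mul1r.
  have : 0 <= l * z by rewrite mulr_ge0// ltW.
  lra.
apply: (@le_trans _ _ (e / 2 * (k q' z * expR (- (l * z))))); last first.
  by rewrite lerDr mulr_ge0 ?expR_ge0// mulr_ge0 ?expR_ge0//; exact: ltW.
rewrite mulrA ler_wpM2r ?expR_ge0// -eK /Nker mulrCA ler_wpM2l ?invr_ge0 ?(ltW (gpos _))//.
rewrite -expRD ler_expR.
nra.
Qed.

End passage_transform.

Section laplace_above.
Context (R : realType) (d : measure_display) (Omega : measurableType d).
Variables (F : R -> set (set Omega)) (P : R -> probability Omega R)
          (X : R -> Omega -> R) (zeta : Omega -> \bar R).
Hypothesis Ffilt : filtration F.
Hypothesis zetaS : stopping_time F zeta.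
Hypothesis Xcadlag : cadlag_paths X zeta.
Hypothesis Xnormal : normal P X zeta.
Hypothesis XM : strong_markov F P X zeta.
Notation leb := (@lebesgue_measure R).
Variables (Q z0 theta : R) (g Gam : R -> R).
Hypothesis Q0 : 0 < Q.
Hypothesis z0_ge0 : 0 <= z0.
Hypothesis z0theta : z0 < theta.
Hypothesis gC1 : C1_on_halfline z0 g.
Hypothesis gpos : forall z, z0 < z -> 0 < g z.
Hypothesis gz0 : g z0 = 0.
Hypothesis gint : (\int[leb]_(z in `[theta, +oo[) ((g z)^-1)%:E = +oo)%E.
Hypothesis Ngfin : forall q y : R, Q < q -> 0 < y -> Ng g z0 theta q y \is a fin_num.
Hypothesis passageE : forall l x q : R, 0 < l -> l <= x -> Q < q ->
  laplace_passage P X zeta x q l = (Phi z0 theta g q x / Phi z0 theta g q l)%:E.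
Local Notation G := (invg_primitive theta g).
Hypothesis Gam0 : forall s, z0 < Gam s.
Hypothesis GK : forall s, G (Gam s) = s.
Hypothesis GamK : forall z, z0 < z -> Gam (G z) = z.
Hypothesis dGam : forall s : R, is_derive s 1 Gam (g (Gam s)).
Implicit Types q y z l x t : R.

Let D : set (measurableTypeR R) := `]z0, +oo[%classic.
Let mD : measurable D. Proof. exact: measurable_itv. Qed.
Local Notation k := (Nker theta g).
Local Notation Ph := (Phi z0 theta g).
Local Notation fl := (flow G Gam).
Let Gmono := invg_primitive_mono z0theta gC1 gpos.
Let dG := is_derive_invg_primitive z0theta gC1 gpos.
Let gcont := C1_halfline_continuous gC1.
Let kpos q z : z0 < z -> 0 < k q z.
Proof. exact: Nker_pos. Qed.
Let ik := integrable_Nker z0theta gC1 gpos Ngfin.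

Lemma Phi_mart x t q : 0 < x -> 0 <= t -> Q < q ->
  (\int[P x]_w (if (t%:E < zeta w)%E then Ph q (X t w) else 0)%:E =
   (expR (q * t) * Ph q x)%:E)%E.
Proof.
apply: (@Phi_martingale _ _ _ F P X zeta _ _ _ _ _ Q) => //.
- exact: (Phi_pos z0theta gC1 gpos Ngfin).
- exact: (Phi_continuous z0_ge0 z0theta gC1 gpos Ngfin).
- move=> q1 q2 e; apply: (Phi_ratio z0_ge0 z0theta gC1 gpos gz0 gint Ngfin).
  exact: ltW.
Qed.

(** The flow lowers G by t, so it multiplies exp(q G) by exp(-q t) and preserves dG. *)
Lemma Phi_flow x t q : 0 < x -> Q < q ->
  leb.-integrable D (EFin \o (fun z => k q z * expR (- (x * fl t z)))) /\
  \int[leb]_(z in D) (k q z * expR (- (x * fl t z))) = expR (q * t) * Ph q x.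
Proof.
move=> x0 Qq.
pose H z := k q z * expR (- (x * z)).
have H0 z : z0 < z -> 0 <= H z.
  by move=> z0z; rewrite mulr_ge0 ?expR_ge0// ltW// kpos.
have cH z : z0 < z -> {for z, continuous H}.
  move=> z0z; apply: continuousM; first exact: (Nker_continuous z0theta gC1 gpos).
  exact: expRM_continuous.
have E z : z0 < z -> H (fl t z) * (g (fl t z) * (g z)^-1) =
    expR (- (q * t)) * (k q z * expR (- (x * fl t z))).
  move=> z0z; rewrite /H /Nker (G_flow GK) mulrBr expRD.
  have g1 : g (fl t z) != 0 by rewrite gt_eqF// gpos//; exact: Gam0.
  have g2 : g z != 0 by rewrite gt_eqF// gpos.
  by field; rewrite g1 g2.
have fin : (\int[leb]_(z in D) (H z)%:E)%E = (Ph q x)%:E.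
  rewrite /Phi /Rintegral fineK//.
  by apply: (integrable_fin_num mD); exact: ik.
have IE : (\int[leb]_(z in D) (expR (- (q * t)) * (k q z * expR (- (x * fl t z))))%:E)%E = (Ph q x)%:E.
  rewrite -fin (integral_flow gpos gcont dG Gmono Gam0 GK GamK dGam t H0 cH).
  apply: eq_integral => z /set_mem; rewrite /D/= in_itv/= andbT => z0z.
  by rewrite E.
have mK : measurable_fun D (fun z => k q z * expR (- (x * fl t z))).
  apply: continuous_halfline_measurable => z z0z.
  apply: continuousM; first exact: (Nker_continuous z0theta gC1 gpos).
  apply: (@continuous_comp _ _ _ (fl t) (fun z => expR (- (x * z)))).
    exact: (flow_continuous dG dGam).
  exact: expRM_continuous.
have iK' : leb.-integrable D (EFin \o (fun z => expR (- (q * t)) * (k q z * expR (- (x * fl t z))))).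
  apply/integrableP; split.
    apply/measurable_EFinP; apply: measurable_funM => //; exact: measurable_cst.
  under eq_integral => z /set_mem zD.
    rewrite gee0_abs; last first.
      move: zD; rewrite /D/= in_itv/= andbT => z0z.
      by rewrite lee_fin !mulr_ge0 ?expR_ge0// ltW// invr_gt0 gpos.
    over.
  by rewrite [X in (X < _)%E]IE ltry.
have iK : leb.-integrable D (EFin \o (fun z => k q z * expR (- (x * fl t z)))).
  have := integrableR_Zl mD (expR (q * t)) iK'.
  apply: eq_integrable => // z _ /=; congr EFin.
  by rewrite mulrA -expRD subrr expR0 mul1r.
split => //.
have : \int[leb]_(z in D) (expR (- (q * t)) * (k q z * expR (- (x * fl t z)))) = Ph q x.
  by rewrite /Rintegral IE.
rewrite RintegralZl// => <-.
by rewrite mulrA -expRD subrr expR0 mul1r.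
Qed.

Definition Lap x t z : R := fine (\int[P x]_w (Lint X zeta z t w)%:E)%E.

Lemma LapE x t z : 0 <= t -> 0 <= z ->
  (\int[P x]_w (Lint X zeta z t w)%:E)%E = (Lap x t z)%:E.
Proof.
move=> t0 z_ge0; rewrite /Lap fineK// ge0_fin_numE; last first.
  by apply: integral_ge0 => w _; rewrite lee_fin Lint_ge0.
apply: (@le_lt_trans _ _ (\int[P x]_w (cst 1%:E w))%E); last first.
  by rewrite integral_cst//= probability_setT mule1 ltry.
apply: ae_le_integral_nonmeas => [w|w|].
- by rewrite lee_fin Lint_ge0.
- by [].
- by apply: aeW => w; rewrite lee_fin (Lint_le1 Xcadlag).
Qed.

(** Tonelli requires joint measurability in w and z, which is supplied by the powers of the version
    [U]. *)
Lemma Phi_tonelli x t q : 0 < x -> 0 <= t -> Q < q ->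
  (\int[leb]_(z in D) (k q z * Lap x t z)%:E = (expR (q * t) * Ph q x)%:E)%E.
Proof.
move=> x0 t0 Qq; rewrite -Phi_mart//.
have [U [mU U01 UE UL UI]] := kpow_version Ffilt zetaS Xcadlag Xnormal XM x0 t0.
pose kD (z : measurableTypeR R) : R := (k q \_ D) z.
have kD0 z : 0 <= kD z.
  rewrite /kD patchE; case: ifPn => // /set_mem; rewrite /D/= in_itv/= andbT => z0z.
  by apply/ltW/kpos.
have mkD : measurable_fun setT kD.
  by apply/(measurable_restrictT _ mD); exact: (measurable_Nker z0theta gC1 gpos).
pose f (p : Omega * measurableTypeR R) : \bar R := (kD p.2 * kpow (U p.1) p.2)%:E.
have mf : measurable_fun setT f.
  apply/measurable_EFinP; apply: measurable_funM.
    exact: measurableT_comp mkD measurable_snd.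
  apply: measurable_kpow; last exact: measurable_snd.
  exact: measurableT_comp mU measurable_fst.
have f0 p : (0 <= f p)%E by rewrite lee_fin mulr_ge0// kpow_ge0.
have := @fubini_tonelli _ _ _ _ R (P x) leb f mf f0.
rewrite /fubini_F /fubini_G => FT.
transitivity (\int[leb]_z \int[P x]_w f (w, z))%E.
  rewrite integral_mkcond; apply: eq_integral => z _; rewrite patchE.
  case: ifPn => zD; last first.
    rewrite /f /= /kD patchE (negbTE zD); under eq_integral do rewrite mul0r.
    by rewrite integral0.
  have z0z : z0 < z by move/set_mem : zD; rewrite /D/= in_itv/= andbT.
  have z_ge0 : 0 <= z by exact/ltW/(le_lt_trans z0_ge0).
  rewrite /f /= /kD patchE zD; under [RHS]eq_integral do rewrite EFinM.
  rewrite integralZl_nonmeas ?kpos//; last by move=> w; rewrite lee_fin kpow_ge0.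
  by rewrite -UI LapE// -EFinM.
rewrite -FT; apply: ae_eq_integral_nonmeas.
- by move=> w; apply: integral_ge0 => z _.
- move=> w; rewrite lee_fin; case: ifPn => // tz; apply/ltW.
  apply: (Phi_pos z0theta gC1 gpos Ngfin) => //.
  by have [] := Xcadlag t0 tz.
apply: filterS UE => w Uw.
have fE : (\int[leb]_z f (w, z) = \int[leb]_(z in D) (k q z * kpow (U w) z)%:E)%E.
  rewrite [RHS]integral_mkcond; apply: eq_integral => z _.
  rewrite /f /= /kD !patchE; case: ifPn => // _; by rewrite mul0r.
rewrite fE Uw /Lint; have [tz|tz] := boolP (t%:E < zeta w)%E; last first.
  by under eq_integral do rewrite /kpow ltxx mulr0; rewrite integral0.
have [X0 _] := Xcadlag t0 tz.
rewrite /Phi /Rintegral fineK; last first.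
  by apply: (integrable_fin_num mD); exact: ik.
apply: eq_integral => z _; rewrite /kpow expR_gt0 expRK mul1r.
by rewrite mulrN [z * _]mulrC.
Qed.

Lemma Lap_continuous x t z : 0 < x -> 0 <= t -> 0 < z -> {for z, continuous (Lap x t)}.
Proof.
move=> x0 t0 z_gt0.
have [U [mU U01 UE UL UI]] := kpow_version Ffilt zetaS Xcadlag Xnormal XM x0 t0.
have -> : Lap x t = fun z => \int[P x]_w kpow (U w) z.
  by apply/funext => z'; rewrite /Lap UI.
have := @continuity_under_integral R _ Omega (P x) (fun z w => kpow (U w) z) setT measurableT
  0 (z + 1) _ _ (fun=> 1); apply.
- move=> z' /=; rewrite in_itv/= => /andP[z'0 _].
  by apply: integrable_kpow => //; exact: ltW.
- by apply: aeW => w _ z' _; exact: kpow_continuous.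
- exact: finite_measure_integrable_cst.
- move=> z' /=; rewrite in_itv/= => /andP[z'0 _]; apply: aeW => w _.
  rewrite ger0_norm ?kpow_ge0// kpow_le1//; last exact: ltW.
  by have /andP[] := U01 w.
- by rewrite inE/= in_itv/=; apply/andP; split => //; lra.
Qed.

Theorem Lap_above x t z : 0 < x -> 0 <= t -> z0 < z ->
  Lap x t z = expR (- (x * fl t z)).
Proof.
move=> x0 t0 z0z.
pose h z := (g z)^-1 * (Lap x t z - expR (- (x * fl t z))).
have z_gt0 z' : z0 < z' -> 0 < z' by exact: le_lt_trans.
have ch z' : z0 < z' -> {for z', continuous h}.
  move=> z0z'; apply: continuousM; first exact: (invg_continuous gC1 gpos).
  apply: continuousB; first by apply: Lap_continuous => //; exact: z_gt0.
  apply: (@continuous_comp _ _ _ (fl t) (fun z => expR (- (x * z)))).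
    exact: (flow_continuous dG dGam).
  exact: expRM_continuous.
have mG : measurable_fun D G.
  by apply: continuous_halfline_measurable => z' z0z'; exact: (invg_primitive_continuous z0theta gC1).
have mh : measurable_fun D h by apply: continuous_halfline_measurable.
have mkL q : measurable_fun D (fun z => k q z * Lap x t z).
  apply: continuous_halfline_measurable => z' z0z'.
  apply: continuousM; first exact: (Nker_continuous z0theta gC1 gpos).
  by apply: Lap_continuous => //; exact: z_gt0.
have Lap0 z' : 0 <= Lap x t z'.
  by rewrite /Lap fine_ge0// integral_ge0// => w _; rewrite lee_fin Lint_ge0.
have ikL q : Q < q -> leb.-integrable D (EFin \o (fun z => k q z * Lap x t z)).
  move=> Qq; apply/integrableP; split; first by apply/measurable_EFinP.
  under eq_integral => z' /set_mem zD.
    rewrite gee0_abs; last first.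
      move: zD; rewrite /D/= in_itv/= andbT => z0z'.
      by rewrite lee_fin mulr_ge0// ltW// kpos.
    over.
  by rewrite [X in (X < _)%E](Phi_tonelli x0 t0 Qq) ltry.
have hE q z' : h z' * expR (q * G z') = k q z' * Lap x t z' - k q z' * expR (- (x * fl t z')).
  by rewrite /h /Nker; ring.
have null : exp_null leb D G Q h.
  split; first split => // q Qq.
    under eq_fun do rewrite hE.
    by apply: integrableR_B => //; [exact: ikL|have [] := Phi_flow t x0 Qq].
  move=> q Qq; rewrite /exp_transform; under eq_Rintegral do rewrite hE.
  have [iF FE] := Phi_flow t x0 Qq.
  rewrite RintegralB//; last exact: ikL.
  by rewrite FE /Rintegral Phi_tonelli//= subrr.
have h0 : h z = 0.
  apply: (exp_null_eq0 mG _ z0z _ _ null); last 2 first.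
  - exact: ch.
  - exact: (invg_primitive_continuous z0theta gC1).
  move=> a b; rewrite !inE /D/= !in_itv/= !andbT => za zb ab.
  exact: (invg_primitive_incr z0theta gC1).
move/eqP : h0; rewrite /h mulf_eq0 invr_eq0 gt_eqF ?gpos//= subr_eq0.
by move/eqP.
Qed.

End laplace_above.

(** * Laplace transforms at all arguments *)

(** Nonnegativity makes f monotone, so (n+1) f x lies between k f 1 and (k+1) f 1 whenever k <=
    (n+1) x < k+1; n is taken large enough to contradict a positive gap. *)
Lemma additive_nonneg_linear {R : realType} (f : R -> R) :
  (forall x, 0 < x -> 0 <= f x) ->
  (forall x y, 0 < x -> 0 < y -> f (x + y) = f x + f y) ->
  forall x, 0 < x -> f x = x * f 1.
Proof.
move=> f0 fD.
have fnat n x : 0 < x -> f (n.+1%:R * x) = n.+1%:R * f x.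
  move=> x0; elim: n => [|n ih]; first by rewrite !mul1r.
  by rewrite -natr1 !mulrDl !mul1r fD// ?ih// mulr_gt0.
have fmono x y : 0 < x -> x <= y -> f x <= f y.
  move=> x0; rewrite le_eqVlt => /predU1P[->//|xy].
  by rewrite -[y](subrKC x) fD// ?subr_gt0// lerDl f0// subr_gt0.
move=> x x0; apply/eqP; rewrite -subr_eq0 -normr_eq0; apply: contraT => h.
have h0 : 0 < `|f x - x * f 1| by rewrite lt_def h normr_ge0.
set a := `|_| in h0.
pose n := Num.Def.truncn (f 1 / a).
have fn : f 1 < n.+1%:R * a.
  by rewrite -ltr_pdivrMr//; exact: truncnS_gt.
have nx0 : 0 < n.+1%:R * x by rewrite mulr_gt0.
pose k := Num.Def.truncn (n.+1%:R * x).
have kx : k%:R <= n.+1%:R * x by have /andP[] := truncn_itv (ltW nx0).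
have xk : n.+1%:R * x < k.+1%:R by exact: truncnS_gt.
have f1 : 0 <= f 1 by exact: f0.
have ub : n.+1%:R * f x <= k.+1%:R * f 1.
  by rewrite -fnat// -(fnat k)// mulr1; apply: fmono => //; exact: ltW.
have lb : k%:R * f 1 <= n.+1%:R * f x.
  case: k kx {xk ub} => [|k] kx; first by rewrite mul0r mulr_ge0// f0.
  by rewrite -(fnat n)// -(fnat k)// mulr1; apply: fmono.
have : n.+1%:R * a <= f 1.
  rewrite /a -[n.+1%:R](@ger0_norm R)// -normrM mulrBr ler_norml.
  move: xk ub; rewrite -natr1 => xk ub.
  by apply/andP; split; nra.
by rewrite leNgt fn.
Qed.

Lemma Rintegral_prob_cst d (T : measurableType d) (R : realType)
  (P : probability T R) (c : R) : \int[P]_w c = c.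
Proof. by rewrite Rintegral_cst//= probability_setT mulr1. Qed.

Section transforms_continuation.
Context {R : realType}.
Implicit Types (f : R -> R) (q e : R).

(** The conclusion of [exp_transform_left] with threshold 0, isolated as a property of the transform
    alone: f at q - e is recovered from its values on [q, q + e]. *)
Definition exp_continuable f := forall q e, 0 < q - e -> 0 <= e ->
  (\sum_(k < n.+2) binom2 R n.+1 k * f (q + e * k%:R / n.+1%:R)) @[n --> \oo]
    --> f (q - e).

(** With e = z0 + 1 and base point z + e, every sampled point lies above z0. *)
Lemma exp_continuable_eq f1 f2 (z0 : R) : 0 <= z0 ->
  exp_continuable f1 -> exp_continuable f2 ->
  (forall z, z0 < z -> f1 z = f2 z) -> forall z, 0 < z -> f1 z = f2 z.
Proof.
move=> z00 c1 c2 f12 z z_gt0.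
pose e : R := z0 + 1.
have e0 : 0 <= e by rewrite /e; lra.
have ze : 0 < z + e - e by lra.
have := c1 _ _ ze e0; have := c2 _ _ ze e0; rewrite addrK => h2 h1.
apply: (cvg_unique _ h1) => //; apply: cvg_trans h2; apply: near_eq_cvg.
apply: nearW => n; apply: eq_bigr => k _; congr (_ * _); apply/esym/f12.
have : 0 <= e * k%:R / n.+1%:R by rewrite !mulr_ge0// invr_ge0.
by move: (e * _ / _) => b b0; rewrite /e; lra.
Qed.

Lemma exp_continuable_kpow d (T : measurableType d) (mu : {measure set T -> \bar R})
    (f h : T -> R) : measurable_fun setT h -> measurable_fun setT f ->
  (forall z, 0 < z -> mu.-integrable setT (EFin \o (fun x => h x * expR (z * f x)))) ->
  exp_continuable (fun z => \int[mu]_x (h x * expR (z * f x))).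
Proof.
move=> mh mf ih q e qe e0.
by apply: (exp_transform_left measurableT (Q := 0)) => //; split.
Qed.

End transforms_continuation.

Section kpow_more.
Context {R : realType}.
Implicit Types (v z : R).

Lemma kpowE v z : kpow v z = (0 < v)%R%:R * expR (z * ln v).
Proof. by rewrite /kpow; case: ifP => _; rewrite ?mul1r ?mul0r. Qed.

Lemma kpow_anti v z z' : v <= 1 -> z <= z' -> kpow v z' <= kpow v z.
Proof.
move=> v1 zz; rewrite /kpow; case: ifP => // _.
by rewrite ler_expR ler_wnM2r// ln_le0.
Qed.

Lemma kpow_natM v z (n : nat) : kpow v (n.+1%:R * z) = kpow v z ^+ n.+1.
Proof.
rewrite /kpow; case: ifP => _; last by rewrite expr0n.
by rewrite -mulrA expRM_natl.
Qed.

Lemma Bernoulli_sub1X (a : R) (n : nat) : 0 <= a <= 1 -> 1 - a ^+ n <= n%:R * (1 - a).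
Proof.
move=> /andP[a0 a1]; elim: n => [|n ih]; first by rewrite expr0 subrr mul0r.
have an : a ^+ n <= 1 by rewrite exprn_ile1.
have an0 : 0 <= a ^+ n by rewrite exprn_ge0.
rewrite exprS -natr1; nra.
Qed.

(** With y = - ln v, the derivative in the exponent is - y exp(-a y), of modulus at most 1/c for a
    >= c. The point is that the constant is the same for all v. *)
Lemma kpow_lipschitz v (a b c : R) : 0 < c -> c <= a -> c <= b -> v <= 1 ->
  `|kpow v a - kpow v b| <= `|a - b| / c.
Proof.
move=> c0; wlog ab : a b / a <= b => [wl ca cb v1|ca cb v1].
  have [ab|/ltW ba] := leP a b; first exact: wl.
  by rewrite distrC [`|a - b|]distrC; exact: wl.
rewrite /kpow; case: ifPn => v0; last first.
  by rewrite subrr normr0 divr_ge0// ltW.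
pose y := - ln v.
have y0 : 0 <= y by rewrite /y oppr_ge0 ln_le0.
have -> : a * ln v = - (a * y) by rewrite /y mulrN opprK.
have -> : b * ln v = - (a * y) - (b - a) * y by rewrite /y; ring.
rewrite expRD -{1}[expR (- (a * y))]mulr1 -mulrBr normrM ger0_norm ?expR_ge0//.
have ba : 0 <= b - a by lra.
have h0 : 0 <= (b - a) * y by rewrite mulr_ge0.
have h1 : `|1 - expR (- ((b - a) * y))| <= (b - a) * y.
  have := expR_ge1Dx (- ((b - a) * y)) => h.
  rewrite ger0_norm ?subr_ge0; first by lra.
  by rewrite expR_le1 oppr_le0.
have h2 : y * expR (- (a * y)) <= c^-1.
  rewrite -[c^-1]mul1r ler_pdivlMr// mulrC mulrA.
  have cy : c * y <= expR (a * y).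
    apply: (@le_trans _ _ (a * y)); first by rewrite ler_wpM2r.
    by have := expR_ge1Dx (a * y); lra.
  by rewrite expRN ler_pdivrMr ?expR_gt0// mul1r.
rewrite (distrC a) (ger0_norm ba).
apply: (@le_trans _ _ (expR (- (a * y)) * ((b - a) * y))).
  by rewrite ler_wpM2l// expR_ge0.
by rewrite mulrCA ler_wpM2l// mulrC.
Qed.

End kpow_more.

Section all_lambda.
Context (R : realType) (d : measure_display) (Omega : measurableType d).
Variables (F : R -> set (set Omega)) (P : R -> probability Omega R)
          (X : R -> Omega -> R) (zeta : Omega -> \bar R).
Hypothesis Ffilt : filtration F.
Hypothesis zetaS : stopping_time F zeta.
Hypothesis Xcadlag : cadlag_paths X zeta.
Hypothesis Xnormal : normal P X zeta.
Hypothesis XM : strong_markov F P X zeta.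
Variables (z0 : R) (v : R -> R -> R).
Hypothesis z0_ge0 : 0 <= z0.
Hypothesis v_gt : forall t z, z0 < v t z.
Local Notation LapX := (Lap P X zeta).
Hypothesis Lap_v : forall x t z : R, 0 < x -> 0 <= t -> z0 < z ->
  LapX x t z = expR (- (x * v t z)).
Implicit Types x y t s z h e lam : R.

Let version x t (x0 : 0 < x) (t0 : 0 <= t) :=
  kpow_version Ffilt zetaS Xcadlag Xnormal XM x0 t0.

Lemma Lap_version x t : 0 < x -> 0 <= t -> exists U : Omega -> R,
  [/\ measurable_fun [set: Omega] U, forall w, 0 <= U w <= 1,
   {ae P x, forall w z, Lint X zeta z t w = kpow (U w) z} &
   forall z, LapX x t z = \int[P x]_w kpow (U w) z].
Proof.
move=> x0 t0; have [U [mU U01 _ UL UI]] := version x0 t0.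
by exists U; split => // z; rewrite /Lap UI.
Qed.

Lemma Lap_continuable x t : 0 < x -> 0 <= t -> exp_continuable (LapX x t).
Proof.
move=> x0 t0; have [U [mU U01 _ UI]] := Lap_version x0 t0.
have -> : LapX x t = fun z => \int[P x]_w ((0 < U w)%R%:R * expR (z * ln (U w))).
  by apply/funext => z; rewrite UI; apply: eq_Rintegral => w _; rewrite kpowE.
apply: exp_continuable_kpow.
- have -> : (fun w => (0 < U w)%R%:R : R) = (fun w => if 0 < U w then 1 else 0).
    by apply/funext => w; case: ifP.
  by apply: measurable_fun_ifT => //; exact: measurable_fun_ltr.
- exact: measurableT_comp.
- move=> z z_gt0; under eq_fun do rewrite -kpowE.
  by apply: integrable_kpow => //; exact: ltW.
Qed.

(** A product of two transforms is the transform of the product measure, with exponent ln U + ln V;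
    this puts it within reach of [exp_continuable_kpow]. *)
Lemma Lap_mul_continuable x y t : 0 < x -> 0 < y -> 0 <= t ->
  exp_continuable (fun z => LapX x t z * LapX y t z).
Proof.
move=> x0 y0 t0; have [U [mU U01 _ UI]] := Lap_version x0 t0.
have [V [mV V01 _ VI]] := Lap_version y0 t0.
pose mu := (P x \x P y)%E.
pose h (p : Omega * Omega) : R := (0 < U p.1)%R%:R * (0 < V p.2)%R%:R.
pose S (p : Omega * Omega) : R := ln (U p.1) + ln (V p.2).
have hE z p : h p * expR (z * S p) = kpow (U p.1) z * kpow (V p.2) z.
  by rewrite !kpowE /h /S mulrDr expRD; ring.
have mU1 : measurable_fun setT (fun p : Omega * Omega => U p.1).
  exact: measurableT_comp mU measurable_fst.
have mV2 : measurable_fun setT (fun p : Omega * Omega => V p.2).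
  exact: measurableT_comp mV measurable_snd.
have mk z : measurable_fun setT (fun p : Omega * Omega => kpow (U p.1) z * kpow (V p.2) z).
  by apply: measurable_funM; apply: measurable_kpow.
have mb (f : Omega * Omega -> R) : measurable_fun setT f ->
    measurable_fun setT (fun p => (0 < f p)%R%:R : R).
  move=> mf; have -> : (fun w => (0 < f w)%R%:R : R) = (fun w => if 0 < f w then 1 else 0).
    by apply/funext => w; case: ifP.
  by apply: measurable_fun_ifT => //; exact: measurable_fun_ltr.
have iE z : 0 <= z -> (\int[mu]_p (kpow (U p.1) z * kpow (V p.2) z)%:E =
    (LapX x t z * LapX y t z)%:E)%E.
  move=> z_ge0.
  have := @fubini_tonelli1 _ _ _ _ R (P x) (P y) (fun p => (kpow (U p.1) z * kpow (V p.2) z)%:E).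
  rewrite /mu => ->; last 2 first.
  - exact/measurable_EFinP.
  - by move=> p; rewrite lee_fin mulr_ge0// kpow_ge0.
  have iV := integrable_kpow P y mV V01 z_ge0.
  have iU := integrable_kpow P x mU U01 z_ge0.
  transitivity (\int[P x]_w ((kpow (U w) z)%:E * (LapX y t z)%:E))%E.
    apply: eq_integral => w _; rewrite /fubini_F /=.
    under eq_integral do rewrite EFinM.
    rewrite integralZl//; congr (_ * _)%E.
    by rewrite VI /Rintegral fineK//; exact: integrable_fin_num.
  rewrite integralZr// EFinM; congr (_ * _)%E.
  by rewrite UI /Rintegral fineK//; exact: integrable_fin_num.
have c : exp_continuable (fun z => \int[mu]_p (h p * expR (z * S p))).
  apply: exp_continuable_kpow.
  - by apply: measurable_funM; apply: mb.
  - by apply: measurable_funD; apply: measurableT_comp.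
  - move=> z z_gt0; under eq_fun do rewrite hE.
    apply/integrableP; split; first exact/measurable_EFinP.
    under eq_integral do rewrite gee0_abs ?lee_fin ?mulr_ge0 ?kpow_ge0//.
    by rewrite [X in (X < _)%E](iE _ (ltW z_gt0)) ltry.
move=> q e qe e0; have := c _ _ qe e0.
have E z : 0 <= z -> \int[mu]_p (h p * expR (z * S p)) = LapX x t z * LapX y t z.
  move=> z_ge0; under eq_Rintegral do rewrite hE.
  by rewrite /Rintegral iE.
rewrite E ?(ltW qe)//; apply: cvg_trans; apply: near_eq_cvg; apply: nearW => n.
apply: eq_bigr => k _; rewrite E//.
have : 0 <= e * k%:R / n.+1%:R by rewrite !mulr_ge0// invr_ge0.
by move: (e * _ / _) => b b0; lra.
Qed.

Lemma Lap_mulx x y t z : 0 < x -> 0 < y -> 0 <= t -> 0 < z ->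
  LapX (x + y) t z = LapX x t z * LapX y t z.
Proof.
move=> x0 y0 t0.
apply: (exp_continuable_eq z0_ge0 (Lap_continuable (addr_gt0 x0 y0) t0)
  (Lap_mul_continuable x0 y0 t0)) => z' z0z'.
rewrite !Lap_v ?addr_gt0// -expRD; congr expR; ring.
Qed.

Lemma Lap_anti x t z z' : 0 < x -> 0 <= t -> 0 <= z -> z <= z' ->
  LapX x t z' <= LapX x t z.
Proof.
move=> x0 t0 z_ge0 zz; have [U [mU U01 _ UI]] := Lap_version x0 t0.
rewrite !UI; apply: le_Rintegral => //.
- by apply: integrable_kpow => //; exact: le_trans zz.
- exact: integrable_kpow.
- by move=> w _; apply: kpow_anti => //; have /andP[] := U01 w.
Qed.

Lemma Lap_gt0 x t z : 0 < x -> 0 <= t -> 0 <= z -> 0 < LapX x t z.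
Proof.
move=> x0 t0 z_ge0; apply: lt_le_trans (Lap_anti x0 t0 z_ge0 (_ : z <= z + z0 + 1)).
  by rewrite Lap_v ?expR_gt0//; lra.
by have := z0_ge0; lra.
Qed.

Lemma Lap_le1 x t z : 0 < x -> 0 <= t -> 0 <= z -> LapX x t z <= 1.
Proof.
move=> x0 t0 z_ge0; have [U [mU U01 _ UI]] := Lap_version x0 t0.
rewrite UI; apply: (@le_trans _ _ (\int[P x]_w 1)).
  apply: le_Rintegral => //; first exact: integrable_kpow.
    exact: finite_measure_integrable_cst.
  by move=> w _; apply: kpow_le1 => //; have /andP[] := U01 w.
by rewrite Rintegral_prob_cst.
Qed.

(** The exponent u_t(z) for all z >= 0, read off from the starting point 1; above z0 it is [v]. *)
Definition cumulant t z : R := - ln (LapX 1 t z).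
Local Notation u := cumulant.

Lemma expR_cumulant t z : 0 <= t -> 0 <= z -> expR (- u t z) = LapX 1 t z.
Proof. by move=> t0 z_ge0; rewrite /cumulant opprK lnK// posrE Lap_gt0. Qed.

Lemma cumulant_ge0 t z : 0 <= t -> 0 <= z -> 0 <= u t z.
Proof. by move=> t0 z_ge0; rewrite /cumulant oppr_ge0 ln_le0// Lap_le1. Qed.

Lemma Lap_cumulant_pos x t z : 0 < x -> 0 <= t -> 0 < z ->
  LapX x t z = expR (- (x * u t z)).
Proof.
move=> x0 t0 z_gt0; have z_ge0 := ltW z_gt0.
have := @additive_nonneg_linear R (fun x => - ln (LapX x t z)).
move=> /(_ _ _ _ x0) h; rewrite /cumulant -h ?opprK.
- by rewrite lnK// posrE Lap_gt0.
- by move=> y y0; rewrite oppr_ge0 ln_le0// Lap_le1.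
- by move=> a b a0 b0; rewrite Lap_mulx// lnM ?posrE ?Lap_gt0// opprD.
Qed.

Lemma Lap_cvg0 x t : 0 < x -> 0 <= t ->
  LapX x t n.+1%:R^-1 @[n --> \oo] --> LapX x t 0.
Proof.
move=> x0 t0; have [U [mU U01 _ UI]] := Lap_version x0 t0.
rewrite UI; under eq_fun do rewrite UI.
have [] := @Rdominated_cvg _ _ _ (P x) setT measurableT
  (fun n w => kpow (U w) n.+1%:R^-1) (fun w => kpow (U w) 0) (fun=> 1).
- by move=> n; exact: measurable_kpow.
- move=> w _; apply: (@continuous_cvg _ _ _ _ _ _ (kpow (U w))).
    exact: kpow_continuous.
  exact: cvg_harmonic.
- exact: finite_measure_integrable_cst.
- move=> n w _; rewrite ger0_norm ?kpow_ge0// kpow_le1//.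
  by have /andP[] := U01 w.
by [].
Qed.

Lemma cumulant_cvg0 t : 0 <= t -> u t n.+1%:R^-1 @[n --> \oo] --> u t 0.
Proof.
move=> t0; apply: cvgN; apply: (@continuous_cvg _ _ _ _ _ _ (@ln R)).
  by apply: continuous_ln; exact: Lap_gt0.
exact: Lap_cvg0.
Qed.

(** At z = 0 multiplicativity is not continued from above z0 but obtained as the limit along z =
    1/(n+1). *)
Lemma Lap_cumulant x t z : 0 < x -> 0 <= t -> 0 <= z ->
  LapX x t z = expR (- (x * u t z)).
Proof.
move=> x0 t0; rewrite le_eqVlt => /predU1P[<-|]; last exact: Lap_cumulant_pos.
apply: (cvg_unique _ (Lap_cvg0 x0 t0)) => //.
have -> : (fun n => LapX x t n.+1%:R^-1) = (fun n => expR (- (x * u t n.+1%:R^-1))).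
  by apply/funext => n; rewrite Lap_cumulant_pos// invr_gt0.
apply: (@continuous_cvg _ _ _ _ _ _ (@expR R)); first exact: continuous_expR.
by apply: cvgN; apply: cvgM; [exact: cvg_cst|exact: cumulant_cvg0].
Qed.

Lemma cumulant_above t z : 0 <= t -> z0 < z -> u t z = v t z.
Proof. by move=> t0 z0z; rewrite /cumulant Lap_v// expRK opprK mul1r. Qed.

(** If u_t(z) = 0 then 1 - U^z has integral 0. By Bernoulli so has 1 - U^(n z), and for n z > z0
    this contradicts the explicit transform there, which is less than 1. *)
Lemma cumulant_gt0 t z : 0 <= t -> 0 < z -> 0 < u t z.
Proof.
move=> t0 z_gt0; have z_ge0 := ltW z_gt0.
rewrite lt_neqAle cumulant_ge0// andbT; apply/eqP => /esym u0.
have [U [mU U01 _ UI]] := Lap_version ltr01 t0.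
have L1 : LapX 1 t z = 1 by rewrite -expR_cumulant// u0 oppr0 expR0.
pose n := Num.Def.truncn (z0 / z).
have nz : z0 < n.+1%:R * z by rewrite -ltr_pdivrMr//; exact: truncnS_gt.
have nz_ge0 : 0 <= n.+1%:R * z by rewrite mulr_ge0.
have i1 := integrable_kpow P 1 mU U01 z_ge0.
have i2 := integrable_kpow P 1 mU U01 nz_ge0.
have ic : (P 1).-integrable setT (EFin \o (fun=> 1 : R)) by exact: finite_measure_integrable_cst.
have : \int[P 1]_w (1 - kpow (U w) (n.+1%:R * z)) <= \int[P 1]_w (n.+1%:R * (1 - kpow (U w) z)).
  apply: le_Rintegral => //.
  - exact: integrableR_B.
  - by apply: integrableR_Zl => //; exact: integrableR_B.
  move=> w _; rewrite kpow_natM; apply: Bernoulli_sub1X.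
  by rewrite kpow_ge0/= kpow_le1//; have /andP[] := U01 w.
rewrite RintegralZl//; last exact: integrableR_B.
rewrite !RintegralB// -!UI Rintegral_prob_cst L1 subrr mulr0.
rewrite subr_le0 Lap_v// mul1r leNgt expR_lt1 oppr_lt0.
by rewrite (le_lt_trans z0_ge0 (v_gt _ _)).
Qed.

Lemma cumulant0 z : 0 <= z -> u 0 z = z.
Proof.
move=> z_ge0; rewrite /cumulant /Lap (integral_Lint0 Xnormal)//= mulr1.
by rewrite expRK opprK.
Qed.

Lemma cumulant_semigroup t s z : 0 <= t -> 0 <= s -> 0 <= z ->
  u (t + s) z = u t (u s z).
Proof.
move=> t0 s0 z_ge0; rewrite /cumulant; congr (- ln _); rewrite /Lap.
rewrite (Lint_semigroup Ffilt zetaS Xcadlag XM ltr01 t0 s0 (v := u s z))//.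
by move=> y y0; rewrite (LapE P Xcadlag)// Lap_cumulant.
Qed.

Lemma cumulant_mono t z z' : 0 <= t -> 0 <= z -> z <= z' -> u t z <= u t z'.
Proof.
move=> t0 z_ge0 zz; rewrite /cumulant lerN2 ler_ln ?posrE ?Lap_gt0//; last exact: le_trans zz.
exact: Lap_anti.
Qed.

Lemma Lap_cvg_time0 z : 0 <= z -> LapX 1 t z @[t --> 0^'+] --> expR (- z).
Proof.
(* Along a sequence of times, the countably many versions share one null set. *)
move=> z_ge0; apply/cvg_at_rightP => s [s0 scvg].
have := fun n => Lap_version ltr01 (ltW (s0 n)).
move=> /choice[U HU].
have -> : (fun n => LapX 1 (s n) z) = (fun n => \int[P 1]_w kpow (U n w) z).
  by apply/funext => n; have [_ _ _ ->] := HU n.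
have aeL : {ae P 1, forall w n, Lint X zeta z (s n) w = kpow (U n w) z}.
  apply/ae_foralln => n; have [_ _ UL _] := HU n.
  by apply: filterS UL => w ->.
have aeX : {ae P 1, forall w, Xe X zeta 0 w = 1%:E}.
  by have := Xnormal ltr01; apply: negligibleS.
have aec : {ae P 1, forall w, [set: Omega] w -> (kpow (U n w) z)%:E @[n --> \oo] --> (expR (- z))%:E}.
  apply: filterS2 aeL aeX => w L; rewrite /Xe; case: ifPn => // z1 [X1] _.
  have [_ [rc _]] := Xcadlag (lexx 0) z1.
  apply: cvg_EFin; first by apply: nearW.
  have -> : fine \o (fun n => (kpow (U n w) z)%:E) = (fun n => Lint X zeta z (s n) w).
    by apply/funext => n; rewrite /= L.
  have cX : X (s n) w @[n --> \oo] --> X 0 w.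
    by move/cvg_at_rightP : rc => /(_ s); apply.
  have c2 : expR (- (z * X (s n) w)) @[n --> \oo] --> expR (- z).
    rewrite -[X in _ --> expR (- X)]mulr1 -X1.
    apply: (@continuous_cvg _ _ _ _ _ _ (@expR R)); first exact: continuous_expR.
    by apply: cvgN; apply: cvgM; [exact: cvg_cst|].
  apply: cvg_trans c2; apply: near_eq_cvg.
  have [e e0 He] : exists2 e : R, 0 < e & forall r, r < e -> (r%:E < zeta w)%E.
    case: (zeta w) z1 => [y| |] //.
    - by rewrite lte_fin => y0; exists y.
    - by move=> _; exists 1 => // r _; rewrite ltry.
  near=> n; rewrite /Lint He//; near: n.
  by move/cvgr_lt : scvg; apply.
have [] := @dominated_convergence _ _ _ (P 1) setT measurableT
  (fun n w => (kpow (U n w) z)%:E) (cst (expR (- z))%:E) (cst 1%:E).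
- by move=> n; apply/measurable_EFinP; apply: measurable_kpow => //; have [] := HU n.
- exact: measurable_cst.
- exact: aec.
- exact: finite_measure_integrable_cst.
- apply: aeW => w n _; rewrite /= lee_fin ger0_norm ?kpow_ge0// kpow_le1//.
  by have [_ /(_ w) /andP[]] := HU n.
move=> _ _; rewrite integral_cst//= probability_setT mule1 => c.
apply: fine_cvg; exact: c.
Unshelve. all: by end_near. Qed.

Lemma cumulant_cvg_time0 z : 0 <= z -> u t z @[t --> 0^'+] --> z.
Proof.
move=> z_ge0; rewrite -[X in _ --> X]opprK -[X in _ --> - X]expRK.
apply: cvgN; apply: (@continuous_cvg _ _ _ _ _ _ (@ln R)).
  by apply: continuous_ln; exact: expR_gt0.
exact: Lap_cvg_time0.
Qed.

Lemma Lap_lipschitz t (a b c : R) : 0 <= t -> 0 < c -> c <= a -> c <= b ->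
  `|LapX 1 t a - LapX 1 t b| <= `|a - b| / c.
Proof.
move=> t0 c0 ca cb; have [U [mU U01 _ UI]] := Lap_version ltr01 t0.
have ia := integrable_kpow P 1 mU U01 (ltW (lt_le_trans c0 ca)).
have ib := integrable_kpow P 1 mU U01 (ltW (lt_le_trans c0 cb)).
have ic : (P 1).-integrable setT (EFin \o (fun=> `|a - b| / c : R)) by exact: finite_measure_integrable_cst.
rewrite !UI -RintegralB//; apply: (le_trans (le_normr_Rintegral _ _)) => //.
  exact: integrableR_B.
apply: (@le_trans _ _ (\int[P 1]_w (`|a - b| / c))).
  apply: le_Rintegral => //.
    by apply: (integrable_norm (f := fun w => kpow (U w) a - kpow (U w) b)); exact: integrableR_B.
  by move=> w _; apply: kpow_lipschitz => //; have /andP[] := U01 w.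
by rewrite Rintegral_prob_cst.
Qed.

(** The semigroup property turns the time increment into a change of exponent, L_(s+h)(z) =
    L_s(u_h(z)), where the Lipschitz constant 2/z does not depend on s. Uniformity in s upgrades
    right-continuity at 0 to two-sided continuity at t > 0. *)
Lemma Lap_unif_continuous z e : 0 < z -> 0 < e -> exists2 dl : R, 0 < dl &
  forall s h, 0 <= s -> 0 <= h -> h < dl -> `|LapX 1 (s + h) z - LapX 1 s z| <= e.
Proof.
move=> z_gt0 e0.
pose e' : R := Num.min (z / 2) (e * (z / 2)).
have z20 : 0 < z / 2 by lra.
have e'0 : 0 < e' by rewrite /e' lt_min z20 mulr_gt0.
have := cumulant_cvg_time0 (ltW z_gt0).
move/cvgrPdist_lt => /(_ _ e'0)[dl /= dl0 Hdl].
exists dl => // s h s0; rewrite le_eqVlt => /predU1P[<- _|h0 hdl].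
  by rewrite addr0 subrr normr0 ltW.
have := Hdl h; rewrite /ball/= sub0r normrN gtr0_norm// => /(_ hdl h0).
rewrite lt_min => /andP[h1 h2].
have Lsh : LapX 1 (s + h) z = LapX 1 s (u h z).
  rewrite -!expR_cumulant ?cumulant_semigroup ?cumulant_ge0//; try exact: ltW.
  - by rewrite addr_ge0// ltW.
have uz : z / 2 <= u h z by move: h1; rewrite ltr_norml => /andP[]; lra.
rewrite Lsh; apply: (le_trans (@Lap_lipschitz s _ _ (z / 2) s0 _ uz _)); try lra.
by rewrite ler_pdivrMr; [rewrite distrC ltW|lra].
Qed.

Lemma cumulant_continuous t z : 0 < t -> 0 < z -> {for t, continuous (u ^~ z)}.
Proof.
move=> t0 z_gt0.
apply: (@continuousN _ _ _ (fun t => ln (LapX 1 t z))).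
apply: (@continuous_comp _ _ _ (fun t => LapX 1 t z) (@ln R)); last first.
  by apply: continuous_ln; apply: Lap_gt0 => //; exact: ltW.
apply/cvgrPdist_le => e e0; have [dl dl0 H] := Lap_unif_continuous z_gt0 e0.
near=> s.
have s0 : 0 < s by near: s; exact: lt_nbhsr.
have : `|t - s| < dl by near: s; exact: cvgr_dist_lt.
have [ts|st] := leP t s.
  rewrite distrC ger0_norm ?subr_ge0// => h.
  rewrite distrC -[s in LapX _ s](subrKC t); apply: H => //; first exact: ltW.
  by rewrite subr_ge0.
rewrite gtr0_norm ?subr_gt0// => h.
rewrite -[t in LapX _ t](subrKC s); apply: H => //; first exact: ltW.
by rewrite subr_ge0 ltW.
Unshelve. all: by end_near. Qed.

End all_lambda.

(** * Limits of measures along an ultrafilter *)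

Section ultralimit.
Context {R : realType}.

Lemma ultra_bounded_lim (T : Type) (U : set_system T) (UU : UltraFilter U)
    (f : T -> R) (a b : R) : (\forall t \near U, a <= f t <= b) ->
  exists l : R, f @ U --> l.
Proof.
move=> fab.
have UP : ProperFilter U by exact: ultra_proper.
have fU : (f @ U) `[a, b]%classic.
  by apply: filterS fab => t /=; rewrite in_itv.
have [l [_ ll]] := @segment_compact R a b (f @ U) _ fU.
exists l => N Nl; have [UN|UN] := in_ultra_setVsetC (f @^-1` N) UU => //.
have UN' : (f @ U) (~` N) by [].
by have [y [y1 y2]] := ll _ _ UN' Nl.
Qed.

(** Counterexamples for every N would converge, along an ultrafilter, to one common point of
    discontinuity. *)
Lemma unif_continuous01 (phi : R -> R) : continuous phi -> forall e : R, 0 < e ->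
  exists N : nat, forall x y : R, 0 <= x <= 1 -> 0 <= y <= 1 ->
    `|x - y| <= N.+1%:R^-1 -> `|phi x - phi y| <= e.
Proof.
move=> cphi e e0; apply: contrapT => /forallNP H.
have : forall N : nat, exists p : R * R, [/\ 0 <= p.1 <= 1, 0 <= p.2 <= 1,
    `|p.1 - p.2| <= N.+1%:R^-1 & e < `|phi p.1 - phi p.2|].
  move=> N; apply: contrapT => nex; apply: (H N) => x y x01 y01 xy.
  by rewrite leNgt; apply/negP => h; apply: nex; exists (x, y).
move=> /choice[p Hp].
have [U [UU UF]] := @ultraFilterLemma nat (nbhs \oo) _.
have UP : ProperFilter U by exact: ultra_proper.
have [l ll] : exists l : R, (fun n => (p n).1) @ U --> l.
  by apply: (@ultra_bounded_lim _ U UU _ 0 1); apply: filterE => n; have [] := Hp n.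
have d0 : (fun n => (p n).1 - (p n).2) @ U --> 0.
  have h : (fun n => (p n).1 - (p n).2) @ \oo --> 0.
    apply: (@cvg_dist_le_harmonic _ _ _ 1) => n; rewrite subr0 mul1r.
    by have [] := Hp n.
  by move=> A /h; exact: UF.
have ll2 : (fun n => (p n).2) @ U --> l.
  have -> : (fun n => (p n).2) = (fun n => (p n).1 - ((p n).1 - (p n).2)).
    by apply/funext => n; ring.
  by rewrite -[X in _ --> X](subr0 l); exact: cvgB.
have c1 : (fun n => phi (p n).1) @ U --> phi l.
  by apply: (@continuous_cvg _ _ _ _ _ _ phi) => //; exact: cphi.
have c2 : (fun n => phi (p n).2) @ U --> phi l.
  by apply: (@continuous_cvg _ _ _ _ _ _ phi) => //; exact: cphi.
have c3 : (fun n => phi (p n).1 - phi (p n).2) @ U --> phi l - phi l by exact: cvgB.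
move/cvgrPdist_lt : c3 => /(_ _ e0); rewrite subrr => /filter_ex[n].
rewrite sub0r normrN; have [_ _ _ h] := Hp n; move=> /(lt_trans h).
by rewrite ltxx.
Qed.

Definition grid (N i : nat) : R := i%:R / N.+1%:R.

(* The step function phi (grid i.+1) on ]grid i, grid i.+1], written by Abel
   summation so that only indicators of {v <= grid i} occur: its integrals are
   combinations of values of a distribution function. *)
Definition abel_step (phi : R -> R) (N n : nat) (v : R) : R :=
  phi (grid N n) - \sum_(i < n) (phi (grid N i.+1) - phi (grid N i)) * (v <= grid N i)%R%:R.

Lemma grid0 N : grid N 0 = 0.
Proof. by rewrite /grid mul0r. Qed.

Lemma gridN N : grid N N.+1 = 1.
Proof. by rewrite /grid divff// pnatr_eq0. Qed.

Lemma grid_le N i j : (i <= j)%N -> grid N i <= grid N j.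
Proof. by move=> ij; rewrite /grid ler_pM2r ?invr_gt0// ler_nat. Qed.

Lemma grid_ge0 N i : 0 <= grid N i.
Proof. by rewrite /grid divr_ge0. Qed.

Lemma gridS N i : grid N i.+1 = grid N i + N.+1%:R^-1.
Proof. by rewrite /grid -natr1 mulrDl mul1r. Qed.

Lemma abel_step_approx (phi : R -> R) (e : R) (N n : nat) (v : R) :
  (forall x y : R, 0 <= x <= 1 -> 0 <= y <= 1 -> `|x - y| <= N.+1%:R^-1 -> `|phi x - phi y| <= e) ->
  0 <= e -> (n <= N.+1)%N -> 0 <= v -> v <= grid N n ->
  `|phi v - abel_step phi N n v| <= e.
Proof.
move=> H e0; elim: n => [|n ih] nN v0 vn.
  rewrite grid0 in vn; have -> : v = 0 by apply/eqP; rewrite eq_le v0 vn.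
  by rewrite /abel_step big_ord0 grid0 subr0 subrr normr0.
rewrite /abel_step big_ord_recr/=.
have [vn'|vn'] := leP v (grid N n).
  rewrite mulr1 [X in `|_ - X|](_ : _ = abel_step phi N n v); first by apply: ih => //; exact: ltnW.
  by rewrite /abel_step; ring.
rewrite mulr0 addr0 big1 ?subr0; last first.
  move=> i _; have : grid N i <= grid N n by apply: grid_le; exact: ltnW.
  by move=> h; rewrite leNgt (le_lt_trans h vn') mulr0.
have g1 : grid N n.+1 <= 1 by rewrite -(gridN N); exact: grid_le.
apply: H.
- by rewrite v0 (le_trans vn).
- by rewrite grid_ge0 g1.
rewrite distrC ger0_norm ?subr_ge0//.
by rewrite gridS lerBlDl lerD2r ltW.
Qed.

(** The integral of phi is approximated using the total mass and finitely many values of the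
    distribution function only. Applied both to the approximating measures and to their limit. *)
Lemma abel_step_integral d (T : measurableType d) (mu : {measure set T -> \bar R})
    (D : set T) (V k : T -> R) (phi : R -> R) (e : R) (N : nat) :
  measurable D -> measurable_fun D V -> (forall x, D x -> 0 <= V x <= 1) ->
  mu.-integrable D (EFin \o k) -> (forall x, D x -> 0 <= k x) -> continuous phi ->
  (forall x y : R, 0 <= x <= 1 -> 0 <= y <= 1 -> `|x - y| <= N.+1%:R^-1 -> `|phi x - phi y| <= e) ->
  0 <= e ->
  `|\int[mu]_(x in D) (phi (V x) * k x) -
    (phi 1 * \int[mu]_(x in D) k x -
     \sum_(i < N.+1) (phi (grid N i.+1) - phi (grid N i)) *
        \int[mu]_(x in D) (k x * (V x <= grid N i)%R%:R))| <= e * \int[mu]_(x in D) k x.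
Proof.
move=> mD mV V01 ik k0 cphi H e0.
have mk : measurable_fun D k by have /integrableP[/measurable_EFinP] := ik.
have iki i : mu.-integrable D (EFin \o (fun x => k x * (V x <= grid N i)%R%:R)).
  apply: (le_integrableR mD _ _ ik).
    apply: measurable_funM => //.
    have -> : (fun x => (V x <= grid N i)%R%:R : R) = (fun x => if V x <= grid N i then 1 else 0).
      by apply/funext => x; case: ifP.
    by apply: measurable_fun_if => //; exact: measurable_fun_ler.
  move=> x Dx; rewrite normrM (ger0_norm (k0 _ Dx)) ler_piMr ?k0//.
  by case: (V x <= grid N i); rewrite ?normr1 ?normr0.
pose A x := abel_step phi N N.+1 (V x) * k x.
have AE x : A x = phi 1 * k x - \sum_(i < N.+1) (phi (grid N i.+1) - phi (grid N i)) * (k x * (V x <= grid N i)%R%:R).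
  rewrite /A /abel_step gridN mulrBl mulr_suml; congr (_ - _).
  by apply: eq_bigr => i _; ring.
have iterm (i : 'I_N.+1) : mu.-integrable D (EFin \o (fun x => (phi (grid N i.+1) - phi (grid N i)) * (k x * (V x <= grid N i)%R%:R))).
  exact: integrableR_Zl.
have [isum sumE] := Rintegral_sumR mD (index_enum 'I_N.+1) iterm.
have iA : mu.-integrable D (EFin \o A).
  have -> : A = fun x => phi 1 * k x - \sum_(i < N.+1) (phi (grid N i.+1) - phi (grid N i)) * (k x * (V x <= grid N i)%R%:R).
    by apply/funext.
  by apply: integrableR_B => //; exact: integrableR_Zl.
have EA : \int[mu]_(x in D) A x = phi 1 * \int[mu]_(x in D) k x -
     \sum_(i < N.+1) (phi (grid N i.+1) - phi (grid N i)) *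
        \int[mu]_(x in D) (k x * (V x <= grid N i)%R%:R).
  under eq_Rintegral do rewrite AE.
  rewrite RintegralB//; last exact: integrableR_Zl.
  rewrite RintegralZl// sumE; congr (_ - _); apply: eq_bigr => i _.
  by rewrite RintegralZl.
have diff x : D x -> `|phi (V x) * k x - A x| <= e * k x.
  move=> Dx; rewrite /A -mulrBl normrM (ger0_norm (k0 _ Dx)) ler_wpM2r ?k0//.
  have /andP[V0 V1] := V01 _ Dx.
  by apply: abel_step_approx => //; rewrite gridN.
have iphi : mu.-integrable D (EFin \o (fun x => phi (V x) * k x)).
  have := integrableR_D mD (integrable_norm iA) (integrableR_Zl mD e ik).
  apply: le_integrableR => //.
    apply: measurable_funM => //; apply: measurableT_comp => //.
    exact: continuous_measurable_fun.
  move=> x Dx; rewrite /= -{1}[phi (V x) * k x](subrK (A x)) addrC.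
  by rewrite (le_trans (ler_normD _ _))// lerD2l diff.
rewrite -EA -RintegralB// -RintegralZl//.
apply: (le_trans (le_normr_Rintegral _ _)) => //; first exact: integrableR_B.
apply: le_Rintegral => //.
- by apply: (integrable_norm (f := fun x => phi (V x) * k x - A x)); exact: integrableR_B.
- exact: integrableR_Zl.
Qed.

End ultralimit.

Section stieltjes.
Context {R : realType}.
Variable F : R -> R.
Hypothesis Fnd : {homo F : x y / x <= y}.
Hypothesis F0 : forall x, 0 <= F x.

Definition rlimit (a : R) : R := inf [set F b | b in [set b | a < b]].

Lemma rlimit_has_inf a : has_inf [set F b | b in [set b | a < b]].
Proof.
split; first by exists (F (a + 1)); exists (a + 1) => //=; rewrite ltrDl.
by exists 0 => _ [b _ <-].
Qed.

Lemma rlimit_ge a : F a <= rlimit a.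
Proof.
apply: lb_le_inf; first by exists (F (a + 1)); exists (a + 1) => //=; rewrite ltrDl.
by move=> _ [b /= ab <-]; apply: Fnd; exact: ltW.
Qed.

Lemma rlimit_le a b : a < b -> rlimit a <= F b.
Proof. by move=> ab; apply: inf_lbound; [have [] := rlimit_has_inf a|exists b]. Qed.

Lemma rlimit_nd : {homo rlimit : x y / x <= y}.
Proof.
move=> x y xy; apply: lb_le_inf; first by exists (F (y + 1)); exists (y + 1) => //=; rewrite ltrDl.
by move=> _ [b /= yb <-]; apply: rlimit_le; exact: le_lt_trans yb.
Qed.

Lemma rlimit_rc x : rlimit @ x^'+ --> rlimit x.
Proof.
apply/cvgrPdist_le => e e0.
have [_ [b /= xb <-] Fb] := inf_adherent e0 (rlimit_has_inf x).
near=> y.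
have xy : x < y by near: y; exact: nbhs_right_gt.
have yb : y < b by near: y; exact: nbhs_right_lt.
rewrite distrC ger0_norm ?subr_ge0; last by apply: rlimit_nd; exact: ltW.
rewrite lerBlDl; apply: le_trans (ltW Fb); exact: rlimit_le.
Unshelve. all: by end_near. Qed.

Definition rlimit_cumulative : cumulative R R :=
  HB.pack rlimit (isCumulative.Build R _ R rlimit rlimit_nd rlimit_rc).

Lemma stieltjes_itvoc (a b : R) : a <= b ->
  lebesgue_stieltjes_measure rlimit_cumulative `]a, b]%classic = (rlimit b - rlimit a)%:E.
Proof.
move=> ab; rewrite /lebesgue_stieltjes_measure /measure_extension.
rewrite measurable_mu_extE; last exact: is_ocitv.
exact: (wlength_itv_bnd rlimit_cumulative false false ab).
Qed.

End stieltjes.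

(* Helly's selection theorem with an ultrafilter in place of a subsequence: the
   limits of the distribution functions of V under k dmu, made right-continuous,
   are the Stieltjes function of the limit measure. *)
Section measure_ultralimit.
Context {R : realType} d (T : measurableType d).
Variables (I : topologicalType) (U : set_system I) (mu : I -> {measure set T -> \bar R})
  (V k : I -> T -> R) (M : R).
Hypothesis UU : UltraFilter U.
Hypothesis mV : \forall t \near U, measurable_fun setT (V t).
Hypothesis V01 : \forall t \near U, forall x, 0 <= V t x <= 1.
Hypothesis ik : \forall t \near U, (mu t).-integrable setT (EFin \o k t).
Hypothesis k0 : \forall t \near U, forall x, 0 <= k t x.
Hypothesis kM : \forall t \near U, \int[mu t]_x k t x <= M.

Let UP : ProperFilter U. Proof. exact: ultra_proper. Qed.

Let cdf (t : I) (a : R) : R := \int[mu t]_x (k t x * (V t x <= a)%R%:R).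

Let icdf t a : measurable_fun setT (V t) -> (mu t).-integrable setT (EFin \o k t) ->
  (forall x, 0 <= k t x) -> (mu t).-integrable setT (EFin \o (fun x => k t x * (V t x <= a)%R%:R)).
Proof.
move=> mVt ikt k0t; have mk : measurable_fun setT (k t) by have /integrableP[/measurable_EFinP] := ikt.
apply: (le_integrableR measurableT _ _ ikt).
  apply: measurable_funM => //.
  have -> : (fun x => (V t x <= a)%R%:R : R) = (fun x => if V t x <= a then 1 else 0).
    by apply/funext => x; case: ifP.
  by apply: measurable_fun_ifT => //; apply: measurable_fun_ler.
move=> x _; rewrite normrM (ger0_norm (k0t _)) ler_piMr ?k0t//.
by case: (V t x <= a); rewrite ?normr1 ?normr0.
Qed.

Let good t := [/\ measurable_fun setT (V t), forall x, 0 <= V t x <= 1,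
  (mu t).-integrable setT (EFin \o k t), forall x, 0 <= k t x & \int[mu t]_x k t x <= M].

Let goodU : \forall t \near U, good t.
Proof. by near=> t; split; near: t. Unshelve. all: by end_near. Qed.

Let cdf_bound t a : good t -> 0 <= cdf t a <= M.
Proof.
move=> [mVt V01t ikt k0t kMt]; apply/andP; split.
  by apply: Rintegral_ge0 => x _; rewrite mulr_ge0.
apply: le_trans kMt; apply: le_Rintegral => //; first exact: icdf.
by move=> x _; rewrite ler_piMr//; case: (V t x <= a).
Qed.

Let ex_lim a : exists l : R, cdf ^~ a @ U --> l.
Proof.
by apply: (ultra_bounded_lim UU (a := 0) (b := M)); apply: filterS goodU => t /cdf_bound.
Qed.

(** The limit distribution function vanishes below 0, so the mass of ]-1, 0] is the atom at 0, which
    a half-open interval starting at 0 would lose; [Num.max 0 v] evaluates phi at 0 on it. *)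
Lemma measure_ultralimit_exists : exists nu : {measure set (measurableTypeR R) -> \bar R},
  (nu `](-1)%R, 1%R]%classic < +oo)%E /\ forall phi : R -> R, continuous phi ->
  (\int[mu t]_x (phi (V t x) * k t x)) @[t --> U] -->
    \int[nu]_(v in `](-1), 1]%classic) phi (Num.max 0 v).
Proof.
have /choice[F FE] := ex_lim.
have lim_le (f h : I -> R) (l m : R) : f @ U --> l -> h @ U --> m ->
    (\forall t \near U, f t <= h t) -> l <= m.
  by move=> fl hm fh; exact: (ler_cvg_to fl hm).
have F0 a : 0 <= F a.
  apply: (lim_le (fun=> 0) _ _ _ _ (FE a)); first exact: cvg_cst.
  by apply: filterS goodU => t /(cdf_bound a) /andP[].
have FM a : F a <= M.
  apply: (lim_le _ (fun=> M) _ _ (FE a)); first exact: cvg_cst.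
  by apply: filterS goodU => t /(cdf_bound a) /andP[].
have Fnd : {homo F : x y / x <= y}.
  move=> a b ab; apply: (lim_le _ _ _ _ (FE a) (FE b)).
  apply: filterS goodU => t [mVt V01t ikt k0t kMt].
  apply: le_Rintegral => //; [exact: icdf|exact: icdf|].
  move=> x _; rewrite ler_wpM2l//; have [va|_] := leP (V t x) a => //.
  by rewrite (le_trans va ab).
have Fneg a : a < 0 -> F a = 0.
  move=> a0; apply: (cvg_unique _ (FE a)) => //; apply: cvg_near_cst.
  apply: filterS goodU => t [mVt V01t ikt k0t kMt].
  rewrite /cdf; under eq_Rintegral => x _.
    have /andP[v0 _] := V01t x.
    rewrite leNgt (lt_le_trans a0 v0) mulr0; over.
  by rewrite Rintegral_cst// mul0r.
have total t : good t -> cdf t 1 = \int[mu t]_x k t x.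
  move=> [mVt V01t ikt k0t kMt]; apply: eq_Rintegral => x _.
  by have /andP[_ ->] := V01t x; rewrite mulr1.
have Fpos a : 1 <= a -> F a = F 1.
  move=> a1; apply: (cvg_unique _ (FE a)) => //; apply: cvg_trans (FE 1).
  apply: near_eq_cvg; apply: filterS goodU => t [mVt V01t ikt k0t kMt].
  apply: eq_Rintegral => x _; have /andP[_ v1] := V01t x.
  by rewrite v1 (le_trans v1 a1).
pose G := rlimit F.
have GF a : F a <= G a by exact: rlimit_ge.
have GFlt a b : a < b -> G a <= F b by exact: rlimit_le.
have Gneg : G (-1) = 0.
  apply/eqP; rewrite eq_le (le_trans (F0 _) (GF _)) andbT.
  have h : (-1 : R) < - 2^-1 by rewrite ltrN2 invf_lt1//; lra.
  by apply: (le_trans (GFlt _ _ h)); rewrite Fneg// oppr_lt0 invr_gt0.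
have G1 : G 1 = F 1.
  apply/eqP; rewrite eq_le GF andbT.
  have h : (1 : R) < 2 by lra.
  by apply: (le_trans (GFlt _ _ h)); rewrite Fpos//; lra.
pose nu : {measure set (measurableTypeR R) -> \bar R} :=
  lebesgue_stieltjes_measure (rlimit_cumulative F0).
have nuE (b : R) : 0 <= b -> nu `](-1), b]%classic = (G b)%:E.
  move=> b0; have h : -1 <= b by lra.
  rewrite [LHS](stieltjes_itvoc F0 h).
  by rewrite -/G Gneg subr0.
exists nu; split; first by rewrite nuE// ltry.
move=> phi cphi.
pose D : set (measurableTypeR R) := `](-1), 1]%classic.
have mD : measurable D by exact: measurable_itv.
have i1 : nu.-integrable D (EFin \o (fun=> 1 : R)).
  apply/integrableP; split; first exact/measurable_EFinP/measurable_cst.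
  under eq_integral do rewrite /= normr1.
  rewrite (_ : \int[nu]_(x in D) 1%:E = \int[nu]_(x in D) (cst 1%:E) x)%E//.
  by rewrite integral_cst// mul1e [X in (X < _)%E](nuE _ ler01) ltry.
have nuD : \int[nu]_(x in D) (1 : R) = F 1.
  by rewrite Rintegral_cst// mul1r -G1; exact: (congr1 fine (nuE _ ler01)).
have mmax : measurable_fun D (fun v : R => Num.max 0 v).
  by apply: measurable_maxr => //; exact: measurable_id.
have max01 v : D v -> 0 <= Num.max 0 v <= 1.
  by rewrite /D/= in_itv/= => /andP[_ v1]; rewrite le_max lexx/= ge_max ler01 v1.
have nuG (a : R) : 0 <= a <= 1 -> \int[nu]_(v in D) (1 * (Num.max 0 v <= a)%R%:R) = G a.
  move=> /andP[a0 a1].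
  have -> : G a = fine (nu `](-1), a]%classic) by rewrite nuE.
  pose A : set (measurableTypeR R) := `](-1), a]%classic.
  have mA : measurable A by exact: measurable_itv.
  have sub : A `<=` D.
    by move=> v; rewrite /A /D/= !in_itv/= => /andP[-> h]; exact: le_trans h a1.
  rewrite -/A -[in RHS](setIidl sub) -(integral_indic _ mD mA).
  apply: eq_Rintegral => v /set_mem; rewrite /D/= in_itv/= => /andP[v1 _].
  rewrite mul1r indicE mem_setE in_itv/= v1/= ge_max a0//.
apply/cvgrPdist_le => e e0.
have M0 : 0 <= M by exact: le_trans (F0 1) (FM 1).
pose e' := e / (4 * (M + 1)).
have e'0 : 0 < e' by rewrite /e' divr_gt0// mulr_gt0//; lra.
have e'M : e' * M <= e / 4.
  have M1 : 0 < M + 1 by lra.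
  have -> : e' * M = (e / 4) * (M / (M + 1)) by rewrite /e'; field; rewrite gt_eqF.
  by rewrite ler_piMr ?divr_ge0 ?ltW// ltr_pdivrMr// mul1r ltrDl.
have [N HN] := unif_continuous01 cphi e'0.
pose dphi (i : nat) := phi (grid N i.+1) - phi (grid N i).
pose S (H : R -> R) := phi 1 * H 1 - \sum_(i < N.+1) dphi i * H (grid N i).
have g01 (i : 'I_N.+1) : (0 : R) <= (grid N i : R) <= 1.
  by rewrite grid_ge0/= -(gridN N); apply: grid_le; exact: ltnW.
have g01S (i : 'I_N.+1) : (0 : R) <= (grid N i.+1 : R) <= 1.
  by rewrite grid_ge0/= -(gridN N); apply: grid_le.
have cS : S (cdf t) @[t --> U] --> S F.
  apply: cvgB; first by apply: cvgM; [exact: cvg_cst|exact: FE].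
  have csum (n : nat) : \sum_(i < n) dphi i * cdf t (grid N i) @[t --> U] -->
      \sum_(i < n) dphi i * F (grid N i).
    elim: n => [|n ih]; first by under eq_fun do rewrite big_ord0; rewrite big_ord0; exact: cvg_cst.
    rewrite big_ord_recr/=; under eq_fun do rewrite big_ord_recr/=.
    by apply: cvgD => //; apply: cvgM; [exact: cvg_cst|exact: FE].
  exact: csum.
have near1 t : good t -> `|\int[mu t]_x (phi (V t x) * k t x) - S (cdf t)| <= e / 4.
  move=> gt; have [mVt V01t ikt k0t kMt] := gt.
  have := abel_step_integral measurableT mVt (fun x _ => V01t x) ikt (fun x _ => k0t x) cphi HN (ltW e'0).
  rewrite -total// => h; apply: (le_trans h); rewrite total//.
  by apply: le_trans e'M; rewrite ler_wpM2l// ltW.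
(* [F] and its right-continuous version [G] may differ at grid points, but G(grid i) <= F(grid
   (i+1)), so the differences are dominated by a telescoping sum. *)
have SFG : `|S F - S G| <= e / 4.
  have -> : S F - S G = \sum_(i < N.+1) dphi i * (G (grid N i) - F (grid N i)).
    rewrite /S G1; under [RHS]eq_bigr do rewrite mulrBr.
    rewrite sumrB; ring.
  apply: (le_trans (ler_norm_sum _ _ _)).
  apply: (@le_trans _ _ (\sum_(i < N.+1) e' * (F (grid N i.+1) - F (grid N i)))).
    apply: ler_sum => i _; rewrite normrM (@ger0_norm _ (G _ - F _)) ?subr_ge0//.
    apply: ler_pM => //; first by rewrite subr_ge0.
      apply: HN => //; rewrite gridS addrC addKr ger0_norm// invr_ge0//.
    rewrite lerD2r; apply: GFlt; rewrite gridS ltrDl invr_gt0//.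
  rewrite -mulr_sumr; apply: le_trans e'M; apply: ler_wpM2l; first exact: ltW.
  rewrite -(big_mkord xpredT (fun i => F (grid N i.+1) - F (grid N i))).
  rewrite telescope_sumr// lerBlDr (le_trans (FM _))// lerDl//.
have nearG : `|\int[nu]_(v in D) phi (Num.max 0 v) - S G| <= e / 4.
  have := abel_step_integral mD mmax max01 i1 (fun x _ => ler01) cphi HN (ltW e'0).
  rewrite nuD.
  under eq_bigr => i _ do rewrite nuG//.
  under eq_Rintegral do rewrite mulr1.
  rewrite -G1 => h; apply: (le_trans h); rewrite G1.
  by apply: le_trans e'M; rewrite ler_wpM2l// ltW.
have e40 : 0 < e / 4 by lra.
move/cvgrPdist_le : cS => /(_ _ e40) cS.
near=> t.
have gt : good t by near: t.
have h1 := near1 _ gt.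
have h2 : `|S F - S (cdf t)| <= e / 4 by near: t.
rewrite -/D; set A := \int[nu]_(v in D) _ in nearG *.
set B := \int[mu t]_x _ in h1 *.
have -> : A - B = (A - S G) - (S F - S G) + (S F - S (cdf t)) - (B - S (cdf t)) by ring.
apply: (le_trans (ler_normB _ _)); apply: (@le_trans _ _ (e / 4 + e / 4 + e / 4 + e / 4)); last by lra.
apply: lerD => //; apply: (le_trans (ler_normD _ _)); apply: lerD => //.
by apply: (le_trans (ler_normB _ _)); apply: lerD.
Unshelve. all: by end_near. Qed.

End measure_ultralimit.

(** * The Levy-Khintchine representation *)

Section density.
Local Open Scope ereal_scope.
Context d (T : measurableType d) (R : realType) (mu : {measure set T -> \bar R}).
Variable k : T -> R.
Hypotheses (mk : measurable_fun setT k) (k0 : forall x, (0 <= k x)%R).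

Definition density (A : set T) : \bar R := \int[mu]_(x in A) (k x)%:E.

Let density0 : density set0 = 0.
Proof. by rewrite /density integral_set0. Qed.

Let density_ge0 A : 0 <= density A.
Proof. by apply: integral_ge0 => x _; rewrite lee_fin; exact: k0. Qed.

Let density_sigma_additive : semi_sigma_additive density.
Proof.
apply: semi_sigma_additive_nng_induced => [|x]; last by rewrite lee_fin.
exact/measurable_EFinP.
Qed.

Definition density_measure : {measure set T -> \bar R} :=
  HB.pack density (isMeasure.Build _ _ _ density density0 density_ge0 density_sigma_additive).

Import HBNNSimple.

Lemma integral_density (f : T -> \bar R) : measurable_fun setT f ->
  (forall x, 0 <= f x) -> \int[density_measure]_x f x = \int[mu]_x ((k x)%:E * f x).
Proof.
move=> mf f0; pose f_ := nnsfun_approx measurableT mf.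
have step (n : nat) : \int[density_measure]_x (f_ n x)%:E = \int[mu]_x ((k x)%:E * (f_ n x)%:E).
  under eq_integral do rewrite fimfunE -fsumEFin//.
  under [RHS]eq_integral do rewrite fimfunE -fsumEFin//.
  rewrite ge0_integral_fsum//; last 2 first.
  - by move=> y; exact/measurable_EFinP/measurable_funM.
  - by move=> y x _; rewrite nnfun_muleindic_ge0.
  transitivity (\int[mu]_x \sum_(r \in range (f_ n)) ((k x)%:E * (r * \1_(f_ n @^-1` [set r]) x)%:E)).
    rewrite ge0_integral_fsum//; last 2 first.
    - move=> y; apply: emeasurable_funM; first exact/measurable_EFinP.
      exact/measurable_EFinP/measurable_funM.
    - by move=> y x _; apply: mule_ge0; [rewrite lee_fin|rewrite EFinM nnfun_muleindic_ge0].
    apply: eq_fsbigr => r /set_mem[x0 _ rE].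
    have r0 : (0 <= r)%R by rewrite -rE.
    have mr : measurable (f_ n @^-1` [set r]) by [].
    under eq_integral do rewrite EFinM.
    rewrite ge0_integralZl_EFin//; last exact/measurable_EFinP.
    rewrite integral_indic// setIT.
    transitivity (r%:E * \int[mu]_x ((k x)%:E * (\1_(f_ n @^-1` [set r]) x)%:E)).
      congr (_ * _); rewrite /= /density integral_mkcond.
      by apply: eq_integral => x _; rewrite epatch_indic.
    rewrite -ge0_integralZl_EFin//.
    - by apply: eq_integral => x _; rewrite EFinM muleCA.
    - by move=> x _; rewrite mule_ge0// lee_fin.
    - by apply: emeasurable_funM; exact/measurable_EFinP.
  apply: eq_integral => x _; rewrite ge0_mule_fsumr//.
  by move=> r; rewrite nnfun_muleindic_ge0.
transitivity (limn (fun n => \int[density_measure]_x (f_ n x)%:E)).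
  rewrite -monotone_convergence//.
  - by apply: eq_integral => y _; apply/esym/cvg_lim => //; exact: cvg_nnsfun_approx.
  - by move=> n; exact/measurable_EFinP/measurable_funP.
  - by move=> n y _; rewrite lee_fin.
  - by move=> y _ m n mn; rewrite lee_fin; exact/lefP/nd_nnsfun_approx.
under eq_fun do rewrite step.
rewrite -monotone_convergence//.
- apply: eq_integral => y _; apply/cvg_lim => //.
  by apply: cvgeZl => //; exact: cvg_nnsfun_approx.
- by move=> n; apply: emeasurable_funM; [exact/measurable_EFinP|]; exact/measurable_EFinP/measurable_funP.
- by move=> n y _; rewrite mule_ge0// lee_fin.
- by move=> y _ m n mn; apply: lee_wpmul2l; rewrite lee_fin//; exact/lefP/nd_nnsfun_approx.
Qed.

End density.

(** * The normalized Levy-Khintchine integrand *)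

Section lkphi.
Context {R : realType}.
Implicit Types (v c : R).

Lemma is_derive_expR_ln c v : 0 < v ->
  is_derive v 1 (fun x => expR (c * ln x)) (c * expR (c * ln v) / v).
Proof.
move=> v0.
have dln := is_derive1_ln v0.
have h1 : is_derive v 1 (fun x => c * ln x) (c * v^-1).
  exact: (is_deriveZ c dln).
have h2 := @is_derive1_comp R expR (fun x => c * ln x) v _ _ (is_derive_expR _) h1.
by apply: (is_derive_eq h2); ring.
Qed.

Lemma continuous_expR_ln c v : 0 < v -> {for v, continuous (fun x => expR (c * ln x))}.
Proof.
move=> v0; apply: differentiable_continuous; apply/derivable1_diffP.
by have [] := is_derive_expR_ln c v0.
Qed.

Lemma kpow1 v : 0 <= v -> kpow v 1 = v.
Proof.
rewrite /kpow mul1r le_eqVlt => /predU1P[<-|v0]; first by rewrite ltxx.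
by rewrite v0 lnK// posrE.
Qed.

Lemma kpowM v (a k : R) : kpow (kpow v a) k = kpow v (k * a).
Proof.
rewrite /kpow; case: (ltP 0 v) => v0; last by rewrite ltxx.
by rewrite expR_gt0 expRK mulrA.
Qed.

Lemma kpow_continuousl (k : R) : 0 < k -> continuous (fun v => kpow v k).
Proof.
move=> k0 v; have [v0|v0|<-] := ltgtP 0 v.
- have := @continuous_expR_ln k v v0; rewrite /continuous_at /kpow v0 => h.
  apply: cvg_trans h; apply: near_eq_cvg; near=> x.
  have -> // : 0 < x by near: x; exact: lt_nbhsr.
- rewrite /continuous_at; have -> : kpow v k = 0 by rewrite /kpow ltNge (ltW v0).
  apply: cvg_near_cst; near=> x.
  by rewrite /kpow ltNge ltW//; near: x; exact: lt_nbhsl.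
rewrite /continuous_at; have -> : kpow 0 k = 0 by rewrite /kpow ltxx.
apply/cvgrPdist_le => e e0; near=> x.
rewrite sub0r normrN ger0_norm ?kpow_ge0// /kpow; case: ifPn => [x0|_]; last exact: ltW.
rewrite -(@lnK _ e)// ler_expR mulrC -ler_pdivlMr// -ler_expR lnK ?posrE//.
by apply: ltW; near: x; apply: lt_nbhsl; exact: expR_gt0.
Unshelve. all: by end_near. Qed.

(* With v = exp (-a h) this is the Levy-Khintchine integrand at k a, compensated
   by the one at a and divided by (1 - v)^2; the value at v = 1 is the limit. *)
Definition lkphi k v : R :=
  if v < 1 then ((1 - kpow v k) - k * (1 - v)) / (1 - v) ^+ 2 else k * (1 - k) / 2.

Let ln_at_left1 c : expR (c * ln x) @[x --> (1 : R)^'-] --> (1 : R).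
Proof.
have h : expR (c * ln x) @[x --> (1 : R)] --> expR (c * ln (1 : R)).
  exact: (@continuous_expR_ln c 1 ltr01).
rewrite ln1 mulr0 expR0 in h.
exact: cvg_at_left_filter.
Qed.

Let oneB_at_left1 : 1 - x @[x --> (1 : R)^'-] --> (0 : R).
Proof.
rewrite -[X in _ --> X](subrr (1 : R)); apply: cvgB; first exact: cvg_cst.
by apply: cvg_at_left_filter; exact: cvg_id.
Qed.

Let is_derive_oneB v : is_derive v 1 (fun x : R => 1 - x) (-1).
Proof. by apply: is_derive_eq; ring. Qed.

Let lim1 c : (1 - expR (c * ln x)) / (1 - x) @[x --> (1 : R)^'-] --> c.
Proof.
apply: (@lhopital_at_left R (fun x => 1 - expR (c * ln x)) (fun x => - (c * expR (c * ln x) / x))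
  (fun x => 1 - x) (fun=> -1) 0 1 c) => //.
- move=> x; rewrite in_itv/= => /andP[x0 _].
  by have h := is_derive_expR_ln c x0; apply: is_derive_eq; rewrite /GRing.scale/=; ring.
- by rewrite -[X in _ --> X](subrr (1 : R)); apply: cvgB; [exact: cvg_cst|exact: ln_at_left1].
have -> : (fun x : R => - (c * expR (c * ln x) / x) / -1) = (fun x => c * expR (c * ln x) * x^-1).
  by apply/funext => x; rewrite invrN invr1 mulrN1 opprK.
suff : c * expR (c * ln x) * x^-1 @[x --> (1 : R)^'-] --> c * 1 * 1^-1 by rewrite invr1 !mulr1.
apply: cvgM; first by apply: cvgM; [exact: cvg_cst|exact: ln_at_left1].
apply: cvgV; first by rewrite oner_eq0.
by apply: cvg_at_left_filter; exact: cvg_id.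
Qed.

(** After one use of l'Hopital the quotient is - k/2 times the one of [lim1] for the exponent k -
    1. *)
Let lim2 k : (1 - expR (k * ln x) - k * (1 - x)) / (1 - x) ^+ 2 @[x --> (1 : R)^'-] --> k * (1 - k) / 2.
Proof.
apply: (@lhopital_at_left R (fun x => 1 - expR (k * ln x) - k * (1 - x))
  (fun x => k - k * expR (k * ln x) / x)
  (fun x => (1 - x) ^+ 2) (fun x => - (2 * (1 - x))) 0 1 _) => //.
- move=> x; rewrite in_itv/= => /andP[x0 _].
  have h := is_derive_expR_ln k x0; have h2 := is_derive_oneB x.
  by apply: is_derive_eq; rewrite /GRing.scale/=; ring.
- move=> x _; have h2 := is_derive_oneB x.
  by apply: is_derive_eq; rewrite /GRing.scale/=; ring.
- have -> : (0 : R) = (1 - 1) - k * 0 by ring.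
  apply: cvgB; last by apply: cvgM; [exact: cvg_cst|exact: oneB_at_left1].
  by apply: cvgB; [exact: cvg_cst|exact: ln_at_left1].
- have -> : (fun x : R => (1 - x) ^+ 2) = fun x => (1 - x) * (1 - x) by apply/funext => x; rewrite expr2.
  by rewrite -[X in _ --> X](mul0r (0 : R)); apply: cvgM; exact: oneB_at_left1.
- move=> x; rewrite in_itv/= => /andP[_ x1].
  by rewrite oppr_eq0 mulf_neq0// gt_eqF// subr_gt0.
have -> : k * (1 - k) / 2 = - (k / 2) * (k - 1) by ring.
apply: cvg_trans (cvgM (@cvg_cst _ (- (k / 2)) _ _ _) (@lim1 (k - 1))).
apply: near_eq_cvg; near=> x.
have x0 : 0 < x by near: x; apply: nbhs_left_gt.
have x1 : x < 1 by near: x; apply: nbhs_left_lt.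
have E1 : (k - 1) * ln x = k * ln x - ln x by ring.
rewrite /= E1 expRD expRN lnK ?posrE//.
move: (expR _) => E; field.
by rewrite !gt_eqF ?subr_gt0.
Unshelve. all: by end_near. Qed.

Lemma lkphi_continuous k : 0 < k -> continuous (lkphi k).
Proof.
move=> k0 v; have [v1|v1|->] := ltgtP v 1.
- have h : {for v, continuous (fun x => ((1 - kpow x k) - k * (1 - x)) / (1 - x) ^+ 2)}.
    have c1 : {for v, continuous (fun x : R => 1 - x)}.
      by apply: continuousB; [exact: cst_continuous|exact: cvg_id].
    apply: continuousM; last first.
      apply: continuousV; first by rewrite expf_neq0// gt_eqF// subr_gt0.
      exact: (@continuousM _ _ _ _ _ c1 c1).
    apply: continuousB; last by apply: continuousM => //; exact: cst_continuous.
    by apply: continuousB; [exact: cst_continuous|exact: kpow_continuousl].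
  rewrite /continuous_at /lkphi v1; apply: cvg_trans h; apply: near_eq_cvg; near=> x.
  have -> // : x < 1 by near: x; exact: lt_nbhsl.
- rewrite /continuous_at /lkphi ltNge (ltW v1)/=; apply: cvg_near_cst; near=> x.
  by rewrite ltNge ltW//; near: x; exact: lt_nbhsr.
apply/left_right_continuousP; split.
  rewrite /lkphi ltxx; apply: cvg_trans (@lim2 k); apply: near_eq_cvg; near=> x.
  have -> : x < 1 by near: x; exact: nbhs_left_lt.
  by rewrite /kpow; have -> // : 0 < x by near: x; exact: nbhs_left_gt.
rewrite /lkphi ltxx; apply: cvg_near_cst; near=> x.
by rewrite ltNge ltW//; near: x; exact: nbhs_right_gt.
Unshelve. all: by end_near. Qed.

Lemma lkphiM k v : 0 <= v <= 1 -> lkphi k v * (1 - v) ^+ 2 = (1 - kpow v k) - k * (1 - kpow v 1).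
Proof.
move=> /andP[v0]; rewrite le_eqVlt => /predU1P[->|v1].
  by rewrite /lkphi ltxx /kpow ltr01 ln1 !mulr0 expR0; ring.
by rewrite /lkphi v1 kpow1// divfK// expf_neq0// gt_eqF// subr_gt0.
Qed.

End lkphi.

Section ultralimit_phi.
Context {R : realType} d (T : measurableType d).
Variables (P : R -> probability T R) (V : R -> T -> R) (u : R -> R -> R) (a b1 b2 : R).
Variable U : set_system R.
Hypothesis UU : UltraFilter U.
Hypothesis U0 : (0 : R)^'+ `<=` U.
Hypothesis a_gt0 : 0 < a.
Hypothesis mV : forall t, 0 < t -> measurable_fun setT (V t).
Hypothesis V01 : forall t, 0 < t -> forall w, 0 <= V t w <= 1.
Hypothesis VE : forall t k : R, 0 < t -> 0 < k ->
  \int[P t]_w kpow (V t w) k = expR (- (t ^+ 2 * u t (k * a))).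
Hypothesis u0 : forall z, 0 < z -> u t z @[t --> 0^'+] --> z.
Hypothesis dua : (u t a - a) / t @[t --> 0^'+] --> b1.
Hypothesis du2a : (u t (2 * a) - 2 * a) / t @[t --> 0^'+] --> b2.

(* Starting from x = t^2 makes (1 - exp (-x u)) / x = u + O(t^2), so that
   (1/x) law(V) may be divided by t once more. *)
Let k t w : R := (1 - V t w) ^+ 2 / t ^+ 3.

Let A (c t : R) : R :=
  ((1 - expR (- (t ^+ 2 * u t (c * a)))) - c * (1 - expR (- (t ^+ 2 * u t (1 * a))))) / t ^+ 3.

Let ikpow t c : 0 < t -> 0 <= c -> (P t).-integrable setT (EFin \o (fun w => kpow (V t w) c)).
Proof. by move=> t0 c0; exact: (integrable_kpow P t (mV t0) (V01 t0) c0). Qed.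

Let AE c t : 0 < c -> 0 < t -> \int[P t]_w (lkphi c (V t w) * k t w) = A c t.
Proof.
move=> c0 t0.
have i1 := ikpow t0 (@ler01 R); have ic := ikpow t0 (ltW c0).
transitivity (\int[P t]_w ((t ^+ 3)^-1 * ((1 - c) + (c * kpow (V t w) 1 - kpow (V t w) c)))).
  apply: eq_Rintegral => w _; rewrite /k mulrA lkphiM ?V01//.
  by move: (kpow _ _) (kpow _ _) (t ^+ 3)^-1 => x y z; ring.
have i2 : (P t).-integrable setT (EFin \o (fun w => c * kpow (V t w) 1)) by exact: integrableR_Zl.
have i3 : (P t).-integrable setT (EFin \o (fun w => c * kpow (V t w) 1 - kpow (V t w) c)).
  exact: integrableR_B.
have i4 : (P t).-integrable setT (EFin \o (fun w => 1 - c)).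
  exact: finite_measure_integrable_cst.
rewrite RintegralZl//; last exact: integrableR_D.
rewrite RintegralD// Rintegral_prob_cst RintegralB// RintegralZl// !VE// /A.
by move: (expR _) (expR _) (t ^+ 3)^-1 => x y z; ring.
Qed.

Let ik t : 0 < t -> (P t).-integrable setT (EFin \o k t).
Proof.
move=> t0; have t3 : 0 <= (t ^+ 3)^-1 by rewrite invr_ge0 exprn_ge0// (ltW t0).
have ic : (P t).-integrable setT (EFin \o (fun=> (t ^+ 3)^-1)) by exact: finite_measure_integrable_cst.
apply: (le_integrableR measurableT _ _ ic).
  apply: measurable_funM => //; apply: measurable_funX; apply: measurable_funB => //; exact: mV.
move=> w _; have /andP[v0 v1] := V01 t0 w.
rewrite /k normrM [X in _ * X]ger0_norm//.
rewrite -[leRHS]mul1r ler_wpM2r//.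
by rewrite ger0_norm ?sqr_ge0// expr_le1 ?subr_ge0// lerBlDr lerDl.
Qed.

(** For c = 2 the compensated numerator is (1 - v^2) - 2 (1 - v) = - (1 - v)^2, so the total mass
    depends only on u at a and 2a, where [dua] and [du2a] control it. *)
Let kE t : 0 < t -> \int[P t]_w k t w = - A 2 t.
Proof.
move=> t0; rewrite -AE//.
have kk w : lkphi 2 (V t w) * k t w = - 1 * k t w.
  rewrite /k [LHS]mulrA lkphiM ?V01// kpow1; last by have /andP[] := V01 t0 w.
  have -> : kpow (V t w) 2 = V t w ^+ 2.
    have -> : (2 : R) = 1.+1%:R * 1 by rewrite mulr1.
    by rewrite kpow_natM kpow1//; have /andP[] := V01 t0 w.
  by move: (V t w) (t ^+ 3)^-1 => x y; ring.
under [X in _ = - X]eq_Rintegral do rewrite kk.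
by rewrite RintegralZl ?ik// mulN1r opprK.
Qed.

(** The remainder exp(-x) - 1 + x is at most x^2; at x = t^2 u and after division by t^3 it is of
    order t u^2. *)
Let AB c : 0 < c -> A c t - (u t (c * a) - c * u t a) / t @[t --> 0^'+] --> (0 : R).
Proof.
move=> c0.
pose r (x : R) : R := expR (- x) - 1 + x.
have rb (x : R) : 0 <= x -> `|r x| <= x ^+ 2.
  move=> x0; have h1 := expR_sub1D_ge0 (- x); have h2 := expR_sub1D_le (- x).
  have h3 := expR_ge1Dx (- x).
  have rE : r x = expR (- x) - 1 - - x by rewrite /r opprK.
  rewrite ger0_norm rE//; apply: (le_trans h2); rewrite mulNr -mulrN opprB expr2 ler_wpM2l//.
  by lra.
have bound t : 0 < t -> 0 <= u t (c * a) -> 0 <= u t a ->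
    `|A c t - (u t (c * a) - c * u t a) / t| <= t * (u t (c * a) ^+ 2 + c * u t a ^+ 2).
  move=> t0 ua0 ub0; set x := u t (c * a) in ua0 *; set y := u t a in ub0 *.
  have t20 : 0 <= t ^+ 2 by exact: sqr_ge0.
  have E : A c t - (x - c * y) / t = (- r (t ^+ 2 * x) + c * r (t ^+ 2 * y)) / t ^+ 3.
    rewrite /A /r mul1r -/x -/y; move: (expR _) (expR _) => e1 e2.
    by field; rewrite gt_eqF.
  rewrite E normrM [X in _ * X]ger0_norm ?invr_ge0 ?exprn_ge0 ?(ltW t0)//.
  rewrite ler_pdivrMr ?exprn_gt0//; apply: (le_trans (ler_normD _ _)).
  rewrite normrN normrM (gtr0_norm c0).
  have h1 := rb _ (mulr_ge0 t20 ua0).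
  have h2 : c * `|r (t ^+ 2 * y)| <= c * (t ^+ 2 * y) ^+ 2.
    by apply: ler_wpM2l; [exact: ltW|apply: rb; rewrite mulr_ge0].
  by apply: (le_trans (lerD h1 h2)); rewrite le_eqVlt; apply/orP; left; apply/eqP; ring.
apply/cvgr0Pnorm_le => e e0.
have lim0 : t * (u t (c * a) ^+ 2 + c * u t a ^+ 2) @[t --> 0^'+] --> (0 : R).
  rewrite -[X in _ --> X](mul0r ((c * a) * (c * a) + c * (a * a))).
  apply: cvgM; first by apply: cvg_at_right_filter; exact: cvg_id.
  apply: cvgD; last first.
    apply: cvgM; first exact: cvg_cst.
    by under eq_fun do rewrite expr2; apply: cvgM; exact: u0.
  by under eq_fun do rewrite expr2; apply: cvgM; apply: u0; rewrite mulr_gt0.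
move/cvgr0Pnorm_le : lim0 => /(_ e e0) lim0.
have p1 : \forall t \near (0 : R)^'+, 0 <= u t (c * a).
  have ca0 : 0 < c * a by rewrite mulr_gt0.
  by near=> t; apply: ltW; near: t; exact: (cvgr_gt _ (u0 ca0)).
have p2 : \forall t \near (0 : R)^'+, 0 <= u t a.
  by near=> t; apply: ltW; near: t; exact: (cvgr_gt _ (u0 a_gt0)).
near=> t.
have t0 : 0 < t by near: t; exact: nbhs_right_gt.
apply: (le_trans (bound _ t0 _ _)); [by near: t|by near: t|].
by apply: (le_trans (ler_norm _)); near: t.
Unshelve. all: by end_near. Qed.

Lemma ultralimit_lkphi : exists nu : {measure set (measurableTypeR R) -> \bar R},
  (nu `](-1)%R, 1%R]%classic < +oo)%E /\ forall c, 0 < c ->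
  (u t (c * a) - c * u t a) / t @[t --> U] -->
    \int[nu]_(v in `](-1), 1]%classic) lkphi c (Num.max 0 v).
Proof.
have UP : ProperFilter U by exact: ultra_proper.
have Upos : \forall t \near U, 0 < t by apply: U0; exact: nbhs_right_gt.
have A2 : A 2 t @[t --> 0^'+] --> 0 + (b2 - 2 * b1).
  have h : (u t (2 * a) - 2 * u t a) / t @[t --> 0^'+] --> b2 - 2 * b1.
    have -> : (fun t => (u t (2 * a) - 2 * u t a) / t) =
        (fun t => (u t (2 * a) - 2 * a) / t - 2 * ((u t a - a) / t)).
      by apply/funext => t; move: (t^-1) => y; ring.
    by apply: cvgB => //; apply: cvgM => //; exact: cvg_cst.
  have -> : A 2 = fun t => (A 2 t - (u t (2 * a) - 2 * u t a) / t) + (u t (2 * a) - 2 * u t a) / t.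
    by apply/funext => t; rewrite subrK.
  by apply: cvgD; [exact: AB|exact: h].
have hM : \forall t \near (0 : R)^'+, \int[P t]_x k t x <= `|0 + (b2 - 2 * b1)| + 1.
  move/cvgrPdist_le : (A2) => /(_ 1 ltr01) A2'.
  near=> t; rewrite kE; last by near: t; exact: nbhs_right_gt.
  apply: (le_trans (ler_norm _)); rewrite normrN.
  have h : `|0 + (b2 - 2 * b1) - A 2 t| <= 1 by near: t.
  rewrite -[A 2 t](subKr (0 + (b2 - 2 * b1))).
  by apply: (le_trans (ler_normB _ _)); rewrite lerD2l.
have [nu [nufin nuE]] := @measure_ultralimit_exists R _ T R U P V k (`|0 + (b2 - 2 * b1)| + 1) UU
  (filterS (fun t => @mV t) Upos) (filterS (fun t => @V01 t) Upos) (filterS (fun t => @ik t) Upos)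
  (filterS (fun t (t0 : 0 < t) w => divr_ge0 (sqr_ge0 _) (exprn_ge0 _ (ltW t0))) Upos)
  (U0 hM).
exists nu; split => // c c0.
have h1 := nuE _ (lkphi_continuous c0).
have h2 : A c t - (u t (c * a) - c * u t a) / t @[t --> U] --> (0 : R).
  by move=> B /(AB c0); exact: U0.
rewrite -[X in _ --> X]subr0; apply: cvg_trans (cvgB h1 h2).
apply: near_eq_cvg; near=> t.
transitivity (\int[P t]_x (lkphi c (V t x) * k t x) - (A c t - (u t (c * a) - c * u t a) / t)) => //.
by rewrite AE ?subKr//; near: t.
Unshelve. all: by end_near. Qed.

End ultralimit_phi.

Section weighted_image.
Local Open Scope ereal_scope.
Context d1 d2 (T1 : measurableType d1) (T2 : measurableType d2) (R : realType).
Variables (mu : {measure set T1 -> \bar R}) (k : T1 -> R) (h : T1 -> T2).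
Hypotheses (mk : measurable_fun setT k) (k0 : forall x, (0 <= k x)%R).
Hypothesis mh : measurable_fun setT h.

Lemma weighted_image : exists m : {measure set T2 -> \bar R},
  forall f : T2 -> R, measurable_fun setT f ->
  \int[m]_y (f y)%:E = \int[mu]_x (k x * f (h x))%:E.
Proof.
pose h' : {mfun T1 >-> T2} := HB.pack h (isMeasurableFun.Build _ _ _ _ _ mh).
exists (pushforward (density_measure mu mk k0) h') => f mf.
have step (q : T2 -> \bar R) : measurable_fun setT q -> (forall y, 0 <= q y) ->
    \int[pushforward (density_measure mu mk k0) h']_y q y = \int[mu]_x ((k x)%:E * q (h x)).
  move=> mq q0; rewrite (@ge0_integral_pushforward _ _ _ _ _ h' mh)// preimage_setT integral_density//.
  - exact: measurableT_comp.
  - by move=> x; exact: q0.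
have mE : measurable_fun setT (EFin \o f) by exact/measurable_EFinP.
rewrite [LHS]integralE [RHS]integralE !step//.
- congr (_ - _); apply: eq_integral => x _.
    by rewrite !funeposE/= -!EFin_max -EFinM maxr_pMr// mulr0.
  by rewrite !funenegE/= -!EFin_max -EFinM maxr_pMr// mulr0 mulrN.
- exact: measurable_funeneg.
- exact: measurable_funepos.
Unshelve. all: exact: mh. Qed.

End weighted_image.

(** * Regularity and growth of Laplace exponents *)

Section levy.
Context {R : realType}.
Variables (m : {measure set R -> \bar R}).
Hypothesis mL : levy_measure m.

Let D : set R := `]0%R, +oo[%classic.
Let mD : measurable D. Proof. exact: measurable_itv. Qed.

Definition lkint (z h : R) : R := expR (- (z * h)) + z * h * (\1_`]0%R, 1%R] h : R) - 1.

Lemma measurable_lkint z : measurable_fun setT (lkint z).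
Proof.
have mz : measurable_fun setT (fun h : R => z * h) by exact: measurable_funM.
apply: measurable_funB => //; apply: measurable_funD.
  by apply: measurableT_comp => //; exact: measurableT_comp.
by apply: measurable_funM => //; exact: measurable_indic.
Qed.

Lemma lkint_bound (Z z h : R) : 0 <= z -> z <= Z -> 0 < h ->
  `|lkint z h| <= (Z ^+ 2 + 1) * Num.min 1 (h ^+ 2).
Proof.
move=> z0 zZ h0; have zh0 : 0 <= z * h by rewrite mulr_ge0// ltW.
have e0 := expR_gt0 (- (z * h)).
have e1 : expR (- (z * h)) <= 1 by rewrite expR_le1 oppr_le0.
have Z20 : 0 <= Z ^+ 2 by exact: sqr_ge0.
rewrite /lkint; have [h1|h1] := leP h 1.
  have -> : \1_`]0%R, 1%R] h = 1 :> R by rewrite indicE mem_setE in_itv/= h0 h1.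
  have h21 : h ^+ 2 <= 1 by rewrite expr_le1// ltW.
  rewrite min_r//.
  have b1 := expR_sub1D_ge0 (- (z * h)); have b2 := expR_sub1D_le (- (z * h)).
  have b3 := expR_ge1Dx (- (z * h)).
  have -> : expR (- (z * h)) + z * h * 1 - 1 = expR (- (z * h)) - 1 - - (z * h) by ring.
  rewrite ger0_norm//; apply: (le_trans b2); rewrite mulNr -mulrN opprB.
  apply: (@le_trans _ _ ((z * h) * (z * h))); first by rewrite ler_wpM2l//; lra.
  rewrite -expr2 exprMn ler_wpM2r ?sqr_ge0//.
  have : z ^+ 2 <= Z ^+ 2 by rewrite lerXn2r ?nnegrE// (le_trans z0).
  by move: (z ^+ 2) (Z ^+ 2) => x y; lra.
have -> : \1_`]0%R, 1%R] h = 0 :> R.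
  by rewrite indicE memNset//= in_itv/= leNgt h1 andbF.
have h21 : 1 <= h ^+ 2 by rewrite expr_ge1// ltW.
rewrite min_l// mulr1 mulr0 addr0 ler_norml.
by move: (Z ^+ 2) Z20 => x x0; apply/andP; split; lra.
Qed.

Lemma integrable_min1 : m.-integrable D (EFin \o (fun h : R => Num.min 1 (h ^+ 2))).
Proof.
apply/integrableP; split.
  apply/measurable_EFinP; apply: measurable_minr => //; exact: measurable_funX.
under eq_integral => h _.
  rewrite /= ger0_norm; last by rewrite le_min ler01 sqr_ge0.
  over.
exact: mL.
Qed.

Lemma integrable_lkint z : 0 <= z -> m.-integrable D (EFin \o lkint z).
Proof.
move=> z0; apply: (le_integrableR mD _ _ (integrableR_Zl mD (z ^+ 2 + 1) integrable_min1)).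
  by apply: measurable_funTS; exact: measurable_lkint.
by move=> h; rewrite /D/= in_itv/= andbT => h0; exact: lkint_bound.
Qed.

Variables (gamma sigma : R).
Local Notation psi := (laplace_exponent_formula gamma sigma m).

Lemma lefE z : psi z = - gamma * z + sigma ^+ 2 / 2 * z ^+ 2 + \int[m]_(h in D) lkint z h.
Proof. by []. Qed.

Lemma lef0 : psi 0 = 0.
Proof.
rewrite lefE mulr0 expr0n/= mulr0 !add0r.
rewrite -[RHS](mul0r (fine (m D))) -Rintegral_cst//; apply: eq_Rintegral => h _.
by rewrite /lkint !mul0r oppr0 expR0 addr0 subrr.
Qed.

(** Clipping the argument to [0, Z] gives a function continuous on the whole line, from which
    continuity at z > 0, right-continuity at 0 and bounds on [0, Z] can all be read off.
    [lkint_bound] provides a dominating function uniform on [0, Z]. *)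
Lemma lef_clip_continuous (Z : R) : 0 <= Z -> continuous (fun x : R => psi (Num.min Z (Num.max 0 x))).
Proof.
move=> Z0 x0.
pose cl (x : R) := Num.min Z (Num.max 0 x).
have cl0 x : 0 <= cl x by rewrite /cl le_min Z0 le_max lexx.
have clZ x : cl x <= Z by rewrite /cl ge_min lexx.
have ccl : continuous cl.
  move=> x; have c0 : {for x, continuous (fun=> 0 : R^o)} by exact: cst_continuous.
  have cid : {for x, continuous (fun y : R => y : R^o)} by exact: cvg_id.
  have cZ : {for x, continuous (fun=> Z : R^o)} by exact: cst_continuous.
  exact: (continuous_min cZ (continuous_max c0 cid)).
suff key (v : nat -> R) : v n @[n --> \oo] --> x0 -> psi (cl (v n)) @[n --> \oo] --> psi (cl x0).
  apply/left_right_continuousP; split.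
    by apply/cvg_at_leftP => v [_ vx0]; exact: key.
  by apply/cvg_at_rightP => v [_ vx0]; exact: key.
move=> vx0.
have clv : cl (v n) @[n --> \oo] --> cl x0 by apply: (@continuous_cvg _ _ _ _ _ _ cl) => //; exact: ccl.
under eq_fun do rewrite lefE; rewrite lefE; apply: cvgD.
  apply: cvgD; first by apply: cvgM => //; exact: cvg_cst.
  apply: cvgM; first exact: cvg_cst.
  by under eq_fun do rewrite expr2; rewrite expr2; apply: cvgM.
have [] := @Rdominated_cvg _ _ _ m D mD (fun n => lkint (cl (v n))) (lkint (cl x0))
  (fun h => (Z ^+ 2 + 1) * Num.min 1 (h ^+ 2)) => //.
- by move=> n; apply: measurable_funTS; exact: measurable_lkint.
- move=> h _; apply: cvgB; last exact: cvg_cst.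
  apply: cvgD; last by apply: cvgM; [apply: cvgM => //; exact: cvg_cst|exact: cvg_cst].
  apply: (@continuous_cvg _ _ _ _ _ _ (@expR R)); first exact: continuous_expR.
  by apply: cvgN; apply: cvgM => //; exact: cvg_cst.
- exact: (integrableR_Zl mD (Z ^+ 2 + 1) integrable_min1).
- by move=> n h; rewrite /D/= in_itv/= andbT => h0; exact: lkint_bound.
Qed.

Lemma lef_continuous (z : R) : 0 < z -> {for z, continuous psi}.
Proof.
move=> z0; have z10 : 0 <= z + 1 by lra.
have := lef_clip_continuous z10 (x := z); rewrite /continuous_at.
rewrite max_r ?ltW// min_r ?lerDl// => h; apply: cvg_trans h; apply: near_eq_cvg; near=> x.
have x0 : 0 < x by near: x; exact: lt_nbhsr.
have x1 : x < z + 1 by near: x; apply: lt_nbhsl; rewrite ltrDl.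
by rewrite max_r ?(ltW x0)// min_r ?(ltW x1).
Unshelve. all: by end_near. Qed.

Lemma lef_right_continuous (z : R) : 0 <= z -> psi x @[x --> z^'+] --> psi z.
Proof.
move=> z0; have z10 : 0 <= z + 1 by lra.
have := lef_clip_continuous z10 (x := z); rewrite /continuous_at.
rewrite max_r// min_r ?lerDl// => /cvg_at_right_filter h; apply: cvg_trans h; apply: near_eq_cvg; near=> x.
have x0 : z < x by near: x; exact: nbhs_right_gt.
have x1 : x < z + 1 by near: x; apply: nbhs_right_lt; rewrite ltrDl.
by rewrite max_r ?(ltW (le_lt_trans z0 x0))// min_r ?(ltW x1).
Unshelve. all: by end_near. Qed.

(** psi(z)/z is nondecreasing, as for any convex function vanishing at 0. In the integrand the
    compensators cancel, and what remains follows from 1 + y <= exp y at y = z1 h and y = - (z2 -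
    z1) h. *)
Lemma lef_div_mono z1 z2 : 0 < z1 -> z1 <= z2 -> psi z1 * z2 <= psi z2 * z1.
Proof.
move=> z10 z12; have z20 : 0 < z2 by exact: lt_le_trans z12.
have i1 := integrable_lkint (ltW z10); have i2 := integrable_lkint (ltW z20).
have key : z2 * \int[m]_(h in D) lkint z1 h <= z1 * \int[m]_(h in D) lkint z2 h.
  rewrite -!RintegralZl//; apply: le_Rintegral => //; [exact: integrableR_Zl|exact: integrableR_Zl|].
  move=> h; rewrite /D/= in_itv/= andbT => h0; rewrite /lkint.
  move: (\1__ _ : R) => ind.
  suff : z2 * expR (- (z1 * h)) <= (z2 - z1) + z1 * expR (- (z2 * h)).
    by move: (expR _) (expR _) => x y; lra.
  have E2 : expR (- (z2 * h)) = expR (- (z1 * h)) * expR (- ((z2 - z1) * h)).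
    by rewrite -expRD; congr expR; ring.
  have E1 : 1 = expR (- (z1 * h)) * expR (z1 * h) by rewrite -expRD addNr expR0.
  have c0 := expR_gt0 (- (z1 * h)).
  have t1 := expR_ge1Dx (z1 * h); have t2 := expR_ge1Dx (- ((z2 - z1) * h)).
  have s1 : expR (- (z1 * h)) * (1 + z1 * h) <= 1 by rewrite [leRHS]E1 ler_pM2l.
  have s2 : expR (- (z1 * h)) * (1 + - ((z2 - z1) * h)) <= expR (- (z2 * h)).
    by rewrite E2 ler_pM2l.
  have r1 : (z2 - z1) * (expR (- (z1 * h)) * (1 + z1 * h)) <= (z2 - z1) * 1.
    by rewrite ler_wpM2l// subr_ge0.
  have r2 := ler_wpM2l (ltW z10) s2.
  move: r1 r2; move: (expR _) (expR _) => x y r1 r2.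
  have := lerD r1 r2; rewrite mulr1; apply: le_trans.
  by rewrite le_eqVlt; apply/orP; left; apply/eqP; ring.
rewrite !lefE.
have s2 : 0 <= sigma ^+ 2 by exact: sqr_ge0.
have : sigma ^+ 2 / 2 * z1 ^+ 2 * z2 <= sigma ^+ 2 / 2 * z2 ^+ 2 * z1.
  have -> : sigma ^+ 2 / 2 * z1 ^+ 2 * z2 = (sigma ^+ 2 / 2 * (z1 * z2)) * z1 by ring.
  have -> : sigma ^+ 2 / 2 * z2 ^+ 2 * z1 = (sigma ^+ 2 / 2 * (z1 * z2)) * z2 by ring.
  by apply: ler_wpM2l => //; apply: mulr_ge0; [exact: divr_ge0|apply: mulr_ge0; exact: ltW].
move: (sigma ^+ 2 / 2 * z1 ^+ 2) (sigma ^+ 2 / 2 * z2 ^+ 2) key.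
move: (\int[m]_(h in D) lkint z1 h) (\int[m]_(h in D) lkint z2 h) => A B s1 s2'.
by rewrite !mulrDl; lra.
Qed.

(** For a subordinator psi <= 0: the integrand is at most z h on ]0, 1] and nonpositive beyond, and
    the integral of h over ]0, 1] is at most gamma. *)
Lemma lef_not_subordinator z : 0 < z -> 0 < psi z -> ~ subordinator_triple gamma sigma m.
Proof.
move=> z0 + [sg [hfin hle]].
apply/negP; rewrite -leNgt lefE sg expr0n/= !mul0r addr0.
pose J : set R := `]0%R, 1%R]%classic.
have mJ : measurable J by exact: measurable_itv.
have iJ : m.-integrable D (EFin \o (fun h : R => h * \1_J h)).
  apply/integrableP; split.
    by apply/measurable_EFinP; apply: measurable_funM.
  apply: le_lt_trans hfin; rewrite [leRHS]integral_mkcond [leLHS]integral_mkcond.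
  apply: ge0_le_integral => //.
  - by move=> h _; rewrite /patch; case: ifP.
  - apply/(measurable_restrictT _ mD); apply/measurable_EFinP; apply: measurableT_comp => //.
    by apply: measurable_funM.
  - apply/(measurable_restrictT _ mJ); exact/measurable_EFinP.
  move=> h _; rewrite /patch; case: ifPn => [/set_mem hD|_]; last first.
    by case: ifPn => // /set_mem; rewrite /= in_itv/= => /andP[h0 _]; rewrite lee_fin ltW.
  have h0 : 0 < h by move: hD; rewrite /D/= in_itv/= andbT.
  rewrite /= indicE -/J; case: ifPn => hJ.
    by rewrite mulr1 lee_fin gtr0_norm.
  by rewrite mulr0 normr0.
have EJ : \int[m]_(h in D) (h * \1_J h) = \int[m]_(h in J) h.
  rewrite [LHS]Rintegral_mkcond [RHS]Rintegral_mkcond; apply: eq_Rintegral => h _.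
  rewrite /patch indicE; case: ifPn => [hD|hD]; case: ifPn => [hJ|hJ]; rewrite ?mulr1 ?mulr0//.
  move/negP : hD; case; apply/mem_set; move: hJ => /set_mem; rewrite /J /D/= !in_itv/= => /andP[->//].
have : \int[m]_(h in D) lkint z h <= z * \int[m]_(h in D) (h * \1_J h).
  rewrite -RintegralZl//; apply: le_Rintegral => //; [exact: integrable_lkint (ltW z0)|exact: integrableR_Zl|].
  move=> h; rewrite /D/= in_itv/= andbT => h0; rewrite /lkint mulrA -/J.
  have e1 : expR (- (z * h)) <= 1 by rewrite expR_le1 oppr_le0 mulr_ge0// ltW.
  by move: (z * h * _) => y; lra.
rewrite EJ; have : z * \int[m]_(h in J) h <= z * gamma by rewrite ler_pM2l.
move: (\int[m]_(h in J) h) (\int[m]_(h in D) lkint z h) => A B.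
by rewrite mulNr (mulrC gamma); lra.
Qed.

End levy.

Section levy_khintchine.
Context {R : realType}.
Local Notation mR := (measurableTypeR R).
Variables (nu : {measure set mR -> \bar R}) (a b : R).
Let D : set mR := `](-1), 1]%classic.
Let N : set mR := `](-1), 0]%classic.
Let J : set mR := `]0, 1[%classic.
Let O : set mR := [set 1].
Hypothesis nuD : (nu D < +oo)%E.
Hypothesis a0 : 0 < a.

Let mD : measurable D. Proof. exact: measurable_itv. Qed.
Let mN : measurable N. Proof. exact: measurable_itv. Qed.
Let mJ : measurable J. Proof. exact: measurable_itv. Qed.
Let mO : measurable O. Proof. exact: measurable_set1. Qed.

Let JP (v : R) : J v -> 0 < v < 1.
Proof. by rewrite /J/= in_itv. Qed.

(** (1 - v)^-2 on J, written as an exponential so that it is positive and measurable on the whole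
    line. *)
Let w (v : R) : R := expR (- (2 * ln (1 - v))).
Let wE v : J v -> w v = ((1 - v) ^+ 2)^-1.
Proof.
move=> /JP /andP[_ v1]; rewrite /w expRN expRM_natl lnK// posrE subr_gt0//.
Qed.

Let k (v : mR) : R := \1_J v * w v.
Let h (v : mR) : R := - ln v / a.

Let mw : measurable_fun (setT : set mR) w.
Proof.
apply: measurableT_comp => //; apply: measurableT_comp => //; apply: measurable_funM => //.
by apply: measurableT_comp => //; exact: measurable_funB.
Qed.

Let mk : measurable_fun setT k.
Proof. by apply: measurable_funM => //; exact: measurable_indic. Qed.

Let k_ge0 v : 0 <= k v.
Proof. by rewrite mulr_ge0// expR_ge0. Qed.

Let mh : measurable_fun setT h.
Proof. by apply: measurable_funM => //; apply: measurableT_comp. Qed.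

Let h_gt0 v : J v -> 0 < h v.
Proof.
by move=> /JP /andP[v0 v1]; rewrite /h divr_gt0// oppr_gt0 ln_lt0// v0 v1.
Qed.

Let H : set R := `]0%R, +oo[%classic.

(** [lkphi c] is 1 - c at v = 0 and c (1 - c)/2 at v = 1, while on J it is a difference of two
    Levy-Khintchine integrands. All terms linear in c are collected in gamma. *)
Lemma levy_khintchine : exists (p gamma sigma : R) (m : {measure set R -> \bar R}),
  [/\ 0 <= p, levy_measure m & forall c, 0 < c ->
    \int[nu]_(v in D) lkphi c (Num.max 0 v) + c * b =
    p - laplace_exponent_formula gamma sigma m (c * a)].
Proof.
have mH : measurable H by exact: measurable_itv.
have aux (x y : R) : 0 <= y -> y <= a -> x * (1 + y) <= 1 -> x < 1 -> y <= (1 + a) * (1 - x).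
  by move=> y0 ya xy x1; have := mulr_ge0 (_ : 0 <= a - y) (_ : 0 <= 1 - x); rewrite !subr_ge0 => /(_ ya (ltW x1)); nra.
have alg (c x y z v : R) : v < 1 -> (1 - x - c * (1 - v)) / (1 - v) ^+ 2 =
    ((1 - v) ^+ 2)^-1 * (-1 * (x + - (c * y) * z - 1 - c * (v + - y * z - 1))).
  by move=> v1; field; rewrite gt_eqF// subr_gt0.
have [m mE] := weighted_image nu mk k_ge0 mh.
have mI (f : R -> R) : measurable_fun setT f ->
    (\int[m]_(y in H) (f y)%:E = \int[nu]_(v in J) (((1 - v) ^+ 2)^-1 * f (h v))%:E)%E.
  move=> mf; have mf' : measurable_fun setT (fun y : R => f y * \1_H y).
    apply: measurable_funM; [exact: mf|exact: (measurable_indic mH)].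
  transitivity (\int[m]_y (f y * \1_H y)%:E)%E.
    rewrite integral_mkcond; apply: eq_integral => y _; rewrite /patch indicE.
    by case: ifP; rewrite ?mulr1 ?mulr0.
  rewrite mE// [RHS]integral_mkcond; apply: eq_integral => v _.
  rewrite /patch /k indicE; case: ifPn => [/set_mem Jv|_]; last by rewrite !mul0r.
  rewrite mul1r wE// indicE mem_set ?mulr1//.
  by rewrite /H/= in_itv/= h_gt0.
have mL : levy_measure m.
  rewrite /levy_measure -/H mI; last first.
    by apply: measurable_minr => //; exact: measurable_funX.
  (* With y = a min(1, h) <= a, v (1 + y) <= 1 gives 1 - v >= y/(1 + y) >= y/(1 + a); hence min(1,
     h) <= ((1 + a)/a) (1 - v). *)
  pose C : R := ((1 + a) / a) ^+ 2.
  apply: (@le_lt_trans _ _ (\int[nu]_(v in J) (cst C%:E) v)%E).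
    apply: ge0_le_integral => //.
    - by move=> v Jv; rewrite lee_fin mulr_ge0 ?invr_ge0 ?sqr_ge0// le_min ler01 sqr_ge0.
    - apply/measurable_EFinP; apply: (@eq_measurable_fun _ _ _ _ J (fun v => w v * Num.min 1 (h v ^+ 2))).
        by move=> v /set_mem Jv; rewrite wE.
      apply: measurable_funTS; apply: measurable_funM => //.
      by apply: measurable_minr => //; exact: measurable_funX.
    move=> v Jv; rewrite lee_fin mulrC.
    have /andP[v0 v1] := JP Jv; have h0 := h_gt0 Jv.
    have v1' : 0 < 1 - v by rewrite subr_gt0.
    rewrite ler_pdivrMr ?exprn_gt0// -exprMn.
    pose mh1 : R := Num.min 1 (h v).
    have mh10 : 0 <= mh1 by rewrite le_min ler01 ltW.
    have -> : Num.min 1 (h v ^+ 2) = mh1 ^+ 2.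
      rewrite /mh1; have [h1|h1] := leP 1 (h v).
        by rewrite expr1n min_l// expr_ge1// ltW.
      by rewrite min_r// expr_le1// ltW.
    rewrite lerXn2r ?nnegrE//; first by rewrite mulr_ge0 ?divr_ge0 ?(ltW v1')//; move: (ltW a0); lra.
    have vE : v = expR (- (a * h v)).
      by rewrite /h mulrCA divff ?gt_eqF// mulr1 opprK lnK// posrE.
    rewrite mulrAC ler_pdivlMr//.
    have E := expR_ge1Dx (a * h v).
    have vE2 : v * expR (a * h v) = 1 by rewrite {1}vE -expRD addNr expR0.
    have vh : v * (1 + a * h v) <= 1 by rewrite -[leRHS]vE2 ler_pM2l.
    have a_gt0 := a0.
    have [m1 m2] : mh1 <= 1 /\ mh1 <= h v by split; rewrite /mh1 ge_min lexx ?orbT.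
    have vm : v * (1 + a * mh1) <= 1.
      by apply: le_trans vh; rewrite ler_pM2l// lerD2l ler_pM2l.
    have am : 0 <= a * mh1 by rewrite mulr_ge0// ltW.
    have am1 : a * mh1 <= a by rewrite ler_piMr// ltW.
    by rewrite (mulrC mh1); exact: aux am am1 vm v1.
  rewrite integral_cst// lte_mul_pinfty//; first by rewrite lee_fin sqr_ge0.
  apply: le_lt_trans nuD; apply: le_measure; rewrite ?inE//.
  by move=> v; rewrite /J /D/= !in_itv/= => /andP[v0 v1]; rewrite (ltW v1) andbT; lra.
pose p := fine (nu N); pose s := fine (nu O).
pose Ia := \int[m]_(y in H) lkint a y.
(* Identification of coefficients: that of c gives gamma a = - p + Ia + s/2 + b, that of c^2 gives
   sigma^2 a^2 = s. *)
exists p, ((- p + Ia + s / 2 + b) / a), (Num.sqrt s / a), m.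
have s0 : 0 <= s by rewrite fine_ge0.
split => //; first by rewrite fine_ge0.
move=> c c0; have ca0 : 0 < c * a by rewrite mulr_gt0.
have IJ : \int[nu]_(v in J) lkphi c (Num.max 0 v) = - (\int[m]_(y in H) lkint (c * a) y - c * Ia).
  have i1 := integrable_lkint mL (ltW ca0); have i2 := integrable_lkint mL (ltW a0).
  rewrite /Ia -RintegralZl// -RintegralB//; last exact: integrableR_Zl.
  rewrite -mulN1r -RintegralZl//; last by apply: integrableR_B => //; exact: integrableR_Zl.
  rewrite /Rintegral; congr fine; rewrite mI; last first.
    apply: measurable_funM => //; apply: measurable_funB; first exact: measurable_lkint.
    by apply: measurable_funM => //; exact: measurable_lkint.
  apply: eq_integral => v /set_mem Jv; congr EFin.
  have /andP[v0 v1] := JP Jv.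
  rewrite max_r ?(ltW v0)// /lkphi v1 /kpow v0 /lkint.
  have ah : a * h v = - ln v by rewrite /h mulrCA divff ?gt_eqF// mulr1.
  rewrite -[c * a * h v]mulrA ah mulrN !opprK (@lnK _ v) ?posrE//.
  exact: alg.
have cphi := lkphi_continuous c0.
have [M HM] : exists M : R, forall v, 0 <= v <= 1 -> `|lkphi c v| <= M.
  have cn : {within `[0, 1], continuous (fun v => `|lkphi c v|)}.
    apply: continuous_subspaceT => v.
    exact: (cvg_norm (@cphi v)).
  have [x _ xM] := EVT_max (@ler01 R) cn.
  by exists `|lkphi c x| => v v01; apply: xM; rewrite in_itv.
have iphi : nu.-integrable D (EFin \o (fun v : R => lkphi c (Num.max 0 v))).
  apply: (le_integrableR mD (g := fun=> M)).
  - apply: measurableT_comp; first exact: continuous_measurable_fun.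
    exact: measurable_maxr.
  - move=> v; rewrite /D/= in_itv/= => /andP[_ v1]; apply: HM.
    by rewrite le_max lexx/= ge_max ler01 v1.
  apply/integrableP; split; first exact/measurable_EFinP.
  rewrite (_ : \int[nu]_(x in D) _ = \int[nu]_(x in D) (cst `|M|%:E) x)%E//.
  by rewrite integral_cst// lte_mul_pinfty// lee_fin.
have DE : D = N `|` (J `|` O).
  apply/seteqP; split => v; rewrite /D /N /J /O/= !in_itv/=.
    move=> /andP[v0 v1]; have [v2|v2] := leP v 0; first by left; rewrite v0.
    by right; move: v1; rewrite le_eqVlt => /predU1P[->|->]; [right|left].
  move=> [/andP[-> v0]|[/andP[v0 v1]|->]]; first exact: le_trans v0 ler01.
    by rewrite (ltW v1) andbT; lra.
  by rewrite lexx andbT; lra.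
have subJO : J `|` O `<=` D by rewrite DE; exact: subsetUr.
have iJO : nu.-integrable (J `|` O) (EFin \o (fun v : R => lkphi c (Num.max 0 v))).
  by apply: integrableS iphi => //; exact: measurableU.
have split1 : \int[nu]_(v in D) lkphi c (Num.max 0 v) = \int[nu]_(v in N) lkphi c (Num.max 0 v) +
    (\int[nu]_(v in J) lkphi c (Num.max 0 v) + \int[nu]_(v in O) lkphi c (Num.max 0 v)).
  rewrite DE Rintegral_setU//; last 3 first.
  - exact: measurableU.
  - by rewrite -DE.
  - apply/disj_setPS => v [] /=; rewrite /N /J /O/= !in_itv/= => /andP[_ v0] [/andP[v1 _]|v1].
      by move: (le_lt_trans v0 v1); rewrite ltxx.
    by move: v0; rewrite v1 leNgt ltr01.
  congr (_ + _); rewrite Rintegral_setU//.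
  apply/disj_setPS => v [] /=; rewrite /J /O/= in_itv/= => /andP[_ v0] v1.
  by move: v0; rewrite v1 ltxx.
have IN : \int[nu]_(v in N) lkphi c (Num.max 0 v) = (1 - c) * p.
  rewrite /p -Rintegral_cst//; apply: eq_Rintegral => v /set_mem; rewrite /N/= in_itv/= => /andP[_ v0].
  by rewrite max_l// /lkphi ltr01 /kpow ltxx !subr0 expr1n divr1 mulr1.
have IO : \int[nu]_(v in O) lkphi c (Num.max 0 v) = c * (1 - c) / 2 * s.
  rewrite /s -Rintegral_cst//; apply: eq_Rintegral => v /set_mem ->.
  by rewrite max_r// /lkphi ltxx.
rewrite split1 IN IO IJ lefE -/H exprMn sqr_sqrtr//.
move: (\int[m]_(y in H) lkint (c * a) y) => z.
by field; rewrite gt_eqF.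
Qed.

End levy_khintchine.

(** * The differential equation *)

Section dini.
Context {R : realType}.
Variable U : set_system R.
Hypothesis UU : ProperFilter U.
Hypothesis U0 : (0 : R)^'+ `<=` U.

(* Argument at the last point where f r - c r does not exceed its value at a. *)
Lemma ultra_derivative_le (f k : R -> R) (a b c : R) : a <= b ->
  (forall s, a <= s <= b -> {for s, continuous f}) ->
  (forall s, a <= s <= b -> (f (s + t) - f s) / t @[t --> U] --> k s) ->
  (forall s, a <= s <= b -> k s < c) -> f b - f a <= c * (b - a).
Proof.
move=> ab cf fk kc; rewrite leNgt; apply/negP => fba.
pose F (r : R) := f r - c * r.
have Fab : F a < F b by rewrite /F; lra.
have cF s : a <= s <= b -> {for s, continuous F}.
  move=> sab; apply: continuousB; first exact: cf.
  by apply: continuousM; [exact: cst_continuous|exact: cvg_id].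
pose S := [set r : R | a <= r <= b /\ F r <= F a].
have Sa : S a by split => //; rewrite lexx.
have Sb : has_sup S by split; [exists a|exists b => r [/andP[_ rb] _]].
pose r := sup S.
have ar : a <= r by apply: ub_le_sup => //; have [] := Sb.
have rb : r <= b by apply: ge_sup; [exists a|move=> x [/andP[]]].
have rab : a <= r <= b by rewrite ar.
have Fr : F r <= F a.
  rewrite leNgt; apply/negP => Far.
  have /nbhs_ballP[e /= e0 He] : \forall x \near r, F a < F x by exact: (cvgr_gt _ (cF _ rab)).
  have [x [/andP[ax xb] Fx] rx] := sup_adherent e0 Sb.
  have xr : x <= r by apply: ub_le_sup; [have [] := Sb|split => //; rewrite ax].
  have : F a < F x.
    by apply: He; rewrite /ball/= ger0_norm ?subr_ge0//; move: rx; rewrite -/r; lra.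
  by rewrite ltNge Fx.
have rltb : r < b.
  by rewrite lt_neqAle rb andbT; apply/eqP => rE; move: Fr; rewrite rE leNgt Fab.
have lim : (F (r + t) - F r) / t @[t --> U] --> k r - c.
  apply: cvg_trans (cvgB (fk _ rab) (@cvg_cst _ c _ U _)).
  apply: near_eq_cvg.
  have : \forall t \near U, 0 < t by apply: U0; exact: nbhs_right_gt.
  apply: filterS => t t0.
  transitivity ((f (r + t) - f r) / t - c) => //.
  by rewrite /F; move: (f (r + t)) (f r) => x y; field; rewrite gt_eqF.
have neg : k r - c < 0 by rewrite subr_lt0 kc.
have : \forall t \near U, [/\ (F (r + t) - F r) / t < 0, 0 < t & t < b - r].
  near=> t; split.
  - by near: t; exact: (cvgr_lt _ lim).
  - by near: t; apply: U0; exact: nbhs_right_gt.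
  - by near: t; apply: U0; apply: nbhs_right_lt; rewrite subr_gt0.
move=> /filter_ex[t [Ft t0 tb]].
have : F (r + t) < F r by move: Ft; rewrite pmulr_llt0 ?invr_gt0// subr_lt0.
move=> Frt; have Srt : S (r + t).
  split; last exact: le_trans (ltW Frt) Fr.
  by apply/andP; split; lra.
have : r + t <= r by apply: ub_le_sup => //; have [] := Sb.
by rewrite leNgt ltrDl t0.
Unshelve. all: by end_near. Qed.

Lemma is_derive_of_dist (f : R -> R) (s l : R) :
  (forall e : R, 0 < e -> exists2 dl : R, 0 < dl &
    forall y, `|y - s| < dl -> `|f y - f s - l * (y - s)| <= e * `|y - s|) ->
  is_derive s 1 f l.
Proof.
move=> H.
have h : h^-1 *: (f (h *: (1 : R) + s) - f s) @[h --> 0^'] --> l.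
  apply/cvgrPdist_le => e e0; have [dl dl0 Hdl] := H _ e0.
  near=> x.
  have x0 : x != 0 by near: x; exact: nbhs_dnbhs_neq.
  have xd : `|x| < dl.
    near: x; apply: nbhs_dnbhs; apply/nbhs_ballP; exists dl => //= y.
    by rewrite /ball/= sub0r normrN.
  have := Hdl (x *: 1 + s); rewrite /GRing.scale/= mulr1 addrK => /(_ xd).
  rewrite -ler_pdivrMr ?normr_gt0// -normf_div distrC; apply: le_trans.
  rewrite le_eqVlt; apply/orP; left; apply/eqP; congr `|_|.
  by field.
by apply: DeriveDef; [apply/cvg_ex; exists l|apply/cvg_lim].
Unshelve. all: by end_near. Qed.

(** Near s, where [k] is within e of [k s], [ultra_derivative_le] bounds the increments of f from
    above and, applied to - f, from below. *)
Lemma ultra_derivative_is_derive (f k : R -> R) :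
  (forall s, 0 < s -> {for s, continuous f}) -> (forall s, 0 < s -> {for s, continuous k}) ->
  (forall s, 0 < s -> (f (s + t) - f s) / t @[t --> U] --> k s) ->
  forall s : R, 0 < s -> is_derive s 1 f (k s).
Proof.
move=> cf ck fk s s0; apply: is_derive_of_dist => e e0.
move/cvgrPdist_lt : (ck _ s0) => /(_ _ e0) /nbhs_ballP[d1 /= d10 Hd].
exists (Num.min d1 s); first by rewrite lt_min d10.
have key x y : 0 < x -> x <= y -> (forall r, x <= r <= y -> `|s - r| < d1) ->
    `|f y - f x - k s * (y - x)| <= e * (y - x).
  move=> x0 xy Hr.
  have pos r : x <= r <= y -> 0 < r by move=> /andP[xr _]; exact: lt_le_trans xr.
  have kb r : x <= r <= y -> k s - e < k r < k s + e.
    by move=> /Hr /Hd; rewrite ltr_distlC => /andP[h1 h2]; apply/andP; split; lra.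
  have ub : f y - f x <= (k s + e) * (y - x).
    apply: (@ultra_derivative_le f k) => // r /[dup] rxy /pos r0; [exact: cf|exact: fk|].
    by have /andP[] := kb _ rxy.
  have lb : - f y - - f x <= (- k s + e) * (y - x).
    apply: (@ultra_derivative_le (fun r => - f r) (fun r => - k r)) => // r /[dup] rxy /pos r0.
    - by apply: continuousN; exact: cf.
    - have -> : (fun t => (- f (r + t) - - f r) / t) = (fun t => - ((f (r + t) - f r) / t)).
        by apply/funext => t; move: (t^-1) => y'; ring.
      by apply: cvgN; exact: fk.
    - by have /andP[] := kb _ rxy; lra.
  by rewrite ler_norml; apply/andP; split; lra.
move=> y; rewrite lt_min => /andP[yd ys].
have y0 : 0 < y by move: ys; rewrite ltr_distl => /andP[+ _]; lra.
have [sy|/ltW ys'] := leP s y.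
  rewrite ger0_norm ?subr_ge0// in yd *; apply: key => // r /andP[sr ry].
  by rewrite distrC ger0_norm ?subr_ge0//; apply: le_lt_trans yd; rewrite lerD2r.
rewrite ler0_norm ?subr_le0// in yd *.
have -> : f y - f s - k s * (y - s) = - (f s - f y - k s * (s - y)) by ring.
rewrite normrN opprB; apply: key => // r /andP[yr rs].
rewrite ger0_norm ?subr_ge0//; move: yd; rewrite opprB; apply: le_lt_trans.
by rewrite lerD2l lerN2.
Qed.

End dini.

Lemma MVT_pos {R : realType} (f df : R -> R) (x y : R) : 0 < x -> 0 < y ->
  (forall r : R, 0 < r -> is_derive r 1 f (df r)) ->
  exists r, [/\ 0 < r, `|r - x| <= `|y - x| & f y - f x = df r * (y - x)].
Proof.
move=> x0 y0 dfr.
have key (a b : R) : 0 < a -> a <= b -> exists2 r : R, a <= r <= b & f b - f a = df r * (b - a).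
  move=> a0 ab.
  have pos (r : R) : a <= r -> 0 < r by exact: lt_le_trans.
  have d1 r : r \in `]a, b[ -> is_derive r 1 f (df r).
    by rewrite in_itv/= => /andP[/ltW ar _]; apply: dfr; exact: pos.
  have d2 : {within `[a, b], continuous f}.
    apply: derivable_within_continuous => r; rewrite in_itv/= => /andP[ar _].
    by have [] := dfr _ (pos _ ar).
  have [r rab E] := MVT_segment ab d1 d2.
  by exists r; first by move: rab; rewrite in_itv.
have [xy|/ltW yx] := leP x y.
  have [r /andP[xr ry] E] := key _ _ x0 xy.
  exists r; split => //; first exact: lt_le_trans xr.
  by rewrite !ger0_norm ?subr_ge0// lerD2r.
have [r /andP[yr rx] E] := key _ _ y0 yx.
exists r; split => //; first exact: lt_le_trans yr.
  by rewrite !ler0_norm ?subr_le0// lerN2 lerD2r.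
by rewrite -[LHS]opprB E; ring.
Qed.

Section ode.
Context {R : realType}.
Variables (U : set_system R) (u : R -> R -> R) (psi : R -> R) (p B : R).
Hypothesis UU : ProperFilter U.
Hypothesis U0 : (0 : R)^'+ `<=` U.
Hypothesis u_gt0 : forall t z, 0 <= t -> 0 < z -> 0 < u t z.
Hypothesis uD : forall t s z, 0 <= t -> 0 <= s -> 0 <= z -> u (t + s) z = u t (u s z).
Hypothesis ucont : forall t z, 0 < t -> 0 < z -> {for t, continuous (u ^~ z)}.
Hypothesis psicont : forall z, 0 < z -> {for z, continuous psi}.
Hypothesis ulim : forall z, 0 < z -> (u t z - z) / t @[t --> U] --> p - psi z.

Lemma ode_pos (t z : R) : 0 < t -> 0 < z -> is_derive t 1 (u ^~ z) (p - psi (u t z)).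
Proof.
move=> t0 z0; apply: (@ultra_derivative_is_derive _ U UU U0 (u ^~ z) (fun t => p - psi (u t z))) => //.
- by move=> s s0; exact: ucont.
- move=> s s0; apply: continuousB; first exact: cst_continuous.
  apply: (@continuous_comp _ _ _ (u ^~ z) psi); first exact: ucont.
  by apply: psicont; apply: u_gt0 => //; exact: ltW.
move=> s s0; have us0 : 0 < u s z by apply: u_gt0 => //; exact: ltW.
apply: cvg_trans (ulim us0); apply: near_eq_cvg.
have : \forall r \near U, 0 < r by apply: U0; exact: nbhs_right_gt.
by apply: filterS => r r0; rewrite [s + r]addrC uD// ltW.
Qed.

Hypothesis B_ge0 : 0 <= B.
Hypothesis clip : continuous (fun x : R => psi (Num.min B (Num.max 0 x))).
Hypothesis u_ge0 : forall t, 0 <= t -> 0 <= u t 0.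
Hypothesis u_le : forall t n, 0 <= t -> u t n.+1%:R^-1 <= B.
Hypothesis ucvg0 : forall t, 0 <= t -> u t n.+1%:R^-1 @[n --> \oo] --> u t 0.

(* The equation at z = 0 is the limit of the equations at z = 1/(n+1), whose
   solutions are Lipschitz in time uniformly in n. *)
Lemma ode_zero (t : R) : 0 < t -> is_derive t 1 (u ^~ 0) (p - psi (u t 0)).
Proof.
move=> t0; pose Psi x := psi (Num.min B (Num.max 0 x)).
have PsiE x : 0 <= x -> x <= B -> Psi x = psi x by move=> x0 xB; rewrite /Psi max_r// min_r.
have lam0 n : 0 < n.+1%:R^-1 :> R by rewrite invr_gt0.
have un_gt0 s n : 0 <= s -> 0 < u s n.+1%:R^-1 by move=> s0; exact: u_gt0.
have uB s : 0 <= s -> u s 0 <= B.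
  move=> s0; apply: (ler_cvg_to (ucvg0 s0) (@cvg_cst _ B _ \oo _)).
  by apply: nearW => n; exact: u_le.
(* All solutions started at 1/(n+1) stay in [0, B], so [K] is a common Lipschitz constant in
   time. *)
have [K K0 HK] : exists2 K : R, 0 <= K & forall x, 0 <= x -> x <= B -> `|p - psi x| <= K.
  have cn : {within `[0, B], continuous (fun x => `|p - Psi x|)}.
    apply: continuous_subspaceT => x.
    have c1 : {for x, continuous (fun x => p - Psi x)}.
      by apply: continuousB; [exact: cst_continuous|exact: clip].
    exact: (cvg_norm c1).
  have [x xB xM] := EVT_max B_ge0 cn.
  exists `|p - Psi x| => // y y0 yB; rewrite -PsiE//.
  by apply: xM; rewrite in_itv/= y0.
have mvt n (x y : R) : 0 < x -> 0 < y -> exists r, [/\ 0 < r, `|r - x| <= `|y - x| &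
    u y n.+1%:R^-1 - u x n.+1%:R^-1 = (p - psi (u r n.+1%:R^-1)) * (y - x)].
  move=> x0 y0; apply: (@MVT_pos _ (u ^~ n.+1%:R^-1) (fun r => p - psi (u r n.+1%:R^-1))) => //.
  by move=> r r0; apply: ode_pos.
apply: is_derive_of_dist => e e0.
have x0B := uB _ (ltW t0); have x00 := u_ge0 (ltW t0).
set x0 := u t 0 in x0B x00 *.
move/cvgrPdist_le : (@clip x0) => /(_ _ e0) /nbhs_ballP[d1 /= d10 Hd].
have K1 : 0 < 2 * (K + 1) by lra.
(* Motion in time within this radius uses at most d1/2; the distance from u_t(1/(n+1)) to u_t(0)
   takes the other half. The bound by t keeps y positive. *)
exists (Num.min t (d1 / (2 * (K + 1)))).
  by rewrite lt_min t0 divr_gt0.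
move=> y; rewrite lt_min => /andP[yt yd].
have y0 : 0 < y by move: yt; rewrite ltr_distl => /andP[+ _]; lra.
have d20 : 0 < d1 / 2 by rewrite divr_gt0.
have c1 : `|u y n.+1%:R^-1 - u t n.+1%:R^-1 - (p - psi x0) * (y - t)| @[n --> \oo] -->
    `|u y 0 - x0 - (p - psi x0) * (y - t)|.
  apply: cvg_norm; apply: cvgB; last exact: cvg_cst.
  by apply: cvgB; apply: ucvg0; exact: ltW.
apply: (ler_cvg_to c1 (@cvg_cst _ (e * `|y - t|) _ \oo _)).
move/cvgrPdist_lt : (ucvg0 (ltW t0)) => /(_ _ d20) near1.
apply: filterS near1 => n hn.
have [r [r0 rt E]] := mvt n t y t0 y0.
have [r' [r'0 r't E']] := mvt n t r t0 r0.
rewrite E -mulrBl normrM ler_wpM2r//.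
have bnd s : 0 < s -> 0 <= u s n.+1%:R^-1 <= B.
  by move=> s0; rewrite (ltW (un_gt0 _ _ (ltW s0))) u_le// ltW.
have /andP[r1 r2] := bnd _ r0; have /andP[r'1 r'2] := bnd _ r'0.
rewrite -(PsiE _ r1 r2) -(PsiE _ x00 x0B).
rewrite [X in `|X|](_ : _ = Psi x0 - Psi (u r n.+1%:R^-1)); last by ring.
apply: Hd; rewrite /ball/=.
have h1 : `|u r n.+1%:R^-1 - u t n.+1%:R^-1| <= K * `|y - t|.
  by rewrite E' normrM; apply: ler_pM => //; exact: HK.
have h2 : K * `|y - t| <= d1 / 2.
  apply: (@le_trans _ _ ((K + 1) * `|y - t|)); first by rewrite ler_wpM2r// lerDl.
  move: yd; rewrite ltr_pdivlMr// => /ltW yd.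
  by move: `|y - t| yd => z; lra.
have -> : x0 - u r n.+1%:R^-1 = (x0 - u t n.+1%:R^-1) - (u r n.+1%:R^-1 - u t n.+1%:R^-1) by ring.
apply: (le_lt_trans (ler_normB _ _)).
have -> : d1 = d1 / 2 + d1 / 2 by lra.
by apply: ltr_leD => //; exact: le_trans h1 h2.
Qed.

End ode.

(** * The branching mechanism *)

Section exponent.
Context {R : realType}.
Notation leb := (@lebesgue_measure R).
Variables (z0 theta p : R) (g psi : R -> R).
Hypothesis z0_ge0 : 0 <= z0.
Hypothesis z0theta : z0 < theta.
Hypothesis gC1 : C1_on_halfline z0 g.
Hypothesis gpos : forall z, z0 < z -> 0 < g z.
Hypothesis gz0 : g z0 = 0.
Hypothesis gpinfty : g @ +oo --> +oo.
Hypothesis gint : (\int[leb]_(z in `[theta, +oo[) ((g z)^-1)%:E = +oo)%E.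
Hypothesis p_ge0 : 0 <= p.
Hypothesis psi0 : psi 0 = 0.
Hypothesis psi_cont : forall z, 0 < z -> {for z, continuous psi}.
Hypothesis psi_rc : psi x @[x --> z0^'+] --> psi z0.
Hypothesis psi_mono : forall z1 z2, 0 < z1 -> z1 <= z2 -> psi z1 * z2 <= psi z2 * z1.
Hypothesis gpsi : forall z, z0 < z -> g z = psi z - p.

(** Convergence of the one-sided difference quotient at z0 forces g to tend to g z0 = 0 from the
    right, where g is psi - p. *)
Lemma psi_z0 : psi z0 = p.
Proof.
have [h [_ [_ hd]]] := gC1.
pose e (n : nat) : R := n.+1%:R^-1.
have e0 n : 0 < e n by rewrite /e invr_gt0.
have ecvg : e n @[n --> \oo] --> (0 : R) by exact: cvg_harmonic.
have ze : z0 + e n @[n --> \oo] --> z0.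
  by rewrite -[X in _ --> X]addr0; apply: cvgD => //; exact: cvg_cst.
have c1 : (g (z0 + e n) - g z0) / e n @[n --> \oo] --> h z0.
  by move/cvg_at_rightP : hd; apply; split.
have c2 : g (z0 + e n) @[n --> \oo] --> (0 : R).
  rewrite -[X in _ --> X](mulr0 (h z0)); apply: cvg_trans (cvgM c1 ecvg).
  apply: near_eq_cvg; apply: nearW => n /=; rewrite gz0 subr0 divfK// gt_eqF//.
have c3 : g (z0 + e n) @[n --> \oo] --> psi z0 - p.
  under eq_fun do rewrite gpsi ?ltrDl//.
  apply: cvgB; last exact: cvg_cst.
  by move/cvg_at_rightP : psi_rc; apply; split => // n; rewrite ltrDl.
by apply/eqP; rewrite -subr_eq0; apply/eqP; apply: (cvg_unique _ c3 c2).
Qed.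

Lemma psi_gt0 : 0 < psi (z0 + 1).
Proof.
have h : z0 < z0 + 1 by rewrite ltrDl.
by have := gpos h; rewrite gpsi//; have := p_ge0; lra.
Qed.

(** A point 0 < z < z0 with psi z > p would contradict psi(z)/z <= psi(z0)/z0 = p/z0; above z0, psi
    - p = g is positive. *)
Lemma rc_inverse_psi : z0 = rc_inverse psi p.
Proof.
have lbz z : 0 <= z /\ p < psi z -> z0 <= z.
  move=> [z_ge0 pz]; rewrite leNgt; apply/negP => zz0.
  move: z_ge0; rewrite le_eqVlt => /predU1P[zE|z_gt0].
    by move: pz; rewrite -zE psi0 ltNge p_ge0.
  have := psi_mono z_gt0 (ltW zz0); rewrite psi_z0 leNgt.
  move/negP; apply; apply: (@le_lt_trans _ _ (p * z0)).
    by rewrite ler_wpM2l// ltW.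
  by rewrite ltr_pM2r// (lt_trans z_gt0).
have mem z : z0 < z -> 0 <= z /\ p < psi z.
  move=> z0z; split; first exact: le_trans z0_ge0 (ltW z0z).
  by have := gpos z0z; rewrite gpsi// subr_gt0.
have z01 : z0 < z0 + 1 by rewrite ltrDl.
apply/eqP; rewrite eq_le; apply/andP; split.
  by apply: lb_le_inf; [exists (z0 + 1); exact: mem|move=> z; exact: lbz].
apply/ler_addgt0Pr => e e0; apply: inf_lbound; first by exists z0 => z; exact: lbz.
by apply: mem; rewrite ltrDl.
Qed.

(** As psi(z)/z is nondecreasing, psi stays positive once it is. This makes 1/psi positive and
    continuous on the range of integration of [integral_inv_psi]. *)
Lemma psi_pos_from : exists z1, [/\ 0 < z1, z1 < rc_inverse psi 0 + 1 &
  forall z, z1 <= z -> 0 < psi z].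
Proof.
pose S := [set z : R | 0 <= z /\ 0 < psi z].
have Sinf : has_inf S.
  split; last by exists 0 => z [].
  by exists (z0 + 1); split; [rewrite addr_ge0|exact: psi_gt0].
have [z1 [z1_ge0 pz1] z1lt] := inf_adherent (@ltr01 R) Sinf.
have z1_gt0 : 0 < z1.
  by rewrite lt_neqAle z1_ge0 andbT; apply/eqP => E; move: pz1; rewrite -E psi0 ltxx.
exists z1; split => // z z1z; have := psi_mono z1_gt0 z1z => h.
have z_gt0 : 0 < z by exact: lt_le_trans z1z.
rewrite -(pmulr_lgt0 _ z1_gt0); apply: lt_le_trans h.
exact: mulr_gt0.
Qed.

(** Since g tends to infinity, psi = g + p <= 2 g on a tail, so 1/psi >= 1/(2 g) there; the tail
    integral of 1/g is infinite because the integral over [theta, N] is finite. *)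
Lemma integral_inv_psi :
  (\int[leb]_(z in `[(rc_inverse psi 0 + 1)%R, +oo[) ((psi z)^-1)%:E = +oo)%E.
Proof.
have aux (x y : R) : 0 < x -> p <= x -> x = y - p -> (2 * x)^-1 <= y^-1.
  by move=> x0 px xy; have p0 := p_ge0; rewrite lef_pV2 ?posrE; lra.
have [z1 [z1_gt0 z1b psi_pos]] := psi_pos_from.
set b := rc_inverse psi 0 + 1 in z1b *.
have [N [bN thN HN]] : exists N : R, [/\ b <= N, theta <= N & forall z, N <= z -> p <= g z].
  have /cvgryPge /(_ p) [M [_ HM]] := gpinfty.
  exists (Num.max (Num.max b theta) (M + 1)); split.
  - by rewrite !le_max lexx.
  - by rewrite !le_max lexx orbT.
  by move=> z; rewrite ge_max => /andP[_ Mz]; apply: HM; apply: lt_le_trans Mz; rewrite ltrDl.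
pose A : set (measurableTypeR R) := `[theta, N]%classic.
pose B : set (measurableTypeR R) := `]N, +oo[%classic.
pose E : set (measurableTypeR R) := `[b, +oo[%classic.
have mA : measurable A by exact: measurable_itv.
have mB : measurable B by exact: measurable_itv.
have mE : measurable E by exact: measurable_itv.
have ABE : (`[theta, +oo[%classic : set (measurableTypeR R)) = A `|` B.
  apply/seteqP; split => z; rewrite /A /B/= !in_itv/= !andbT.
    by move=> tz; have [zN|zN] := leP z N; [left; rewrite tz|right].
  by move=> [/andP[]//|Nz]; exact: le_trans thN (ltW Nz).
have mgz : measurable_fun (`]z0, +oo[%classic : set (measurableTypeR R)) (fun z => (g z)^-1).
  by apply: continuous_halfline_measurable => z zz; exact: (invg_continuous gC1 gpos zz).
have mAB : measurable_fun (A `|` B) (fun z => (g z)^-1).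
  apply: measurable_funS mgz => //; rewrite -ABE => z; rewrite /= !in_itv/= !andbT.
  exact: lt_le_trans.
have mABs : measurable (A `|` B) by exact: measurableU.
have mAg : measurable_fun A (fun z => (g z)^-1) by exact: (measurable_funS mABs (@subsetUl _ _ _) mAB).
have mBg : measurable_fun B (fun z => (g z)^-1) by exact: (measurable_funS mABs (@subsetUr _ _ _) mAB).
have gAB z : (A `|` B) z -> z0 < z.
  by rewrite -ABE/= in_itv/= andbT; exact: lt_le_trans.
have mpsi : measurable_fun E (fun z => (psi z)^-1).
  have : measurable_fun (`]z1, +oo[%classic : set (measurableTypeR R)) (fun z => (psi z)^-1).
    apply: continuous_halfline_measurable => z zz; apply: continuousV.
      by rewrite gt_eqF// psi_pos// ltW.
    by apply: psi_cont; exact: lt_trans zz.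
  apply: measurable_funS => // z; rewrite /E/= !in_itv/= !andbT.
  exact: lt_le_trans.
have intB : (\int[leb]_(z in B) ((g z)^-1)%:E = +oo)%E.
  have := gint; rewrite ABE ge0_integral_setU//.
  - have Afin : (\int[leb]_(z in A) ((g z)^-1)%:E < +oo)%E.
      have /integrableP[_] := invg_integrable gC1 gpos N z0theta.
      apply: le_lt_trans; apply: ge0_le_integral => //.
      + move=> z; rewrite /A/= in_itv/= => /andP[tz _].
        by rewrite lee_fin invr_ge0 ltW// gpos//; exact: lt_le_trans tz.
      + exact/measurable_EFinP.
      + by apply/measurable_EFinP; apply: measurableT_comp.
      + by move=> z _; rewrite lee_fin ler_norm.
    have A0 : (0 <= \int[leb]_(z in A) ((g z)^-1)%:E)%E.
      apply: integral_ge0 => z Az; rewrite lee_fin invr_ge0 ltW// gpos//.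
      by apply: gAB; left.
    move: Afin A0; case: (\int[leb]_(z in A) _)%E => [r _ _| |]//.
    by case: (\int[leb]_(z in B) _)%E.
  - exact/measurable_EFinP.
  - by move=> z /gAB z0z; rewrite lee_fin invr_ge0 ltW// gpos.
  - apply/disj_setPS => z [] /=; rewrite /A /B/= !in_itv/= => /andP[_ zN] /andP[Nz _].
    by move: (le_lt_trans zN Nz); rewrite ltxx.
apply/eqP; rewrite -leye_eq.
have BE : B `<=` E.
  by move=> z; rewrite /B /E/= !in_itv/= !andbT => /ltW Nz; exact: le_trans Nz.
apply: (@le_trans _ _ (\int[leb]_(z in B) ((psi z)^-1)%:E)%E); last first.
  apply: ge0_subset_integral => //; first exact/measurable_EFinP.
  move=> z; rewrite /E/= in_itv/= andbT => bz.
  by rewrite lee_fin invr_ge0 ltW// psi_pos// (le_trans (ltW z1b)).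
apply: (@le_trans _ _ (\int[leb]_(z in B) ((2^-1 : R)%:E * ((g z)^-1)%:E))%E).
  rewrite ge0_integralZl_EFin//.
  - by rewrite intB mulry gtr0_sg// mul1e.
  - by move=> z Bz; rewrite lee_fin invr_ge0 ltW// gpos// gAB//; right.
  - exact/measurable_EFinP.
apply: ge0_le_integral => //.
- by move=> z Bz; rewrite -EFinM lee_fin mulr_ge0// invr_ge0 ltW// gpos// gAB//; right.
- by apply/measurable_EFinP; apply: measurable_funM.
- by apply/measurable_EFinP; apply: (measurable_funS mE BE mpsi).
move=> z Bz; rewrite -EFinM lee_fin -invfM.
have z0z : z0 < z by apply: gAB; right.
have pg : p <= g z by apply: HN; move: Bz; rewrite /B/= in_itv/= andbT => /ltW.
have g0 := gpos z0z; have gE := gpsi z0z.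
exact: aux.
Qed.

End exponent.

Lemma is_derive_cvg_at_right {R : realType} (f : R -> R) (l : R) :
  is_derive (0 : R) 1 f l -> (f t - f 0) / t @[t --> 0^'+] --> l.
Proof.
move=> [d dE].
have h : h^-1 *: (f (h *: (1 : R) + 0) - f 0) @[h --> 0^'] --> l by rewrite -dE.
apply: (@cvg_trans _ (h^-1 *: (f (h *: (1 : R) + 0) - f 0) @[h --> 0^'+])).
  apply: near_eq_cvg; apply: nearW => t; rewrite /GRing.scale/= mulr1 addr0 mulrC//.
apply: cvg_trans h; apply: cvg_app => A hA.
have {}hA : \forall y \near (0 : R), y != 0 -> A y by exact: hA.
change (\forall y \near (0 : R), 0 < y -> A y).
apply: filterS hA => y yA y0; apply: yA.
by rewrite gt_eqF.
Qed.

Theorem mainTheorem9 (R : realType) (d : measure_display) (Omega : measurableType d)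
    (F : R -> set (set Omega)) (P : R -> probability Omega R)
    (X : R -> Omega -> R) (zeta : Omega -> \bar R)
    (Q z0 theta : R) (g : R -> R) :
  standing_setting F P X zeta ->
  no_negative_jumps P X zeta ->
  0 < Q -> 0 <= z0 -> z0 < theta ->
  C1_on_halfline z0 g ->
  (forall z, z0 <= z -> 0 <= g z) ->
  (forall z, z0 < z -> 0 < g z) ->
  g z0 = 0 ->
  g @ +oo --> +oo ->
  (\int[lebesgue_measure]_(z in `[theta, +oo[) ((g z)^-1)%:E = +oo)%E ->
  (forall l x q, 0 < l -> l <= x -> Q < q ->
     Ng g z0 theta q x \is a fin_num /\ Ng g z0 theta q l \is a fin_num /\
     laplace_passage P X zeta x q l
       = (fine (Ng g z0 theta q x) / fine (Ng g z0 theta q l))%:E) ->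
  exists (psi : R -> R) (p : R),
    [/\ spec_pos_laplace_exponent psi, 0 <= p,
        (\int[lebesgue_measure]_(z in `[(rc_inverse psi 0 + 1)%R, +oo[)
            ((psi z)^-1)%:E = +oo)%E,
        is_CSBP P X zeta psi p &
        z0 = rc_inverse psi p /\ (forall z, z0 <= z -> g z = psi z - p)].
Proof.
move=> [[Ffilt _] zetaS _ [Xcadlag _] [_ Xnormal XM _ _]] _ Q0 z0_ge0 z0theta gC1 _ gpos gz0 gpinfty gint passage.
have Ngfin q y : Q < q -> 0 < y -> Ng g z0 theta q y \is a fin_num.
  by move=> Qq y0; have [] := passage y y q y0 (lexx _) Qq.
have passageE (l x q : R) : 0 < l -> l <= x -> Q < q ->
    laplace_passage P X zeta x q l = (Phi z0 theta g q x / Phi z0 theta g q l)%:E.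
  by move=> l0 lx Qq; have [_ [_ ->]] := passage _ _ _ l0 lx Qq; rewrite !(PhiE z0theta gC1 gpos).
have [Gam [Gam0 GK GamK dGam]] := invg_flow_exists z0theta gC1 gpos gz0 gint.
pose fl := flow (invg_primitive theta g) Gam.
have fl_gt t z : z0 < fl t z by exact: flow_gt.
have LapE' (x t z : R) : 0 < x -> 0 <= t -> z0 < z -> Lap P X zeta x t z = expR (- (x * fl t z)).
  by move=> x0 t0 zz; exact: (Lap_above Ffilt zetaS Xcadlag Xnormal XM Q0 z0_ge0 z0theta gC1 gpos gz0 gint Ngfin passageE Gam0 GK GamK dGam).
pose u := cumulant P X zeta.
have LapC (x t z : R) : 0 < x -> 0 <= t -> 0 <= z -> Lap P X zeta x t z = expR (- (x * u t z)).
  exact: (Lap_cumulant Ffilt zetaS Xcadlag Xnormal XM z0_ge0 LapE').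
have u_gt0 (t z : R) : 0 <= t -> 0 < z -> 0 < u t z.
  exact: (cumulant_gt0 Ffilt zetaS Xcadlag Xnormal XM z0_ge0 fl_gt LapE').
have uD (t s z : R) : 0 <= t -> 0 <= s -> 0 <= z -> u (t + s) z = u t (u s z).
  exact: (cumulant_semigroup Ffilt zetaS Xcadlag Xnormal XM z0_ge0 LapE').
have u_ge0 (t z : R) : 0 <= t -> 0 <= z -> 0 <= u t z.
  exact: (cumulant_ge0 Ffilt zetaS Xcadlag Xnormal XM).
have ucont (t z : R) : 0 < t -> 0 < z -> {for t, continuous (u ^~ z)}.
  exact: (cumulant_continuous Ffilt zetaS Xcadlag Xnormal XM z0_ge0 LapE').
have umono (t z z' : R) : 0 <= t -> 0 <= z -> z <= z' -> u t z <= u t z'.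
  exact: (cumulant_mono Ffilt zetaS Xcadlag Xnormal XM z0_ge0 LapE').
have ucvg0 (t : R) : 0 <= t -> u t n.+1%:R^-1 @[n --> \oo] --> u t 0.
  exact: (cumulant_cvg0 Ffilt zetaS Xcadlag Xnormal XM z0_ge0 LapE').
have ucvgt (z : R) : 0 <= z -> u t z @[t --> 0^'+] --> z.
  exact: (cumulant_cvg_time0 Ffilt zetaS Xcadlag Xnormal XM).
have u0 (z : R) : 0 <= z -> u 0 z = z by exact: (cumulant0 Xnormal).
have uabove (t z : R) : 0 <= t -> z0 < z -> u t z = fl t z.
  by move=> t0 zz; exact: (cumulant_above LapE').
have du (z : R) : z0 < z -> (u t z - z) / t @[t --> 0^'+] --> - g z.
  move=> zz; have dfl := is_derive_flow_time (invg_primitive theta g) dGam 0 z.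
  rewrite (flow0 GamK zz) in dfl; have := is_derive_cvg_at_right dfl.
  rewrite (flow0 GamK zz); apply: cvg_trans; apply: near_eq_cvg; near=> t.
  by rewrite uabove// ltW//; near: t; exact: nbhs_right_gt.
(* [U] refines the right neighbourhoods of 0, so the limits at 0+ known above z0 persist along
   it. *)
have [U [UU U0]] := @ultraFilterLemma R (0 : R)^'+ _.
have UP : ProperFilter U by exact: ultra_proper.
(* Both a and 2a must lie above z0, where [du] gives the derivative at time 0. *)
pose a := z0 + 1.
have a_gt0 : 0 < a by rewrite /a; lra.
have z0a : z0 < a by rewrite ltrDl.
have z02a : z0 < 2 * a by lra.
have exV (t : R) : exists V : Omega -> R, 0 < t ->
    [/\ measurable_fun setT V, forall w, 0 <= V w <= 1 &
     forall k : R, 0 < k -> \int[P (t ^+ 2)]_w kpow (V w) k = expR (- (t ^+ 2 * u t (k * a)))].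
  have [t0|t0] := ltP 0 t; last by exists (fun=> 0).
  have t20 : 0 < t ^+ 2 by rewrite exprn_gt0.
  have [V [mV V01 _ VE]] := Lap_version Ffilt zetaS Xcadlag Xnormal XM t20 (ltW t0).
  exists (fun w => kpow (V w) a) => _; split.
  - exact: measurable_kpow.
  - by move=> w; rewrite kpow_ge0/= kpow_le1 ?(ltW a_gt0)//; have /andP[] := V01 w.
  move=> k k0; under eq_Rintegral do rewrite kpowM.
  by rewrite -VE LapC// ?(ltW t0)// mulr_ge0// ltW.
have [V HV] := choice exV.
have [nu [nufin nuE]] := @ultralimit_lkphi R _ Omega (fun t => P (t ^+ 2)) V u a (- g a) (- g (2 * a)) U UU U0 a_gt0
  (fun t t0 => let: And3 mV _ _ := HV t t0 in mV)
  (fun t t0 => let: And3 _ V01 _ := HV t t0 in V01)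
  (fun t k t0 => let: And3 _ _ VE := HV t t0 in VE k)
  (fun z z_gt0 => ucvgt z (ltW z_gt0)) (du _ z0a) (du _ z02a).
have [p [gamma [sigma [m [p_ge0 mL LK]]]]] := levy_khintchine (- g a) nufin a_gt0.
pose psi := laplace_exponent_formula gamma sigma m.
have alg (x y c i b : R) : (x - c * b) * i = (x - c * y) * i + c * ((y - b) * i) by ring.
(* With c = z/a the quotient is that of [ultralimit_lkphi] plus c (u_t(a) - a)/t, whose limit is - c
   g(a): hence the value b = - g a in [levy_khintchine]. *)
have ulim z : 0 < z -> (u t z - z) / t @[t --> U] --> p - psi z.
  move=> z_gt0; have za : z / a * a = z by rewrite divfK// gt_eqF.
  have c0 : 0 < z / a by rewrite divr_gt0.
  have := LK _ c0; rewrite za -/psi => <-.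
  have h1 := nuE _ c0; have h2 : (u t a - a) / t @[t --> U] --> - g a.
    by move=> B /(du _ z0a); exact: U0.
  have -> : (fun t => (u t z - z) / t) = (fun t => (u t (z / a * a) - z / a * u t a) / t + z / a * ((u t a - a) / t)).
    apply/funext => t; have -> : u t (z / a * a) = u t z by rewrite za.
    by rewrite (_ : u t z - z = u t z - z / a * a); [exact: alg|rewrite za].
  by apply: cvgD => //; apply: cvgM => //; exact: cvg_cst.
have gpsi z : z0 < z -> g z = psi z - p.
  move=> zz; have z_gt0 : 0 < z by exact: le_lt_trans zz.
  have h2 : (u t z - z) / t @[t --> U] --> - g z by move=> B /(du _ zz); exact: U0.
  by apply: oppr_inj; rewrite opprB; apply: (cvg_unique _ h2 (ulim _ z_gt0)).
have psi_cont (z : R) : 0 < z -> {for z, continuous psi} by exact: lef_continuous.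
have psi0 : psi 0 = 0 by exact: lef0.
have psi_mono (z1 z2 : R) : 0 < z1 -> z1 <= z2 -> psi z1 * z2 <= psi z2 * z1 by exact: lef_div_mono.
have psi_rc : psi x @[x --> z0^'+] --> psi z0 by exact: lef_right_continuous.
exists psi, p; split => //.
- exists gamma, sigma, m; split => //; split => //.
  apply: (lef_not_subordinator mL a_gt0).
  exact: (psi_gt0 gpos p_ge0 gpsi).
- exact: (integral_inv_psi z0_ge0 z0theta gC1 gpos gpinfty gint p_ge0 psi0 psi_cont psi_mono gpsi).
- exists u; split; last first.
    move=> x t lam x0 t0 lam0.
    have := LapE P Xcadlag x t0 lam0; rewrite LapC//= => <-.
    by apply: eq_integral => w _; rewrite /Lint; case: ifP.
  move=> lam lam0; split; [exact: u0|by move=> t t0; exact: u_ge0|exact: ucvgt|].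
  move=> t t0; move: lam0; rewrite le_eqVlt => /predU1P[<-|lam0]; last first.
    exact: (ode_pos UP U0 u_gt0 uD ucont psi_cont ulim).
  have B0 : 0 <= z0 + 1 by rewrite addr_ge0.
  apply: (ode_zero UP U0 u_gt0 uD ucont psi_cont ulim B0) => //.
  - exact: lef_clip_continuous.
  - by move=> s s0; exact: u_ge0.
  (* u_s(1/(n+1)) <= u_s(a) <= a, because the flow decreases in time; this is the bound B = z0 +
     1. *)
  move=> s n s0; apply: (@le_trans _ _ (u s a)).
    apply: umono => //; rewrite /a; apply: (@le_trans _ _ 1).
      by rewrite invf_le1// ler1n.
    by rewrite lerDr.
  rewrite uabove// -[leRHS](flow0 GamK z0a) /fl /flow.
  rewrite (Gam_le (invg_primitive_mono z0theta gC1 gpos) Gam0 GK).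
  by rewrite lerD2l lerN2.
- split; first exact: (rc_inverse_psi z0_ge0 gC1 gpos gz0 p_ge0 psi0 psi_rc psi_mono gpsi).
  move=> z; rewrite le_eqVlt => /predU1P[<-|]; last exact: gpsi.
  by rewrite gz0 (psi_z0 gC1 gz0 psi_rc gpsi) subrr.
Unshelve. all: by end_near. Qed.
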